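(* Let $D=\{\beta_1\succ\dots\succ\beta_t\}\subset\Phi^+$ ($t\ge 1$) be an orthogonal rook placement, $\xi=(\xi_\beta)_{\beta\in D}$ a family of nonzero elements of $\mathbb{F}_q$, $\Omega=\Omega_{D,\xi}$ the associated coadjoint orbit of $U$, and $\chi=\chi_\Omega$ the corresponding irreducible character of $U$. Let $U_1$, $V'$, $\psi$, $\widetilde U$ and $\widetilde\chi$ be the objects attached to $(D,\xi)$ in the context, and put $\pi^{U_1\rtimes V'}_{\widetilde U}=\pi^{V'}_{\widetilde U}\circ\pi^{U_1\rtimes V'}_{V'}$. Then $$\chi=\mathrm{Ind}_{U_1\rtimes V'}^{U}\Big(\big(\psi\circ\pi^{U_1\rtimes V'}_{U_1}\big)\cdot\big(\widetilde\chi\circ\pi^{U_1\rtimes V'}_{\widetilde U}\big)\Big).$$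
   Context: **Group and Lie algebra.** Let $n\ge1$, $m=2n$, and let $\mathbb{F}_q$ be a finite field of characteristic $p\ge 2n$. Let $\Phi=C_n$ with positive roots $\Phi^+=\{\epsilon_i\pm\epsilon_j: 1\le i<j\le n\}\cup\{2\epsilon_i:1\le i\le n\}\subset\mathbb{R}^n$ ($\epsilon_i$ the standard basis, standard inner product). Index rows and columns of $m\times m$ matrices by $1,2,\dots,n,-n,\dots,-2,-1$, with elementary matrices $e_{a,b}$. Put $e_{2\epsilon_i}=e_{-i,i}$, $e_{\epsilon_i-\epsilon_j}=e_{j,i}-e_{-i,-j}$, $e_{\epsilon_i+\epsilon_j}=e_{-j,i}+e_{-i,j}$ ($i<j$). Let $\mathfrak{u}=\mathfrak u(C_n)\subset\mathfrak{gl}_m(\mathbb{F}_q)$ be the Lie algebra with basis $e_\alpha$, $\alpha\in\Phi^+$, and $U=\exp(\mathfrak{u})$, a maximal unipotent subgroup of $\mathrm{Sp}_{2n}(\mathbb F_q)$. Here $\exp(x)=\sum_{i=0}^{m-1}x^i/i!$, and $\ln:U\to\mathfrak u$ is the inverse of $\exp:\mathfrak u\to U$. Let $\{e_\alpha^*\}$ be the basis of $\mathfrak u^*$ dual to $\{e_\alpha\}$. The group $U$ acts on $\mathfrak u^*$ by the coadjoint action $(g.f)(x)=f(g^{-1}xg)$. Root systems of rank $0$ are empty and their groups trivial. **Rows, columns, order.** $\mathrm{col}(\epsilon_i\pm\epsilon_j)=\mathrm{col}(2\epsilon_i)=i$, $\mathrm{row}(\epsilon_i\pm\epsilon_j)=\mp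 j$ (so $\mathrm{row}(\epsilon_i-\epsilon_j)=j$, $\mathrm{row}(\epsilon_i+\epsilon_j)=-j$), $\mathrm{row}(2\epsilon_i)=-i$. Let $R_i=\{\alpha\in\Phi^+:\mathrm{row}(\alpha)=i\}$, $C_j=\{\alpha\in\Phi^+:\mathrm{col}(\alpha)=j\}$. Order indices by $1\prec2\prec\dots\prec n\prec-n\prec\dots\prec-1$, and roots by: $\alpha\prec\beta$ iff $\mathrm{col}(\beta)\prec\mathrm{col}(\alpha)$, or $\mathrm{col}(\beta)=\mathrm{col}(\alpha)$ and $\mathrm{row}(\beta)\prec\mathrm{row}(\alpha)$. (So $\beta_1$ is the root of $D$ with the smallest column.) **Orthogonal rook placements and orbits.** An orthogonal rook placement is a set $D\subset\Phi^+$ of pairwise orthogonal roots with $|D\cap R_i|\le1$ and $|D\cap C_j|\le1$ for all $i,j$. For nonzero constants $\xi=(\xi_\beta)_{\beta\in D}$ put $f=f_{D,\xi}=\sum_{\beta\in D}\xi_\beta e_\beta^*$, and let $\Omega_{D,\xi}$ be its coadjoint orbit (for $D=\varnothing$, $f=0$). **Characters.** Fix a nontrivial homomorphism $\theta:(\mathbb{F}_q,+)\to\mathbb{C}^\times$. To a coadjoint orbit $\Omega$ corresponds the irreducible complex character $\chi_\Omega(g)=|\Omega|^{-1/2}\sum_{f'\in\Omega}\theta(f'(\ln g))$ of $U$; the same construction applies to the smaller groups below. **Singular roots.** For $\beta\in\Phi^+$, $S(\beta)=\{\alpha\in\Phi^+:\beta-\alpha\in\Phi^+\}$. Let $S^+(2\epsilon_i)=\{\epsilon_i+\epsilon_k:i<k\le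 n\}$ and $S^+(\beta)=S(\beta)\cap C_{\mathrm{col}(\beta)}$ if $\beta$ is not of the form $2\epsilon_i$; $S^-(\beta)=S(\beta)\setminus S^+(\beta)$. **Subgroups attached to $D$.** Let $C'=C_1\setminus\{\epsilon_1-\epsilon_2,\dots,\epsilon_1-\epsilon_n\}$ if $D\cap C_1=\{2\epsilon_1\}$, and $C'=C_1$ otherwise. Put $\mathfrak u_1=\bigoplus_{\alpha\in C'}\mathbb F_q e_\alpha$, $U_1=\exp(\mathfrak u_1)$. Define $\psi:U_1\to\mathbb C^\times$ by $\psi(x)=\theta(f(\ln x))$, i.e. $\psi(x)=\theta(\xi_{\beta_1}x_{i,1})$ if $\mathrm{col}(\beta_1)=1$, $\mathrm{row}(\beta_1)=i$, and $\psi(x)=1$ if $\mathrm{col}(\beta_1)>1$. Let $\Phi_1^+=\Phi^+\setminus C_1$ if $\mathrm{col}(\beta_1)>1$ and $\Phi_1^+=\Phi^+\setminus(C_1\cup S^-(\beta_1))$ if $\mathrm{col}(\beta_1)=1$. Let $V'=\exp\big(\bigoplus_{\alpha\in\Phi_1^+}\mathbb F_qe_\alpha\big)$. Then $V'$ is a group normalizing $U_1$, $U_1\cap V'=1$, and $U_1\rtimes V'=U_1V'\subset U$. Let $\Phi_2^+=\Phi_1^+\setminus S^-(\epsilon_1\pm\epsilon_i)$ if $\beta_1=\epsilon_1\mp\epsilon_i$ with $2\le i\le n$ (opposite signs), and $\Phi_2^+=\Phi_1^+$ otherwise. Put $V_1=\exp\big(\bigoplus_{\alpha\in\Phi_1^+\setminus\Phi_2^+}\mathbb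 F_qe_\alpha\big)$, $\widetilde{\mathfrak u}=\bigoplus_{\alpha\in\Phi_2^+}\mathbb F_qe_\alpha$, $\widetilde U=\exp(\widetilde{\mathfrak u})$; then $V'=V_1\rtimes\widetilde U$. **Projections.** For a semidirect product $\mathcal G=A\rtimes B$ with $A$ normal, each $g\in\mathcal G$ is uniquely $g=ab$ with $a\in A,b\in B$; $\pi^{\mathcal G}_A(g)=a$, $\pi^{\mathcal G}_B(g)=b$. **The character $\widetilde\chi$.** Let $\widetilde\Phi=C_{n-1}$ if $\mathrm{col}(\beta_1)>1$ or $D\cap C_1=\{2\epsilon_1\}$, and $\widetilde\Phi=C_{n-2}$ otherwise. The order-preserving relabelling of the indices occurring in $\Phi_2^+$ (namely $\{2,\dots,n\}$, or $\{2,\dots,n\}\setminus\{i\}$ when $\beta_1=\epsilon_1\pm\epsilon_i$) gives a bijection $\pi:\Phi_2^+\to\widetilde\Phi^+$, and $e_\alpha\mapsto e_{\pi(\alpha)}$ gives a Lie algebra isomorphism $\widetilde{\mathfrak u}\cong\mathfrak u(\widetilde\Phi)$. Put $\widetilde D=\pi(D\setminus C_1)$ and let $\widetilde\xi$ be $\xi$ if $\mathrm{col}(\beta_1)>1$ and $(\xi_{\beta_2},\dots,\xi_{\beta_t})$ if $\mathrm{col}(\beta_1)=1$ (transported via $\pi$). Then $\widetilde\Omega=\Omega_{\widetilde D,\widetilde\xi}$ is the associated coadjoint orbit, and $\widetilde\chi$ is the irreducible character of $\widetilde U$ corresponding to $\widetilde\Omega$ under this isomorphism. *)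

(* Defs.v *)
From HB Require Import structures.
From mathcomp Require Import all_boot all_order all_algebra all_fingroup.
From mathcomp Require Import all_solvable all_field all_character.

Set Implicit Arguments.
Unset Strict Implicit.
Unset Printing Implicit Defensive.

Import GRing.Theory Num.Theory.
Local Open Scope ring_scope.

(* Positive roots of C_r; the paper's index i in {1, ..., r} is the ordinal   *)
(* i - 1 : 'I_r.                                                              *)
Inductive pos_root (r : nat) : Type :=
| eps_sub (i j : 'I_r) of (i < j)%N   (* eps_i - eps_j *)
| eps_add (i j : 'I_r) of (i < j)%N   (* eps_i + eps_j *)
| eps_dbl (i : 'I_r).                 (* 2 eps_i *)

Local Notation root_code r :=
  ({ij : 'I_r * 'I_r | (ij.1 < ij.2)%N} + {ij : 'I_r * 'I_r | (ij.1 < ij.2)%N}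
   + 'I_r)%type.

Definition encode_root r (a : pos_root r) : root_code r :=
  match a with
  | eps_sub i j h => inl (inl (exist _ (i, j) h))
  | eps_add i j h => inl (inr (exist _ (i, j) h))
  | eps_dbl i => inr i
  end.

Definition decode_root r (c : root_code r) : pos_root r :=
  match c with
  | inl (inl (exist ij h)) => eps_sub h
  | inl (inr (exist ij h)) => eps_add h
  | inr i => eps_dbl i
  end.

Lemma encode_rootK r : cancel (@encode_root r) (@decode_root r).
Proof. by case. Qed.

HB.instance Definition _ r :=
  Finite.copy (pos_root r) (can_type (@encode_rootK r)).

(* The vector of Z^r (inside R^r) underlying a root. *)
Definition root_vec r (a : pos_root r) : 'rV[int]_r :=
  match a with
  | eps_sub i j _ => delta_mx 0 i - delta_mx 0 j
  | eps_add i j _ => delta_mx 0 i + delta_mx 0 j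
  | eps_dbl i => delta_mx 0 i *+ 2
  end.

Definition dotv r (v w : 'rV[int]_r) : int := \sum_(k < r) v 0 k * w 0 k.

Definition root_orth r (a b : pos_root r) : bool :=
  dotv (root_vec a) (root_vec b) == 0.

(* Matrices of size 2r. The indices 1 < ... < r < -r < ... < -1 are the       *)
(* positions 0 < ... < r-1 < r < ... < 2r-1, so that the order of the paper   *)
(* is the order of ordinals. The size is written (2r).-1.+1, as {'GL_(2r)}    *)
(* does; it only differs from 2r when r = 0, where there are no roots and     *)
(* all the objects below are trivial.                                         *)
Notation idx r := 'I_((r.*2).-1.+1).
Notation mat F r := 'M[F]_((r.*2).-1.+1).

Definition pidx r (i : 'I_r) : idx r := inord i.
Definition nidx r (i : 'I_r) : idx r := rev_ord (pidx i).

Definition root_col r (a : pos_root r) : idx r :=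
  match a with
  | eps_sub i _ _ => pidx i
  | eps_add i _ _ => pidx i
  | eps_dbl i => pidx i
  end.

Definition root_row r (a : pos_root r) : idx r :=
  match a with
  | eps_sub _ j _ => pidx j
  | eps_add _ j _ => nidx j
  | eps_dbl i => nidx i
  end.

Definition Rset r (i : idx r) : {set pos_root r} := [set a | root_row a == i].
Definition Cset r (j : idx r) : {set pos_root r} := [set a | root_col a == j].

Definition root_lt r (a b : pos_root r) : bool :=
  (root_col b < root_col a)%N ||
  ((root_col b == root_col a) && (root_row b < root_row a)%N).
Definition root_gt r (a b : pos_root r) : bool := root_lt b a.

Definition orthogonal_rook_placement r (D : {set pos_root r}) : Prop :=
  [/\ {in D &, forall a b, a != b -> root_orth a b},
      forall i, (#|D :&: Rset i| <= 1)%N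
    & forall j, (#|D :&: Cset j| <= 1)%N].

Definition singular r (b : pos_root r) : {set pos_root r} :=
  [set a | [exists c, root_vec b - root_vec a == root_vec c]].

Definition splus r (b : pos_root r) : {set pos_root r} :=
  match b with
  | eps_dbl i =>
      [set a | if a is eps_add i' _ _ then i' == i else false]
  | _ => singular b :&: Cset (root_col b)
  end.

Definition sminus r (b : pos_root r) : {set pos_root r} :=
  singular b :\: splus b.

Definition root_mx (F : finFieldType) r (a : pos_root r) : mat F r :=
  match a with
  | eps_sub i j _ => delta_mx (pidx j) (pidx i) - delta_mx (nidx i) (nidx j)
  | eps_add i j _ => delta_mx (nidx j) (pidx i) + delta_mx (nidx i) (pidx j)
  | eps_dbl i => delta_mx (nidx i) (pidx i)
  end.

Definition lie_span (F : finFieldType) r (A : {set pos_root r}) :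
    {set mat F r} :=
  [set \sum_(a in A) c a *: root_mx F a | c : {ffun pos_root r -> F}].

Definition lie_u (F : finFieldType) r : {set mat F r} :=
  lie_span F [set: pos_root r].

Definition exp_mx (F : finFieldType) r (x : mat F r) : mat F r :=
  \sum_(i < (r.*2).-1.+1) (i`!%:R)^-1 *: x ^+ i.

(* The default value 1 is never used: exp_mx x is invertible when x is        *)
(* nilpotent.                                                                 *)
Definition exp_gl (F : finFieldType) r (x : mat F r) : {'GL_(r.*2)[F]} :=
  insubd (1%g : {'GL_(r.*2)[F]}) (exp_mx x).

Definition exp_span (F : finFieldType) r (A : {set pos_root r}) :
    {set {'GL_(r.*2)[F]}} :=
  [set exp_gl x | x in lie_span F A].

Definition group_U (F : finFieldType) r : {set {'GL_(r.*2)[F]}} :=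
  exp_span F [set: pos_root r].

(* The inverse of exp : u -> U, with the junk value 0 outside U.              *)
Definition ln_gl (F : finFieldType) r (g : {'GL_(r.*2)[F]}) : mat F r :=
  odflt 0 [pick x in lie_u F r | exp_gl x == g].

(* For x in u this is the coordinate of x along e_a: see root_coord_mx.       *)
Definition root_coord (F : finFieldType) r (a : pos_root r) (x : mat F r) : F :=
  x (root_row a) (root_col a).

(* The dual space u^*, in the basis (e_a^* )_a dual to (e_a)_a.               *)
Notation udual F r := {ffun pos_root r -> F}.

Definition dual_eval (F : finFieldType) r (f : udual F r) (x : mat F r) : F :=
  \sum_a f a * root_coord a x.

Definition dual_root (F : finFieldType) r (b : pos_root r) : udual F r :=
  [ffun a => (a == b)%:R].

(* See coadjE for the defining property (g.f)(x) = f(g^-1 x g).               *)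
Definition coadj (F : finFieldType) r (g : {'GL_(r.*2)[F]}) (f : udual F r) :
    udual F r :=
  [ffun a => dual_eval f (GLval g^-1 *m root_mx F a *m GLval g)].

Definition coadj_orbit (F : finFieldType) r (f : udual F r) : {set udual F r} :=
  [set coadj g f | g in group_U F r].

Definition rook_form (F : finFieldType) r (D : {set pos_root r})
    (xi : pos_root r -> F) : udual F r :=
  \sum_(b in D) [ffun a => xi b * dual_root F b a].

Definition rook_orbit (F : finFieldType) r (D : {set pos_root r})
    (xi : pos_root r -> F) : {set udual F r} :=
  coadj_orbit (rook_form D xi).

Definition nontrivial_add_char (F : finFieldType) (theta : F -> algC) : Prop :=
  [/\ theta 0 = 1, {morph theta : x y / x + y >-> x * y}
    & exists x, theta x != 1].

Definition orbit_char (F : finFieldType) r (theta : F -> algC)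
    (Omega : {set udual F r}) (g : {'GL_(r.*2)[F]}) : algC :=
  (sqrtC #|Omega|%:R)^-1 * \sum_(f in Omega) theta (dual_eval f (ln_gl g)).

(* Below D is a rook placement, b1 its largest root (smallest column), and    *)
(* ord0 is the index 1.                                                       *)

Definition col1_is_long n (D : {set pos_root n.+1}) : bool :=
  D :&: Cset ord0 == [set eps_dbl ord0].

Definition Cprime n (D : {set pos_root n.+1}) : {set pos_root n.+1} :=
  if col1_is_long D
  then Cset ord0 :\: [set a | if a is eps_sub i _ _ then i == ord0 else false]
  else Cset ord0.

Definition Phi1 n (b1 : pos_root n.+1) : {set pos_root n.+1} :=
  if root_col b1 == ord0 then ~: (Cset ord0 :|: sminus b1) else ~: Cset ord0.

Definition Phi2 n (b1 : pos_root n.+1) : {set pos_root n.+1} :=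
  if root_col b1 == ord0 then
    match b1 with
    | eps_sub i j h => Phi1 b1 :\: sminus (eps_add h)
    | eps_add i j h => Phi1 b1 :\: sminus (eps_sub h)
    | eps_dbl _ => Phi1 b1
    end
  else Phi1 b1.

Definition group_U1 (F : finFieldType) n (D : {set pos_root n.+1}) :=
  exp_span F (Cprime D).

Definition group_Vprime (F : finFieldType) n (b1 : pos_root n.+1) :=
  exp_span F (Phi1 b1).

Definition group_V1 (F : finFieldType) n (b1 : pos_root n.+1) :=
  exp_span F (Phi1 b1 :\: Phi2 b1).

Definition group_Utilde (F : finFieldType) n (b1 : pos_root n.+1) :=
  exp_span F (Phi2 b1).

Definition psi (F : finFieldType) n (theta : F -> algC)
    (D : {set pos_root n.+1}) (xi : pos_root n.+1 -> F)
    (x : {'GL_(n.+1.*2)[F]}) : algC :=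
  theta (dual_eval (rook_form D xi) (ln_gl x)).

(* The indices occurring in Phi2.                                             *)
Definition rest_idx n (b1 : pos_root n.+1) : {set 'I_n.+1} :=
  if root_col b1 == ord0 then
    match b1 with
    | eps_sub _ j _ => ~: [set ord0; j]
    | eps_add _ j _ => ~: [set ord0; j]
    | eps_dbl _ => ~: [set ord0]
    end
  else ~: [set ord0].

(* The rank of the root system of u~: see rank_tildeE.                        *)
Definition rank_tilde n (b1 : pos_root n.+1) : nat := #|rest_idx b1|.

Lemma enum_val_ltn n (A : {set 'I_n}) (i j : 'I_#|A|) :
  (i < j)%N -> (enum_val i < enum_val j)%N.
Proof.
move=> ij; have srt: sorted ltn (map val (enum A)).
  apply: (subseq_sorted ltn_trans _ (iota_ltn_sorted 0 n)).
  by rewrite -val_enum_ord map_subseq // enumT {1}/enum_mem filter_subseq.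
have sz k : (k < #|A|)%N -> (k < size (map val (enum A)))%N.
  by rewrite size_map -cardE.
have := sorted_ltn_nth ltn_trans 0%N srt.
move=> /(_ i j (sz i (ltn_ord i)) (sz j (ltn_ord j)) ij).
by rewrite !(nth_map (enum_default i)) -?cardE // !(enum_val_nth (enum_default i)).
Qed.

(* The inverse of the order-preserving relabelling pi of the roots: enum_val  *)
(* is increasing on ordinals.                                                 *)
Definition unrelabel n (b1 : pos_root n.+1) (a : pos_root (rank_tilde b1)) :
    pos_root n.+1 :=
  match a with
  | eps_sub i j h => eps_sub (enum_val_ltn h)
  | eps_add i j h => eps_add (enum_val_ltn h)
  | eps_dbl i => eps_dbl (enum_val i)
  end.

Definition Dtilde n (D : {set pos_root n.+1}) (b1 : pos_root n.+1) :
    {set pos_root (rank_tilde b1)} :=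
  @unrelabel n b1 @^-1: (D :\: Cset ord0).

Definition xitilde (F : finFieldType) n (b1 : pos_root n.+1)
    (xi : pos_root n.+1 -> F) (a : pos_root (rank_tilde b1)) : F :=
  xi (unrelabel a).

(* The isomorphism e_(pi^-1 a) |-> e_a from u~ to u(C_(rank_tilde b1)).       *)
Definition lie_relabel (F : finFieldType) n (b1 : pos_root n.+1)
    (x : mat F n.+1) : mat F (rank_tilde b1) :=
  \sum_a root_coord (unrelabel a) x *: root_mx F a.

Definition chi_tilde (F : finFieldType) n (theta : F -> algC)
    (D : {set pos_root n.+1}) (b1 : pos_root n.+1) (xi : pos_root n.+1 -> F)
    (g : {'GL_(n.+1.*2)[F]}) : algC :=
  orbit_char theta (rook_orbit (Dtilde D b1) (xitilde xi))
    (exp_gl (lie_relabel b1 (ln_gl g))).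

(* For G = A ><| B and g = a b, divgr A B g = a and remgr A B g = b.          *)
Definition inducing_fun (F : finFieldType) n (theta : F -> algC)
    (D : {set pos_root n.+1}) (b1 : pos_root n.+1) (xi : pos_root n.+1 -> F)
    (g : {'GL_(n.+1.*2)[F]}) : algC :=
  let U1 := group_U1 F D in let V' := group_Vprime F b1 in
  let V1 := group_V1 F b1 in let Ut := group_Utilde F b1 in
  psi theta D xi (divgr U1 V' g)
  * chi_tilde theta D b1 xi (remgr V1 Ut (remgr U1 V' g)).

Lemma val_pidx r (i : 'I_r) : pidx i = i :> nat.
Proof.
rewrite /pidx inordK //; case: r i => [[]//|r i]; rewrite doubleS /=.
by apply: leq_trans (ltn_ord i) _; rewrite -addnn !ltnS leqW // leq_addr.
Qed.

Lemma val_nidx r (i : 'I_r) : nidx i = (r.*2 - i.+1)%N :> nat.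
Proof. by rewrite /nidx /= val_pidx; case: r i => [[]|]. Qed.

Lemma pidx_inj r : injective (@pidx r).
Proof. by move=> i j /(congr1 val) /=; rewrite !val_pidx => /val_inj. Qed.

Lemma nidx_inj r : injective (@nidx r).
Proof. by move=> i j /rev_ord_inj/pidx_inj. Qed.

Lemma nidx_pidx r (i j : 'I_r) : (nidx i == pidx j) = false.
Proof.
apply/negP => /eqP /(congr1 (@nat_of_ord _)).
rewrite val_nidx val_pidx => eq_ij.
have := ltn_ord j; rewrite -eq_ij ltnNge -addnn -addnBA ?ltn_ord //.
by rewrite leq_addr.
Qed.

Lemma rank_tildeE n (b1 : pos_root n.+1) :
  rank_tilde b1 =
    if (root_col b1 != ord0) || (b1 == eps_dbl ord0) then n else n.-1.
Proof.
have p0 (i : 'I_n.+1) : (pidx i == ord0) = (i == ord0).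
  by rewrite -(inj_eq (@ord_inj _)) val_pidx.
have c1 : #|~: [set (ord0 : 'I_n.+1)]| = n by rewrite cardsC1 card_ord.
have c2 (i j : 'I_n.+1) : (i < j)%N -> #|~: [set ord0; j]| = n.-1.
  move=> ij; have := cardsC [set ord0; j].
  rewrite cards2 card_ord; case: eqVneq => [j0|_]; first by rewrite -j0 in ij.
  by move/(congr1 (subn^~ 2)); rewrite addKn subSS subn1.
rewrite /rank_tilde /rest_idx; case: eqVneq => [|//] /=.
case: b1 => [i j ij|i j ij|i] /=.
- by rewrite (c2 _ _ ij).
- by rewrite (c2 _ _ ij).
- by move=> /eqP; rewrite p0 => /eqP ->; rewrite eqxx.
Qed.

Lemma root_coord_mx (F : finFieldType) r (a b : pos_root r) :
  root_coord a (root_mx F b) = (a == b)%:R.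
Proof.
have pn (i j : 'I_r) : (pidx i == nidx j) = false by rewrite eq_sym nidx_pidx.
have code : (a == b) = (encode_root a == encode_root b) by [].
have E := (inj_eq (@pidx_inj r), inj_eq (@nidx_inj r), nidx_pidx, pn).
rewrite /root_coord code.
case: a b {code} => [i j ij|i j ij|i] [k l kl|k l kl|k] /=; rewrite !mxE !E /=;
  rewrite ?andbF ?subr0 ?addr0 ?add0r //=.
- by congr (_%:R); rewrite andbC.
- suff -> : (j == k) && (i == l) = false.
    by rewrite addr0; congr (_%:R); rewrite andbC.
  apply/andP => -[/eqP jk /eqP il].
  by move: kl; rewrite -jk -il ltnNge ltnW.
- suff -> : (j == k) && (i == k) = false by [].
  by apply/andP => -[/eqP jk /eqP ik]; move: ij; rewrite jk ik ltnn.
- rewrite andbC; suff -> : (i == k) && (i == l) = false by rewrite addr0.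
  by apply/andP => -[/eqP ik /eqP il]; move: kl; rewrite -ik -il ltnn.
- by rewrite andbb.
Qed.

Lemma dual_eval_sum (F : finFieldType) r (f : udual F r)
    (c : pos_root r -> F) (M : pos_root r -> mat F r) :
  dual_eval f (\sum_a c a *: M a) = \sum_a c a * dual_eval f (M a).
Proof.
rewrite /dual_eval; under eq_bigr do rewrite /root_coord summxE mulr_sumr.
rewrite exchange_big; apply: eq_bigr => a _; rewrite mulr_sumr.
by apply: eq_bigr => b _; rewrite mxE mulrCA.
Qed.

Lemma dual_eval_mx (F : finFieldType) r (f : udual F r) (a : pos_root r) :
  dual_eval f (root_mx F a) = f a.
Proof.
rewrite /dual_eval (bigD1 a) //= root_coord_mx eqxx mulr1 big1 ?addr0 // => b.
by rewrite root_coord_mx => /negPf ->; rewrite mulr0.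
Qed.

Lemma coadjE (F : finFieldType) r (g : {'GL_(r.*2)[F]}) (f : udual F r) :
  {in lie_u F r, forall x,
    dual_eval (coadj g f) x = dual_eval f (GLval g^-1 *m x *m GLval g)}.
Proof.
move=> _ /imsetP[c _ ->].
have -> : \sum_(a in [set: pos_root r]) c a *: root_mx F a
        = \sum_a c a *: root_mx F a by apply: eq_bigl => a; rewrite inE.
rewrite mulmx_sumr mulmx_suml dual_eval_sum.
under [in RHS]eq_bigr do rewrite -scalemxAr -scalemxAl.
rewrite dual_eval_sum; apply: eq_bigr => a _.
by rewrite dual_eval_mx ffunE.
Qed.

(* Main.v *)
Require Import Defs.
From HB Require Import structures.
From mathcomp Require Import all_boot all_order all_algebra all_fingroup.
From mathcomp Require Import all_solvable all_field all_character.
From mathcomp Require Import zify ring.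

Set Implicit Arguments.
Unset Strict Implicit.
Unset Printing Implicit Defensive.

Import GRing.Theory Num.Theory.
Local Open Scope ring_scope.

(** The proof is the orbit method turned into an induction from a block of the
    orbit.

    Write q for the order of the field, Lie(H) for the span of Psi, the union of
    C' and Phi1, so that H = U1 V' = exp Lie(H), and c for the number of positive
    roots outside Psi. Let the block consist of the functionals on u whose
    restriction to Lie(H) is the sum of the functional defining psi and of a point
    of the smaller orbit, pulled back along the projection to the Lie algebra of
    the group U-tilde. Then the block
    - is contained in the orbit Omega (block_sub_orbit),
    - is stable under H (block_stable),
    - is moved off itself by every element of U outside H (block_return),
    - is invariant under the functionals vanishing on Lie(H), so that the sum over
      the block of theta (f (ln g)) is 0 for g outside H (block_sum_vanish).
    Hence the translates of the block by U / H tile Omega, and summing over them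
    shows that the orbit character is induced from the function on H obtained by
    summing over the block (Ind_block). That function is the inducing function of
    the theorem (block_sum_restrict, inducing_funE); the normalizing factors agree
    because counting the tiling gives |Omega| = q^(2c) times the size of the
    smaller orbit.

    The real content is in the first and third properties. Both express that the
    pairing (x, v) |-> f [x, v] is nondegenerate between u / Lie(H) and the
    elements v of the first column (first_coord_border). To make this visible,
    everything is read off the row iota of the matrices that contains the entry
    of b1: Lie(H) is cut out of u by the vanishing of x iota b at a few columns b,
    called blocked below. The action of exp v adds to f the sum of
    x iota b * v b 1 over the blocked b, times a nonzero factor: twice the
    coefficient xi b1 when b1 is a long root, this coefficient itself otherwise.
    If b1 is not in the first column, no column is blocked, H is the whole of U and
    the block is Omega.

    The same description replaces the Baker-Campbell-Hausdorff formula. The spans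
    of roots that occur are the intersections of u with the matrices supported by
    a transitive strictly lower triangular pattern T. On matrices supported by T
    the exponential is injective, hence by finiteness a bijection onto their
    translate by 1 (exp_mx_onto), and skewness for the symplectic form is read off
    the exponential (symp_unitri_exp). So membership in exp of such a span is the
    vanishing of some entries, which is visibly preserved by products
    (exp_span_patternP). The projections onto V' and U-tilde, and the relabelling
    isomorphism, erase indices through which no two composable steps of the pattern
    lead from one surviving index to another; they are thus multiplicative (middleM, deleteM) and commute
    with the exponential. Likewise the entry of b1 is never reached in two steps,
    which makes it additive on H and psi a character. *)

(** * Matrices supported by a pattern *)

Section Pattern.

Variables (F : finFieldType) (m : nat).
Implicit Types (x y : 'M[F]_m.+1) (T : rel 'I_m.+1).

Definition strict_pattern T : Prop :=
  transitive T /\ forall a b, T a b -> (b < a)%N.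

Definition supported T : {pred 'M[F]_m.+1} :=
  fun x => [forall a, forall b, ~~ T a b ==> (x a b == 0)].

Definition gtI : rel 'I_m.+1 := fun a b => (b < a)%N.

Lemma supportedP T x :
  reflect (forall a b, ~~ T a b -> x a b = 0) (x \in supported T).
Proof.
apply: (iffP forallP) => [h a b nT | h a].
  by apply/eqP; move: (h a) => /forallP/(_ b)/implyP; apply.
by apply/forallP => b; apply/implyP => nT; apply/eqP/h.
Qed.

Lemma supported_subset T T' x :
  subrel T T' -> x \in supported T -> x \in supported T'.
Proof.
move=> sT /supportedP h; apply/supportedP => a b nT.
by apply: h; apply: contra nT; apply: sT.
Qed.

Lemma supported0 T : 0 \in supported T.
Proof. by apply/supportedP => a b _; rewrite mxE. Qed.

Lemma supportedD T x y :
  x \in supported T -> y \in supported T -> x + y \in supported T.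
Proof.
by move=> /supportedP hx /supportedP hy; apply/supportedP => a b n;
   rewrite mxE hx // hy // addr0.
Qed.

Lemma supportedZ T c x : x \in supported T -> c *: x \in supported T.
Proof.
by move=> /supportedP hx; apply/supportedP => a b n; rewrite mxE hx // mulr0.
Qed.

Lemma supportedN T x : x \in supported T -> - x \in supported T.
Proof. by rewrite -scaleN1r; exact: supportedZ. Qed.

Lemma supportedB T x y :
  x \in supported T -> y \in supported T -> x - y \in supported T.
Proof. by move=> hx hy; apply: supportedD => //; apply: supportedN. Qed.

Lemma supported_sum T (I : Type) (r : seq I) (P : pred I) (f : I -> 'M[F]_m.+1) :
  (forall i, P i -> f i \in supported T) -> \sum_(i <- r | P i) f i \in supported T.
Proof.
move=> h; apply: (big_ind (fun x => x \in supported T)) => //.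
  exact: supported0.
by move=> x y; exact: supportedD.
Qed.

Lemma supported_gtI T x : strict_pattern T ->
  x \in supported T -> x \in supported gtI.
Proof. by case=> _ sT; apply: supported_subset => a b /sT. Qed.

Lemma supportedM T x y : transitive T ->
  x \in supported T -> y \in supported T -> x * y \in supported T.
Proof.
move=> trT /supportedP hx /supportedP hy; apply/supportedP => a b nT.
rewrite mxE big1 // => c _; case Tac: (T a c); last by rewrite hx ?Tac ?mul0r.
by rewrite hy ?mulr0 //; apply: contra nT; apply: trT.
Qed.

Lemma supportedX T x k : transitive T ->
  x \in supported T -> x ^+ k.+1 \in supported T.
Proof.
by move=> trT hx; elim: k => [|k IH] //; rewrite exprSr; apply: supportedM.
Qed.

Lemma trans_gtI : transitive gtI.
Proof. by move=> b a c ab bc; apply: ltn_trans bc ab. Qed.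

Lemma strict_gtI : strict_pattern gtI.
Proof. by split; first exact: trans_gtI. Qed.

Lemma strict_pow_eq0 x k (a b : 'I_m.+1) :
  x \in supported gtI -> (a < b + k)%N -> (x ^+ k) a b = 0.
Proof.
move=> /supportedP hx; elim: k a => [|k IH] a lt_a.
  by rewrite expr0 mxE; case: eqP => // ab; move: lt_a; rewrite ab addn0 ltnn.
rewrite exprS mxE big1 // => c _.
have [ca|ca] := boolP (gtI a c); last by rewrite hx ?mul0r.
rewrite IH ?mulr0 //; apply: leq_trans ca _.
by move: lt_a; rewrite addnS ltnS.
Qed.

Lemma strict_nilpotent x k : x \in supported gtI -> (m < k)%N -> x ^+ k = 0.
Proof.
move=> hx mk; apply/matrixP => a b; rewrite strict_pow_eq0 ?mxE //.
by rewrite (leq_trans (ltn_ord a)) // (leq_trans mk) // leq_addl.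
Qed.

Definition agree k x y : Prop :=
  forall a b : 'I_m.+1, (a < b + k)%N -> x a b = y a b.

(** A product of strictly lower triangular matrices only involves entries that
    are strictly closer to the diagonal; this is what allows the exponential to be
    inverted one diagonal at a time. *)
Lemma agreeM k x x' y y' :
    x \in supported gtI -> x' \in supported gtI ->
    y \in supported gtI -> y' \in supported gtI ->
  agree k x x' -> agree k y y' -> agree k.+1 (x * y) (x' * y').
Proof.
move=> /supportedP hx /supportedP hx' /supportedP hy /supportedP hy' ex ey a b ab.
rewrite !mxE; apply: eq_bigr => c _.
have [ca|ca] := boolP (gtI a c); last by rewrite hx // hx' // !mul0r.
have [bc|bc] := boolP (gtI c b); last by rewrite hy // hy' // !mulr0.
rewrite /gtI in ca bc; move: ab; rewrite addnS ltnS => ab.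
rewrite ex; last by apply: leq_ltn_trans ab _; rewrite ltn_add2r.
by rewrite ey //; apply: leq_trans ca ab.
Qed.

Lemma agreeX k i x y :
  x \in supported gtI -> y \in supported gtI -> agree k x y ->
  agree k.+1 (x ^+ i.+2) (y ^+ i.+2).
Proof.
move=> hx hy exy.
suff: agree k (x ^+ i.+1) (y ^+ i.+1).
  move=> h; rewrite !(exprSr _ i.+1).
  by apply: agreeM => //; apply: supportedX => //; exact: trans_gtI.
elim: i => [|i IH]; first by rewrite !expr1.
rewrite !(exprSr _ i.+1) => a b ab.
apply: (agreeM (k := k)) => //; try (by apply: supportedX => //; exact: trans_gtI).
by apply: leq_trans ab _; rewrite leq_add2l.
Qed.

End Pattern.

Arguments gtI {m}.

(** * The truncated exponential *)

Section Exponential.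

Variables (F : finFieldType) (r : nat).
Implicit Types (x y : mat F r) (T : rel (idx r)).

Let m := (r.*2).-1.

(** The powers beyond the nilpotency index vanish. Longer sums make exponentials
    of matrices of different sizes comparable. *)
Lemma exp_mx_trunc x k : (m < k)%N -> x \in supported gtI ->
  exp_mx x = \sum_(i < k) (i`!%:R)^-1 *: x ^+ i.
Proof.
move=> mk hx; rewrite -(big_mkord xpredT (fun i => (i`!%:R)^-1 *: x ^+ i)).
rewrite (big_cat_nat (n := m.+1)) //= big_mkord.
rewrite [X in _ = _ + X]big_nat_cond [X in _ = _ + X]big1 ?addr0 //.
by move=> i /andP[/andP[lt_mi _] _]; rewrite strict_nilpotent ?scaler0.
Qed.

Lemma exp_mx_split k x : (m <= k)%N -> x \in supported gtI ->
  exp_mx x = 1 + \sum_(i < k) (i.+1`!%:R)^-1 *: x ^+ i.+1.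
Proof.
move=> mk hx; rewrite (@exp_mx_trunc x k.+1) // big_ord_recl expr0.
by rewrite invr1 scale1r.
Qed.

Lemma exp_mx_split2 x : x \in supported gtI ->
  exp_mx x = 1 + x + \sum_(i < m) (i.+2`!%:R)^-1 *: x ^+ i.+2.
Proof.
move=> hx; rewrite (@exp_mx_split m.+1) // big_ord_recl expr1.
by rewrite invr1 scale1r addrA.
Qed.

Lemma exp_mx_supported T x : strict_pattern T -> x \in supported T ->
  exp_mx x - 1 \in supported T.
Proof.
move=> sT hx; have hg := supported_gtI sT hx; case: sT => trT _.
rewrite (exp_mx_split (leqnn _)) // addrC addKr.
by apply: supported_sum => i _; apply/supportedZ/supportedX.
Qed.

(** If exp x = exp y and x, y agree on the first k diagonals below the main one,
    then their powers of exponent at least 2 agree on k + 1 diagonals, hence so do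
    x and y. *)
Lemma exp_mx_inj : {in supported (@gtI _) &, injective (@exp_mx F r)}.
Proof.
move=> x y hx hy exy.
suff ag k : agree k x y.
  by apply/matrixP => a b; apply: (ag a.+1); rewrite leq_addl.
elim: k => [|k IH] a b ab.
  by rewrite (supportedP _ _ hx) ?(supportedP _ _ hy) // /gtI -leqNgt;
     move: ab; rewrite addn0 => /ltnW.
move: exy; rewrite !exp_mx_split2 // -!addrA => /addrI /matrixP/(_ a b).
rewrite [X in X = _ -> _]mxE [X in _ = X -> _]mxE !summxE.
have -> : \sum_(i < m) ((i.+2`!%:R)^-1 *: x ^+ i.+2) a b
        = \sum_(i < m) ((i.+2`!%:R)^-1 *: y ^+ i.+2) a b.
  by apply: eq_bigr => i _; rewrite [LHS]mxE [RHS]mxE (agreeX (k := k) i hx hy IH ab).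
by move/addIr.
Qed.

(** For a transitive pattern T the exponential injects the finite set of
    matrices supported by T into its own translate by 1, hence onto it. This
    provides the logarithm without writing down its series. *)
Lemma exp_mx_onto T (g : mat F r) : strict_pattern T -> g - 1 \in supported T ->
  exists2 x, x \in supported T & exp_mx x = g.
Proof.
move=> sT hg; pose A := [set x : mat F r | x \in supported T].
pose f (x : mat F r) := exp_mx x - 1.
have f_inj : {in A &, injective f}.
  move=> x y; rewrite !in_set => hx hy /addIr.
  by apply: exp_mx_inj; apply: (supported_gtI sT).
have fA : f @: A = A.
  apply/eqP; rewrite eqEcard card_in_imset // leqnn andbT.
  by apply/subsetP => _ /imsetP[x xA ->]; move: xA; rewrite !in_set; apply: exp_mx_supported.
have: g - 1 \in f @: A by rewrite fA in_set.
by case/imsetP => x; rewrite in_set => hx /addIr ->; exists x.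
Qed.

Lemma exp_mx0 : exp_mx (0 : mat F r) = 1.
Proof.
rewrite (exp_mx_split (leqnn _)) ?supported0 // big1 ?addr0 // => i _.
by rewrite expr0n scaler0.
Qed.

(** The truncated exponential polynomials satisfy E(X) E(-X) = 1 up to order m,
    by the binomial expansion of (1 - 1) ^ k. *)
Lemma exp_mxN p x : p \in [pchar F] -> (r.*2 <= p)%N -> x \in supported gtI ->
  exp_mx x * exp_mx (- x) = 1.
Proof.
move=> charFp le_rp hx.
have fact_neq0 k : (k <= m)%N -> (k`!%:R : F) != 0.
  move=> km; rewrite -(dvdn_pcharf charFp).
  have pr := pcharf_prime charFp.
  apply/negP => dv; have: (p <= k)%N.
    elim: k dv {km} => [|k IH]; first by rewrite dvdn1 => /eqP p1; rewrite p1 in pr.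
    by rewrite factS Euclid_dvdM // => /orP[/dvdn_leq->//|/IH/leqW].
  move=> pk; have := leq_trans pk km; rewrite /m => pm.
  have := leq_trans le_rp pm; have := prime_gt0 pr; move: pm; clear.
  case: r => [|r'] /=; first by case: p.
  by rewrite doubleS /= ltnn.
pose E s : {poly F} := \poly_(i < m.+1) (s ^+ i / i`!%:R).
have expE s : exp_mx (s *: x) = horner_mx x (E s).
  rewrite /E poly_def rmorph_sum /=; apply: eq_bigr => i _.
  by rewrite linearZ /= rmorphXn /= horner_mx_X exprZn scalerA mulrC.
rewrite -[x in X in X * _]scale1r -scaleN1r !expE -rmorphM /=.
have -> : E 1 * E (-1) = 1 + 'X^(m.+1) * drop_poly m.+1 (E 1 * E (-1)).
  rewrite -[LHS](poly_take_drop m.+1) [_ * 'X^_]mulrC; congr (_ + _).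
  apply/polyP => k; rewrite coef_take_poly coef1.
  case: ltnP => km; last by case: k km.
  rewrite coefMr.
  transitivity ((1 - 1) ^+ k / k`!%:R : F); last first.
    by rewrite subrr expr0n; case: k km => [|k] km /=; rewrite ?mul0r ?divr1.
  rewrite exprDn mulr_suml; apply: eq_bigr => j _.
  have jk : (j <= k)%N by rewrite -ltnS.
  rewrite !coef_poly (leq_ltn_trans jk km) (leq_ltn_trans (leq_subr j k) km).
  rewrite -(bin_fact jk) !natrM !expr1n -[_ *+ 'C(k, j)]mulr_natl.
  have h1 := fact_neq0 j (leq_trans jk km).
  have h2 := fact_neq0 (k - j)%N (leq_trans (leq_subr j k) km).
  have h0 : ('C(k, j)%:R : F) != 0.
    by apply: contra_neq (fact_neq0 k km) => h; rewrite -(bin_fact jk) natrM h mul0r.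
  move: h0 h1 h2; move: ('C(k, j)%:R) (j`!%:R) ((k - j)`!%:R) ((-1) ^+ j) => c d e s.
  by move=> h0 h1 h2; field; rewrite h0 h1 h2.
rewrite rmorphD rmorph1 rmorphM /= rmorphXn /= horner_mx_X.
by rewrite strict_nilpotent // mul0r addr0.
Qed.

End Exponential.

(** * Exponentials and algebra morphisms *)

Section ExponentialMorphisms.

Variables (F : finFieldType) (r : nat).
Implicit Types (x y : mat F r).

Lemma exp_mx_conj (u v x : mat F r) : u * v = 1 -> v * u = 1 ->
  exp_mx (u * x * v) = u * exp_mx x * v.
Proof.
move=> uv vu; rewrite /exp_mx mulr_sumr mulr_suml; apply: eq_bigr => i _.
rewrite -scalerAr -scalerAl; congr (_ *: _).
elim: (i : nat) => [|k IH]; first by rewrite !expr0 mulr1.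
by rewrite !exprSr IH -!mulrA (mulrA v u) vu mul1r !mulrA.
Qed.

Variables (r' : nat) (T : rel (idx r)) (phi : {linear mat F r -> mat F r'}).
Hypothesis sT : strict_pattern T.
Hypothesis phiM :
  {in supported T &, forall x y, phi (x * y) = phi x * phi y}.

(** The morphisms phi used below erase rows and columns and do not preserve the
    unit, so they are applied to exp x - 1 rather than to exp x. *)
Lemma exp_mx_morph x : x \in supported T -> phi x \in supported gtI ->
  exp_mx (phi x) = 1 + phi (exp_mx x - 1).
Proof.
move=> hx hphi.
pose k := maxn (r.*2).-1 (r'.*2).-1.
rewrite (@exp_mx_split _ _ k) ?leq_maxr //.
rewrite (@exp_mx_split _ _ k x) ?leq_maxl ?(supported_gtI sT) //.
rewrite (addrAC 1 _ (-1)) subrr add0r linear_sum; congr (_ + _); apply: eq_bigr => i _.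
rewrite linearZ; congr (_ *: _); case: sT => trT _.
elim: (i : nat) => [|j IH]; first by rewrite !expr1.
by rewrite exprSr IH [in RHS]exprSr phiM ?supportedX.
Qed.

Lemma unital_morphM (g h : mat F r) :
    g - 1 \in supported T -> h - 1 \in supported T ->
  1 + phi (g * h - 1) = (1 + phi (g - 1)) * (1 + phi (h - 1)).
Proof.
move=> hg hh.
rewrite -{1}[g](subrK 1) -{1}[h](subrK 1).
move: (g - 1) (h - 1) hg hh => a b ha hb.
have -> : (a + 1) * (b + 1) - 1 = a * b + a + b.
  by rewrite mulrDl mul1r mulrDr mulr1 !addrA addrK.
rewrite 2!linearD phiM // mulrDl mul1r mulrDr mulr1 -[RHS]addrA; congr (1 + _).
by rewrite addrC [phi a + _]addrC.
Qed.

Lemma morph_conj (g h x : mat F r) :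
    g - 1 \in supported T -> h - 1 \in supported T -> x \in supported T ->
  phi (g * x * h) = (1 + phi (g - 1)) * phi x * (1 + phi (h - 1)).
Proof.
move=> hg hh hx; case: (sT) => trT _.
rewrite -{1}[g](subrK 1) -{1}[h](subrK 1).
move: (g - 1) (h - 1) hg hh => a b ha hb.
rewrite !(mulrDl, mulrDr, mul1r, mulr1) !linearD !phiM ?supportedM //.
by rewrite addrC; congr (_ + _); rewrite addrC.
Qed.

End ExponentialMorphisms.

(** * The symplectic adjoint and the Lie algebra u *)

Lemma rev_ord_ltn m (a b : 'I_m) : (rev_ord a < rev_ord b)%N = (b < a)%N.
Proof. by have := ltn_ord a; have := ltn_ord b => /= hb ha; apply/idP/idP; lia. Qed.

Section Symplectic.

Variables (F : finFieldType) (r : nat).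
Implicit Types (x y : mat F r).

Let m := (r.*2).-1.

Definition half_sign (a : idx r) : F := if (a < r)%N then 1 else -1.

(** The adjoint for the symplectic form whose Gram matrix is antidiagonal with
    entries half_sign; the Lie algebra u consists of the strictly lower
    triangular matrices that are skew for it. *)
Definition adj x : mat F r :=
  \matrix_(a, b) (half_sign a * half_sign b * x (rev_ord b) (rev_ord a)).

Lemma adj_is_linear : linear adj.
Proof. by move=> c x y; apply/matrixP => a b; rewrite !mxE; ring. Qed.

HB.instance Definition _ :=
  GRing.isLinear.Build F (mat F r) (mat F r) _ adj adj_is_linear.

Lemma half_sign_sq a : half_sign a * half_sign a = 1.
Proof. by rewrite /half_sign; case: ifP; rewrite ?mulrNN mulr1. Qed.

Lemma adjM x y : adj (x * y) = adj y * adj x.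
Proof.
apply/matrixP => a b; rewrite !mxE mulr_sumr (reindex_inj rev_ord_inj) /=.
apply: eq_bigr => c _; rewrite !mxE.
have := half_sign_sq c; move: (half_sign a) (half_sign b) (half_sign c) => sa sb sc sc2.
transitivity (sc * sc * (sa * sb * (x (rev_ord b) (rev_ord c) * y (rev_ord c) (rev_ord a)))).
  by rewrite sc2 mul1r.
by ring.
Qed.

Lemma adj1 : adj 1 = 1.
Proof.
apply/matrixP => a b; rewrite !mxE (inj_eq rev_ord_inj) eq_sym.
by case: eqP => [->|]; rewrite ?mulr0 // half_sign_sq mulr1.
Qed.

Lemma adjX x k : adj (x ^+ k) = adj x ^+ k.
Proof. by elim: k => [|k IH]; rewrite ?expr0 ?adj1 // exprS adjM IH exprSr. Qed.

Lemma adj_exp_mx x : adj (exp_mx x) = exp_mx (adj x).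
Proof.
by rewrite /exp_mx linear_sum; apply: eq_bigr => i _; rewrite linearZ /= adjX.
Qed.

Lemma adj_strict x : x \in supported gtI -> adj x \in supported gtI.
Proof.
move=> /supportedP hx; apply/supportedP => a b nab; rewrite mxE hx ?mulr0 //.
by apply: contra nab; rewrite /gtI /=; have := ltn_ord a; have := ltn_ord b; lia.
Qed.

Definition skew_lower x : bool := (x \in supported gtI) && (adj x == - x).

Lemma skew_entry x (a b : idx r) : skew_lower x ->
  x a b = - (half_sign a * half_sign b * x (rev_ord b) (rev_ord a)).
Proof. by case/andP => _ /eqP/matrixP/(_ a b); rewrite !mxE => ->; rewrite opprK. Qed.

(** Below the diagonal, each entry is the position of a root or the mirror image of
    one in the antidiagonal; the condition on a + b selects the first case. *)
Lemma root_position (a b : idx r) : (b < a)%N -> (a + b <= m)%N ->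
  exists al : pos_root r, root_row al = a /\ root_col al = b.
Proof.
rewrite /m => ba abm; have ltar := ltn_ord a.
have br : (b < r)%N by move: ba abm ltar; clear; lia.
case: (ltnP a r) => ar.
  have h : (Ordinal br < Ordinal ar)%N by [].
  by exists (eps_sub h); split; apply: ord_inj; rewrite val_pidx.
have jr : (r.*2 - a.+1 < r)%N by move: ba abm ltar ar; clear; lia.
have ja : (r.*2 - (r.*2 - a.+1).+1 = a :> nat)%N by move: ba ar ltar; clear; lia.
have [bj|bj|bj] := ltngtP b (r.*2 - a.+1)%N.
- have h : (Ordinal br < Ordinal jr)%N by [].
  by exists (eps_add h); split; apply: ord_inj; rewrite ?val_nidx ?val_pidx //= ja.
- by move: abm bj ltar ba; clear; lia.
- by exists (eps_dbl (Ordinal br)); split; apply: ord_inj;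
    rewrite ?val_nidx ?val_pidx //= bj ja.
Qed.

Lemma root_col_row (al : pos_root r) :
  (root_col al < root_row al)%N /\ (root_row al + root_col al <= m)%N.
Proof.
rewrite /m; case: al => [i j ij|i j ij|i] /=; rewrite ?val_nidx ?val_pidx;
  have := ltn_ord i; try (have := ltn_ord j); lia.
Qed.

Lemma delta_strict (a b : idx r) : (b < a)%N ->
  delta_mx a b \in supported (F := F) gtI.
Proof.
move=> ba; apply/supportedP => c d; rewrite mxE /gtI.
by case: (c =P a) => //= ->; case: (d =P b) => //= ->; rewrite ba.
Qed.

Lemma adj_delta (a b : idx r) :
  adj (delta_mx a b) =
    (half_sign (rev_ord b) * half_sign (rev_ord a)) *: delta_mx (rev_ord b) (rev_ord a).
Proof.
have revE (c d : idx r) : (rev_ord c == d) = (c == rev_ord d).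
  by rewrite -(inj_eq rev_ord_inj) rev_ordK.
apply/matrixP => c d; rewrite !mxE !revE [(d == _) && _]andbC.
case: (c =P rev_ord b) => [->|]; last by rewrite !mulr0.
by case: (d =P rev_ord a) => [->|]; rewrite ?mulr0.
Qed.

Lemma half_sign_pidx (i : 'I_r) : half_sign (pidx i) = 1.
Proof. by rewrite /half_sign val_pidx ltn_ord. Qed.

Lemma half_sign_nidx (i : 'I_r) : half_sign (nidx i) = -1.
Proof.
by rewrite /half_sign val_nidx; case: ltnP => //; have := ltn_ord i; lia.
Qed.

Lemma rev_nidx (i : 'I_r) : rev_ord (nidx i) = pidx i.
Proof. by rewrite /nidx rev_ordK. Qed.

Lemma rev_pidx (i : 'I_r) : rev_ord (pidx i) = nidx i.
Proof. by []. Qed.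

Lemma root_mx_skew (al : pos_root r) : skew_lower (root_mx F al).
Proof.
have sE := (half_sign_pidx, half_sign_nidx).
have lt_pn (i j : 'I_r) : (pidx i < nidx j)%N.
  by rewrite val_pidx val_nidx; have := ltn_ord i; have := ltn_ord j; lia.
have lt_nn (i j : 'I_r) : (i < j)%N -> (nidx j < nidx i)%N.
  by move=> ij; rewrite !val_nidx; have := ltn_ord i; have := ltn_ord j; lia.
have lt_pp (i j : 'I_r) : (i < j)%N -> (pidx i < pidx j)%N by rewrite !val_pidx.
rewrite /skew_lower; case: al => [i j ij|i j ij|i] /=.
- rewrite supportedB ?delta_strict ?lt_nn ?lt_pp //=.
  rewrite linearB /= !adj_delta !(rev_pidx, rev_nidx) !sE mulrNN !mulr1 !scale1r.
  by rewrite opprB.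
- rewrite supportedD ?delta_strict ?lt_pn //=.
  rewrite linearD /= !adj_delta !(rev_pidx, rev_nidx) !sE mulN1r.
  by rewrite !scaleN1r opprD addrC.
- by rewrite delta_strict ?lt_pn //= adj_delta !(rev_pidx, rev_nidx) !sE mulN1r scaleN1r.
Qed.

Lemma skew_lower_ext x y : skew_lower x -> skew_lower y ->
  (forall al : pos_root r, root_coord al x = root_coord al y) -> x = y.
Proof.
move=> hx hy exy; apply/matrixP => a b.
have low (a' b' : idx r) : (a' + b' <= m)%N -> x a' b' = y a' b'.
  move=> abm; have [ba|ba] := boolP (gtI a' b'); last first.
    by case/andP: hx => /supportedP -> // _; case/andP: hy => /supportedP ->.
  by have [al [<- <-]] := root_position ba abm; apply: exy.
case: (leqP (a + b) m) => [/low //|abm].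
rewrite (skew_entry _ _ hx) (skew_entry _ _ hy) low //=.
by move: abm (ltn_ord a) (ltn_ord b); rewrite /m; lia.
Qed.

Lemma skew_lower0 : skew_lower 0.
Proof. by rewrite /skew_lower supported0 linear0 oppr0 eqxx. Qed.

Lemma skew_lowerD x y : skew_lower x -> skew_lower y -> skew_lower (x + y).
Proof.
move=> /andP[hx /eqP ex] /andP[hy /eqP ey].
by rewrite /skew_lower supportedD // linearD /= ex ey opprD eqxx.
Qed.

Lemma skew_lowerZ c x : skew_lower x -> skew_lower (c *: x).
Proof.
by move=> /andP[hx /eqP ex]; rewrite /skew_lower supportedZ // linearZ /= ex scalerN eqxx.
Qed.

Lemma skew_lowerN x : skew_lower x -> skew_lower (- x).
Proof. by rewrite -scaleN1r; exact: skew_lowerZ. Qed.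

Lemma skew_lower_sum (I : Type) (s : seq I) (P : pred I) (f : I -> mat F r) :
  (forall i, P i -> skew_lower (f i)) -> skew_lower (\sum_(i <- s | P i) f i).
Proof.
move=> h; apply: (big_ind skew_lower) => //; first exact: skew_lower0.
exact: skew_lowerD.
Qed.

Lemma root_coordD (al : pos_root r) x y :
  root_coord al (x + y) = root_coord al x + root_coord al y.
Proof. by rewrite /root_coord mxE. Qed.

Lemma root_coord_span (A : {set pos_root r}) (c : pos_root r -> F) be :
  root_coord be (\sum_(a in A) c a *: root_mx F a) = c be *+ (be \in A).
Proof.
rewrite /root_coord summxE; have [beA|beA] := boolP (be \in A).
  rewrite (bigD1 be) //= mxE -/(root_coord be _) root_coord_mx eqxx mulr1.
  rewrite big1 ?addr0 // => a /andP[_ nab].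
  by rewrite mxE -/(root_coord be _) root_coord_mx eq_sym (negPf nab) mulr0.
rewrite big1 // => a aA; rewrite mxE -/(root_coord be _) root_coord_mx.
by case: eqP => [E|_]; [rewrite E aA in beA | rewrite mulr0].
Qed.

Lemma skew_lower_expand x : skew_lower x ->
  x = \sum_al root_coord al x *: root_mx F al.
Proof.
move=> hx; apply: skew_lower_ext => // [|al].
  by apply: skew_lower_sum => al _; apply/skew_lowerZ/root_mx_skew.
rewrite (eq_bigl (fun a => a \in [set: pos_root r])); last by move=> a; rewrite inE.
by rewrite root_coord_span inE mulr1n.
Qed.

Lemma lie_spanP (A : {set pos_root r}) x :
  reflect (skew_lower x /\ forall al, al \notin A -> root_coord al x = 0)
          (x \in lie_span F A).
Proof.
apply: (iffP imsetP) => [[c _ ->]|[hx h0]].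
  split=> [|al nal]; last by rewrite root_coord_span (negPf nal).
  by apply: skew_lower_sum => al _; apply/skew_lowerZ/root_mx_skew.
exists [ffun al => root_coord al x]; first by [].
rewrite [LHS]skew_lower_expand // [RHS]big_mkcond; apply: eq_bigr => al _.
by rewrite ffunE; case: ifPn => // /h0 ->; rewrite scale0r.
Qed.

Lemma lie_uP x : reflect (skew_lower x) (x \in lie_u F r).
Proof.
apply: (iffP (lie_spanP _ _)) => [[]//|hx]; split=> // al.
by rewrite inE.
Qed.

Lemma card_lie_span (A : {set pos_root r}) : #|lie_span F A| = (#|F| ^ #|A|)%N.
Proof.
rewrite -(card_pffun_on (0 : F) A predT).
pose f (c : {ffun pos_root r -> F}) := \sum_(a in A) c a *: root_mx F a.
have -> : lie_span F A = f @: [set c in pffun_on 0 A predT].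
  apply/setP => x; apply/imsetP/imsetP => [[c _ ->]|[c _ ->]]; last by exists c.
  exists [ffun a => if a \in A then c a else 0].
    rewrite inE; apply/pffun_onP; split=> //.
    by apply/subsetP => a; rewrite inE ffunE; case: ifP; rewrite ?eqxx.
  by apply: eq_bigr => a aA; rewrite ffunE aA.
rewrite card_in_imset ?cardsE // => c d; rewrite !inE.
move=> /pffun_onP[/subsetP sc _] /pffun_onP[/subsetP sd _] E; apply/ffunP => a.
have [aA|aA] := boolP (a \in A).
  by have := congr1 (root_coord a) E; rewrite !root_coord_span aA.
have /eqP-> : c a == 0 by apply: contraNT aA => h; apply: sc.
by apply/eqP; rewrite eq_sym; apply: contraNT aA => h; apply: sd.
Qed.

End Symplectic.

(** * Groups of exponentials *)

Section Groups.

Variables (F : finFieldType) (r p : nat).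
Hypotheses (charFp : p \in [pchar F]) (le_rp : (r.*2 <= p)%N).
Implicit Types (x y : mat F r) (g h : {'GL_(r.*2)[F]}) (T : rel (idx r)).
Implicit Types (A : {set pos_root r}).

Lemma skew_lower_strict x : skew_lower x -> x \in supported gtI.
Proof. by case/andP. Qed.
Local Hint Resolve skew_lower_strict : core.

Lemma supported_unitalM T (g h : mat F r) : transitive T ->
    g - 1 \in supported T -> h - 1 \in supported T -> g * h - 1 \in supported T.
Proof.
move=> trT; rewrite -{2}(subrK 1 g) -{2}(subrK 1 h).
move: (g - 1) (h - 1) => a b ha hb.
by rewrite mulrDl mul1r mulrDr mulr1 !addrA addrK !supportedD ?supportedM.
Qed.

Lemma supported_conj T (g h x : mat F r) : transitive T ->
    g - 1 \in supported T -> h - 1 \in supported T -> x \in supported T ->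
  g * x * h \in supported T.
Proof.
move=> trT; rewrite -{2}(subrK 1 g) -{2}(subrK 1 h).
move: (g - 1) (h - 1) => a b ha hb hx.
by rewrite !(mulrDl, mulrDr, mul1r, mulr1) !supportedD ?supportedM.
Qed.

Lemma GLval_inj : injective (@GLval r.*2 F).
Proof. exact: val_inj. Qed.

Lemma exp_glE x : x \in supported gtI -> GLval (exp_gl x) = exp_mx x.
Proof.
move=> hx; rewrite /exp_gl insubdK //.
have := exp_mxN charFp le_rp hx; rewrite -mulmxE => /mulmx1_unit[].
by rewrite /unitmx unfold_in.
Qed.

Lemma exp_gl_inj : {in supported gtI &, injective (@exp_gl F r)}.
Proof.
move=> x y hx hy exy; apply: exp_mx_inj => //.
by rewrite -!exp_glE // exy.
Qed.

Lemma exp_gl0 : exp_gl (0 : mat F r) = 1%g.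
Proof. by apply: GLval_inj; rewrite exp_glE ?supported0 // exp_mx0. Qed.

Lemma exp_glN x : x \in supported gtI -> exp_gl (- x) = (exp_gl x)^-1%g.
Proof.
move=> hx; apply: (mulgI (exp_gl x)); rewrite mulgV; apply: GLval_inj.
rewrite GL_ME exp_glE // exp_glE ?supportedN //.
exact: (exp_mxN charFp).
Qed.

Lemma GLvalV g : GLval g * GLval g^-1 = 1.
Proof. by rewrite -GL_ME mulgV. Qed.

Lemma GLVval g : GLval g^-1 * GLval g = 1.
Proof. by rewrite -GL_ME mulVg. Qed.

Definition symp_unitri (g : mat F r) : bool :=
  (g - 1 \in supported gtI) && (g * adj g == 1).

(** The adjoint of the matrix x provided by exp_mx_onto has exponential
    g^-1 = exp (- x), so x is skew by injectivity. *)
Lemma symp_unitri_exp T (g : {'GL_(r.*2)[F]}) : strict_pattern T ->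
    symp_unitri (GLval g) -> GLval g - 1 \in supported T ->
  exists x, [/\ skew_lower x, x \in supported T & exp_gl x = g].
Proof.
move=> sT /andP[_ /eqP gJ] hg; have [x hx ex] := exp_mx_onto sT hg.
have sx := supported_gtI sT hx.
exists x; split=> //; last by apply: GLval_inj; rewrite exp_glE.
rewrite /skew_lower sx; apply/eqP; apply: exp_mx_inj => //.
- exact: adj_strict.
- exact: supportedN.
rewrite -adj_exp_mx ex -[LHS]mul1r -(exp_mxN charFp le_rp (supportedN sx)) opprK.
by rewrite -mulrA ex gJ mulr1.
Qed.

Lemma exp_gl_symp x : skew_lower x -> symp_unitri (GLval (exp_gl x)).
Proof.
move=> hx; have sx := skew_lower_strict hx.
rewrite exp_glE // /symp_unitri exp_mx_supported ?adj_exp_mx //; last exact: strict_gtI.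
by case/andP: hx => _ /eqP ->; rewrite (exp_mxN charFp le_rp sx) eqxx.
Qed.

Lemma group_UP g : reflect (symp_unitri (GLval g)) (g \in group_U F r).
Proof.
apply: (iffP imsetP) => [[x /lie_uP hx ->]|hg]; first exact: exp_gl_symp.
have /andP[h1 _] := hg.
have [x [hx _ <-]] := symp_unitri_exp (strict_gtI _) hg h1.
by exists x => //; apply/lie_uP.
Qed.

Lemma group_UV g : g \in group_U F r -> GLval g^-1 = adj (GLval g).
Proof.
case/group_UP/andP => _ /eqP gJ.
have := congr1 ( *%R (GLval g^-1)) gJ.
by rewrite mulrA GLVval mul1r mulr1 => ->.
Qed.

Lemma group_UM g h :
  g \in group_U F r -> h \in group_U F r -> (g * h)%g \in group_U F r.
Proof.
move=> /group_UP/andP[hg /eqP gJ] /group_UP/andP[hh /eqP hJ].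
apply/group_UP; rewrite /symp_unitri GL_ME adjM mulrA -(mulrA (GLval g)) hJ mulr1 gJ eqxx andbT.
by rewrite supported_unitalM //; exact: trans_gtI.
Qed.

Lemma group_U_group_set : group_set (group_U F r).
Proof.
apply/group_setP; split; last exact: group_UM.
by rewrite -exp_gl0; apply/imsetP; exists 0 => //; apply/lie_uP/skew_lower0.
Qed.

Lemma exp_gl_in_U x : skew_lower x -> exp_gl x \in group_U F r.
Proof. by move=> hx; apply/imsetP; exists x => //; apply/lie_uP. Qed.

Lemma group_U_strict g : g \in group_U F r -> GLval g - 1 \in supported gtI.
Proof. by case/group_UP/andP. Qed.

Lemma exp_glK x : skew_lower x -> ln_gl (exp_gl x) = x.
Proof.
move=> hx; rewrite /ln_gl; case: pickP => [y|/(_ x)].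
  case/andP => /lie_uP hy /eqP; apply: exp_gl_inj; exact: skew_lower_strict.
by rewrite eqxx andbT; case: lie_uP.
Qed.

Lemma ln_glP g : g \in group_U F r -> skew_lower (ln_gl g) /\ exp_gl (ln_gl g) = g.
Proof. by case/imsetP => x /lie_uP hx ->; rewrite exp_glK. Qed.

Lemma lie_span_skew A x : x \in lie_span F A -> skew_lower x.
Proof. by case/lie_spanP. Qed.

Lemma lie_spanN A x : x \in lie_span F A -> - x \in lie_span F A.
Proof.
case/lie_spanP => hx h0; apply/lie_spanP; split; first exact: skew_lowerN.
by move=> al /h0; rewrite /root_coord mxE => ->; rewrite oppr0.
Qed.

Lemma exp_spanP A g :
  reflect (exists2 x, x \in lie_span F A & g = exp_gl x) (g \in exp_span F A).
Proof. exact: imsetP. Qed.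

Lemma exp_span_sub_U A g : g \in exp_span F A -> g \in group_U F r.
Proof. by case/exp_spanP => x /lie_span_skew hx ->; apply: exp_gl_in_U. Qed.

Lemma ln_exp_span A g : g \in exp_span F A -> ln_gl g \in lie_span F A.
Proof. by case/exp_spanP => x hx ->; rewrite exp_glK //; apply: lie_span_skew hx. Qed.

Lemma exp_span_mem A x : x \in lie_span F A -> exp_gl x \in exp_span F A.
Proof. by move=> hx; apply/exp_spanP; exists x. Qed.

Lemma exp_spanV A g : g \in exp_span F A -> (g^-1)%g \in exp_span F A.
Proof.
case/exp_spanP => x hx ->; rewrite -exp_glN; last exact/skew_lower_strict/lie_span_skew/hx.
exact/exp_span_mem/lie_spanN.
Qed.

Lemma group_UVr g : g \in group_U F r -> (g^-1)%g \in group_U F r.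
Proof. exact: exp_spanV. Qed.

Lemma adj_mul_skew (u v x : mat F r) :
    u - 1 \in supported gtI -> v - 1 \in supported gtI -> adj u = v -> adj v = u ->
  skew_lower x -> skew_lower (u * x * v).
Proof.
move=> hu hv uv vu /andP[sx /eqP xJ]; rewrite /skew_lower supported_conj //=.
  by rewrite !adjM uv vu xJ mulNr mulrN mulrA.
exact: trans_gtI.
Qed.

Lemma skew_lower_conj x g : skew_lower x -> g \in group_U F r ->
  skew_lower (GLval g^-1 * x * GLval g).
Proof.
move=> hx gU; have gVU := group_UVr gU.
apply: adj_mul_skew (group_U_strict gVU) (group_U_strict gU) _ _ hx.
  by have := group_UV gVU; rewrite invgK => ->.
by have := group_UV gU => ->.
Qed.

Lemma exp_gl_conj x g : skew_lower x -> g \in group_U F r ->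
  exp_gl (GLval g^-1 * x * GLval g) = (exp_gl x ^ g)%g.
Proof.
move=> hx gU; apply: GLval_inj; rewrite exp_glE; last first.
  exact/skew_lower_strict/skew_lower_conj.
rewrite exp_mx_conj ?GLVval ?GLvalV // -exp_glE; last exact: skew_lower_strict.
by rewrite !GL_ME mulrA.
Qed.

Lemma ln_gl_conj g h : h \in group_U F r -> g \in group_U F r ->
  ln_gl (h ^ g)%g = GLval g^-1 * ln_gl h * GLval g.
Proof.
move=> hU gU; have [hx ex] := ln_glP hU.
by rewrite -{1}ex -exp_gl_conj // exp_glK //; apply: skew_lower_conj.
Qed.

Lemma exp_span_subset A A' : A \subset A' -> exp_span F A \subset exp_span F A'.
Proof.
move=> /subsetP sA; apply/subsetP => g /exp_spanP[x /lie_spanP[hx h0] ->].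
by apply/exp_span_mem/lie_spanP; split=> // al nal; apply: h0; apply: contra nal; apply: sA.
Qed.

Lemma card_exp_span A : #|exp_span F A| = (#|F| ^ #|A|)%N.
Proof.
rewrite -card_lie_span; apply: card_in_imset => x y /lie_span_skew hx /lie_span_skew hy.
by apply: exp_gl_inj; apply: skew_lower_strict.
Qed.

(** The symmetry of T in the antidiagonal makes it compatible with skewness: a skew
    matrix is supported by T as soon as its root coordinates are. *)
Definition pattern_of A T : Prop :=
  [/\ strict_pattern T, forall a b, T (rev_ord b) (rev_ord a) = T a b
    & forall al, (al \in A) = T (root_row al) (root_col al)].

Lemma lie_span_patternP A T x : pattern_of A T ->
  reflect (skew_lower x /\ x \in supported T) (x \in lie_span F A).
Proof.
case=> [[_ sT] symT AT]; apply: (iffP (lie_spanP _ _)) => [[hx h0]|[hx /supportedP h0]].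
  split=> //; apply/supportedP => a b nT.
  have [ba|/(supportedP _ _ (skew_lower_strict hx))//] := boolP (gtI a b).
  have low (a' b' : idx r) : gtI a' b' -> ~~ T a' b' ->
    (a' + b' <= (r.*2).-1)%N -> x a' b' = 0.
    move=> ba' nT' abm; have [al [ea eb]] := root_position ba' abm.
    by have := h0 al; rewrite AT ea eb /root_coord ea eb; apply.
  case: (leqP (a + b) (r.*2).-1) => [/low->//|abm].
  rewrite (skew_entry _ _ hx) low ?mulr0 ?oppr0 ?symT //.
    by move: ba; rewrite /gtI rev_ord_ltn.
  by move: abm (ltn_ord a) (ltn_ord b) => /=; clear; lia.
by split=> // al; rewrite AT => /h0.
Qed.

(** The exponential of such a span is described by the vanishing of entries. All
    closure properties of the groups below follow from this. *)
Lemma exp_span_patternP A T g : pattern_of A T ->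
  reflect (g \in group_U F r /\ GLval g - 1 \in supported T) (g \in exp_span F A).
Proof.
move=> AT; have [sT _ _] := AT; apply: (iffP (exp_spanP _ _)) => [[x]|[/group_UP gU gT]].
  case/(lie_span_patternP _ AT) => hx xT ->.
  rewrite exp_gl_in_U // exp_glE ?exp_mx_supported //; exact: skew_lower_strict.
have [x [hx xT <-]] := symp_unitri_exp sT gU gT.
by exists x => //; apply/(lie_span_patternP _ AT).
Qed.

Lemma exp_span1 A : 1%g \in exp_span F A.
Proof.
rewrite -exp_gl0; apply/exp_span_mem/lie_spanP; split; first exact: skew_lower0.
by move=> al _; rewrite /root_coord mxE.
Qed.

Lemma exp_spanM A T g h : pattern_of A T ->
  g \in exp_span F A -> h \in exp_span F A -> (g * h)%g \in exp_span F A.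
Proof.
move=> AT; have [[trT _] _ _] := AT.
move=> /(exp_span_patternP _ AT)[gU gT] /(exp_span_patternP _ AT)[hU hT].
by apply/(exp_span_patternP _ AT); rewrite group_UM // GL_ME supported_unitalM.
Qed.

Lemma exp_span_group_set A T : pattern_of A T -> group_set (exp_span F A).
Proof.
move=> AT; apply/group_setP; split; first exact: exp_span1.
by move=> g h; apply: exp_spanM AT.
Qed.

End Groups.

(** * Characters induced from a block of an orbit *)

Section BlockInduction.

Variables (gT : finGroupType) (U H : {group gT}) (X : finType).
Variables (act : gT -> X -> X) (e : gT -> X -> algC) (x0 : X) (A : {set X}).
Hypothesis sHU : H \subset U.
Hypothesis act1 : forall x, act 1%g x = x.
Hypothesis actM : {in U &, forall g h x, act (g * h)%g x = act g (act h x)}.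
Hypothesis e_conj : {in U &, forall g u x, e (g ^ u)%g x = e g (act u x)}.

Let Omega : {set X} := [set act g x0 | g in U].

Hypothesis x0A : x0 \in A.
Hypothesis sAOmega : A \subset Omega.
Hypothesis A_block : forall u x, u \in U -> x \in A -> act u x \in A -> u \in H.
Hypothesis A_stable : {in H & A, forall h x, act h x \in A}.
Hypothesis e_vanish : forall g, g \in U -> g \notin H -> \sum_(x in A) e g x = 0.

Lemma actK u : u \in U -> cancel (act u) (act u^-1%g).
Proof. by move=> uU x; rewrite -actM ?groupV // mulVg act1. Qed.

Lemma actVK u : u \in U -> cancel (act u^-1%g) (act u).
Proof. by move=> uU x; rewrite -actM ?groupV // mulgV act1. Qed.

Lemma act_Omega u y : u \in U -> (act u y \in Omega) = (y \in Omega).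
Proof.
move=> uU; apply/imsetP/imsetP => [[v vU E]|[v vU ->]].
  exists (u^-1 * v)%g; first by rewrite groupM ?groupV.
  by rewrite actM ?groupV // -E actK.
by exists (u * v)%g; rewrite ?groupM ?actM.
Qed.

Lemma sum_Omega_act u (E : X -> algC) : u \in U ->
  \sum_(y in Omega) E (act u y) = \sum_(y in Omega) E y.
Proof.
move=> uU; rewrite [RHS](reindex_onto (act u) (act u^-1%g)) => [|y _]; last exact: actVK.
by apply: eq_bigl => y; rewrite act_Omega // actK // eqxx andbT.
Qed.

(** The translates of the block A by U cover Omega, and the elements of U that
    move a given point of Omega into A form a coset of H. *)
Lemma sum_translates (E : X -> algC) :
  \sum_(u in U) \sum_(x in A) E (act u x) = #|H|%:R * \sum_(y in Omega) E y.
Proof.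
have step u : u \in U -> \sum_(x in A) E (act u x)
    = \sum_(y in Omega) (act u^-1%g y \in A)%:R * E y.
  move=> uU; rewrite -(sum_Omega_act _ uU) big_mkcond [RHS]big_mkcond.
  apply: eq_bigr => x _; rewrite actK //; case: (boolP (x \in A)) => xA.
    by rewrite (subsetP sAOmega) // mul1r.
  by rewrite mul0r if_same.
rewrite (eq_bigr _ step) exchange_big mulr_sumr; apply: eq_bigr => y.
case/imsetP => v vU ->; rewrite -mulr_suml; congr (_ * _).
rewrite -(card_lcoset H v) -sum1_card natr_sum.
rewrite [LHS]big_mkcond [RHS]big_mkcond; apply: eq_bigr => u _.
rewrite mem_lcoset; case: (boolP (u \in U)) => [uU|uU] /=; last first.
  rewrite ifF //; apply: contraNF uU => h; rewrite -(mulKVg v u) groupM //.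
  exact: (subsetP sHU).
have -> : ((v^-1 * u)%g \in H) = (act u^-1%g (act v x0) \in A).
  rewrite -actM ?groupV // -groupV invMg invgK.
  apply/idP/idP => [h|]; first exact: A_stable.
  by apply: A_block; rewrite ?groupM ?groupV.
by case: ifP.
Qed.

Lemma card_block : (#|U| * #|A| = #|H| * #|Omega|)%N.
Proof.
have := sum_translates (fun=> 1).
rewrite !sumr_const -natrM => /eqP.
by rewrite -mulrnA eqr_nat mulnC => /eqP; rewrite mulnC.
Qed.

(** By e_vanish, the extension by zero outside H of the sum over A is the sum over
    A itself, and conjugating by u in U replaces A by its translate by u. *)
Lemma Ind_block (c : algC) :
  exists (chi : 'CF(U)) (phi : 'CF(H)),
    [/\ {in U, forall g, chi g = c * \sum_(y in Omega) e g y},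
        {in H, forall h, phi h = c * \sum_(x in A) e h x}
      & chi = 'Ind[U, H] phi].
Proof.
pose chi0 g := if g \in U then c * \sum_(y in Omega) e g y else 0.
pose phi0 g := if g \in H then c * \sum_(y in A) e g y else 0.
have chiP : is_class_fun <<U>>%g [ffun g => chi0 g].
  rewrite genGid; apply: intro_class_fun => [g u gU uU|g]; last by rewrite /chi0 => /negPf->.
  rewrite /chi0 groupJ // gU; congr (_ * _); rewrite -[RHS](sum_Omega_act _ uU).
  by apply: eq_bigr => y _; rewrite e_conj.
have phiP : is_class_fun <<H>>%g [ffun g => phi0 g].
  rewrite genGid; apply: intro_class_fun => [g u gH uH|g]; last by rewrite /phi0 => /negPf->.
  have [gU uU] := (subsetP sHU _ gH, subsetP sHU _ uH).
  rewrite /phi0 groupJ // gH; congr (_ * _).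
  rewrite [RHS](reindex_onto (act u) (act u^-1%g)) => [|y _]; last exact: actVK.
  apply: eq_big => [y|y _]; last by rewrite e_conj.
  rewrite actK // eqxx andbT; apply/idP/idP => [/A_stable->//|h].
  by rewrite -(actK uU y) A_stable ?groupV.
have chiE g : Cfun 0 chiP g = chi0 g by rewrite cfunE.
have phiE g : Cfun 0 phiP g = phi0 g by rewrite cfunE.
exists (Cfun 0 chiP), (Cfun 0 phiP); split=> [g gU|g gH|].
- by rewrite chiE /chi0 gU.
- by rewrite phiE /phi0 gH.
apply/cfun_inP => g gU; rewrite cfIndE // chiE /chi0 gU.
have H0 : (#|H|%:R : algC) != 0 by rewrite pnatr_eq0 -lt0n cardG_gt0.
apply: (mulfI H0); rewrite mulVKf // mulrCA -sum_translates mulr_sumr.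
apply: eq_bigr => u uU; rewrite phiE /phi0; case: ifPn => gH.
  by congr (_ * _); apply: eq_bigr => x _; rewrite e_conj.
rewrite (eq_bigr (fun x => e (g ^ u)%g x)) => [|x _]; last by rewrite e_conj.
by rewrite e_vanish // ?mulr0 ?(groupJ gU uU).
Qed.

End BlockInduction.

(** * Coefficients of roots and singular roots *)

Section RootCoordinates.

Variable r : nat.
Implicit Types (al be : pos_root r) (k : 'I_r).

Definition coef al k : int := root_vec al 0 k.

Lemma coef_sub (i j : 'I_r) (h : (i < j)%N) k :
  coef (eps_sub h) k = (k == i)%:R - (k == j)%:R.
Proof. by rewrite /coef !mxE eqxx. Qed.

Lemma coef_add (i j : 'I_r) (h : (i < j)%N) k :
  coef (eps_add h) k = (k == i)%:R + (k == j)%:R.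
Proof. by rewrite /coef !mxE eqxx. Qed.

Lemma coef_dbl (i : 'I_r) k : coef (eps_dbl i) k = (k == i)%:R *+ 2.
Proof. by rewrite /coef !mxE eqxx. Qed.

Definition coefE := (coef_sub, coef_add, coef_dbl).

Lemma idx_eqE (a b : idx r) : (a == b) = (a == b :> nat).
Proof. by []. Qed.

Lemma ord_eqE (a b : 'I_r) : (a == b) = (a == b :> nat).
Proof. by []. Qed.

Lemma coef_gt0 al k :
  (0 < coef al k) = (root_col al == pidx k) || (root_row al == nidx k).
Proof.
case: al => [i j h|i j h|i]; rewrite coefE /= !idx_eqE ?val_pidx ?val_nidx !ord_eqE;
  have := ltn_ord k; have := ltn_ord i; try (have := ltn_ord j);
  do ?case: eqP => //=; lia.
Qed.

Lemma coef_lt0 al k : (coef al k < 0) = (root_row al == pidx k).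
Proof.
case: al => [i j h|i j h|i]; rewrite coefE /= !idx_eqE ?val_pidx ?val_nidx !ord_eqE;
  have := ltn_ord k; have := ltn_ord i; try (have := ltn_ord j);
  do ?case: eqP => //=; lia.
Qed.

Lemma dotv_delta k (w : 'rV[int]_r) : dotv (delta_mx 0 k) w = w 0 k.
Proof.
rewrite /dotv (bigD1 k) //= mxE !eqxx mul1r big1 ?addr0 // => l lk.
by rewrite mxE eqxx (negPf lk) mul0r.
Qed.

Lemma dotvDl (u v w : 'rV[int]_r) : dotv (u + v) w = dotv u w + dotv v w.
Proof. by rewrite /dotv -big_split; apply: eq_bigr => l _; rewrite mxE mulrDl. Qed.

Lemma dotvNl (u w : 'rV[int]_r) : dotv (- u) w = - dotv u w.
Proof. by rewrite /dotv -sumrN; apply: eq_bigr => l _; rewrite mxE mulNr. Qed.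

End RootCoordinates.

Section FirstColumn.

Variable n : nat.
Implicit Types (al be : pos_root n.+1).

Lemma pidx0 : pidx (ord0 : 'I_n.+1) = ord0.
Proof. by apply: ord_inj; rewrite val_pidx. Qed.

Lemma nidx0 : nidx (ord0 : 'I_n.+1) = ord_max.
Proof. by apply: ord_inj; rewrite val_nidx /= ?doubleS ?subn1. Qed.

Lemma coef_col0 al : (root_col al == ord0) = (coef al ord0 != 0).
Proof.
case: al => [i j h|i j h|i]; rewrite coefE /root_col idx_eqE !ord_eqE val_pidx /=;
  do ?case: eqP => //=; lia.
Qed.

Lemma coef_col0_le be : root_col be != ord0 -> coef be ord0 = 0.
Proof. by rewrite coef_col0 negbK => /eqP. Qed.

Lemma singularP be al :
  reflect (exists c, forall k, coef be k - coef al k = coef c k) (al \in singular be).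
Proof.
rewrite inE; apply: (iffP existsP) => -[c E]; exists c.
  by move=> k; move/eqP/matrixP/(_ 0 k): E; rewrite !mxE.
by apply/eqP/matrixP => i k; rewrite !mxE ord1; apply: E.
Qed.

Lemma coef_col_gt0 r (al : pos_root r) : exists k, 0 < coef al k.
Proof.
case: al => [i j h|i j h|i]; exists i; rewrite coef_gt0 eqxx //.
Qed.

Lemma eps_sub_eq r (i j k l : 'I_r) (h : (i < j)%N) (h' : (k < l)%N) :
  i = k -> j = l -> eps_sub h = eps_sub h'.
Proof. by move=> ik jl; move: h'; rewrite -ik -jl => h'; rewrite (bool_irrelevance h h'). Qed.

Lemma eps_add_eq r (i j k l : 'I_r) (h : (i < j)%N) (h' : (k < l)%N) :
  i = k -> j = l -> eps_add h = eps_add h'.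
Proof. by move=> ik jl; move: h'; rewrite -ik -jl => h'; rewrite (bool_irrelevance h h'). Qed.

Lemma singular_irrefl r (al : pos_root r) (c : pos_root r) (be : pos_root r) :
  (forall k, coef be k - coef al k = coef c k) -> be = c -> False.
Proof.
move=> E bc; have [k] := coef_col_gt0 al; have := E k; rewrite bc; lia.
Qed.

(** If eps_1 - eps_j - al is a root gamma, its coefficient at 1 is 1, so that gamma
    is eps_1 - eps_k or eps_1 + eps_k; it differs from eps_1 - eps_j, hence the
    coefficient of al at j is negative. *)
Lemma singular_sub (j : 'I_n.+1) (h : ((ord0 : 'I_n.+1) < j)%N) al :
  root_col al != ord0 -> (al \in singular (eps_sub h)) = (coef al j < 0).
Proof.
move=> al0; have al00 := coef_col0_le al0.
have j0 : (j == ord0) = false by rewrite ord_eqE; move: h => /=; lia.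
apply/singularP/idP => [[c E]|].
  have := E ord0; rewrite al00 coefE eqxx [ord0 == j]eq_sym j0 => c0.
  have := E j; rewrite coefE eqxx j0.
  case: c E c0 => [k l kl|k l kl|k] E; rewrite !coefE.
  - case: (j =P l) => [jl|_]; last by case: (j == k); lia.
    case: (ord0 =P k) => [k0|_]; last by case: (ord0 == l).
    by case: (singular_irrefl E); apply: eps_sub_eq.
  - by case: (j == k); case: (j == l); lia.
  - by case: (ord0 == k).
rewrite coef_lt0; case: al al0 al00 => [k l kl|k l kl|k] _; rewrite /root_row.
- rewrite (inj_eq (@pidx_inj _)) => al00 /eqP lj.
  have k0 : ((ord0 : 'I_n.+1) < k)%N.
    move: al00; rewrite coefE !ord_eqE /=; have := kl => /=; lia.
  exists (eps_sub k0) => i; rewrite !coefE lj; lia.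
- by rewrite nidx_pidx.
- by rewrite nidx_pidx.
Qed.

Lemma singular_add (j : 'I_n.+1) (h : ((ord0 : 'I_n.+1) < j)%N) al :
  root_col al != ord0 -> (al \in singular (eps_add h)) = (0 < coef al j).
Proof.
move=> al0; have al00 := coef_col0_le al0.
have j0 : (j == ord0) = false by rewrite ord_eqE; move: h => /=; lia.
apply/singularP/idP => [[c E]|].
  have := E ord0; rewrite al00 coefE eqxx [ord0 == j]eq_sym j0 => c0.
  have := E j; rewrite coefE eqxx j0.
  case: c E c0 => [k l kl|k l kl|k] E; rewrite !coefE.
  - case: (ord0 =P k) => [<-|_]; last by case: (ord0 == l).
    by rewrite j0; case: (j == l); lia.
  - case: (ord0 =P k) => [k0|_]; last first.
      case: (ord0 =P l) => // l0; have := kl; rewrite -l0 /=; lia.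
    rewrite -k0 j0; case: (j =P l) => [jl|_]; last by lia.
    by case: (singular_irrefl E); apply: eps_add_eq.
  - by case: (ord0 == k).
rewrite coef_gt0; case: al al0 al00 => [k l kl|k l kl|k] _;
  rewrite /root_row /root_col ?(inj_eq (@pidx_inj _)) ?(inj_eq (@nidx_inj _)) => al00.
- have l0 : ((ord0 : 'I_n.+1) < l)%N by have := kl => /=; lia.
  rewrite [X in _ || X]eq_sym nidx_pidx orbF => /eqP kj.
  by exists (eps_add l0) => i; rewrite !coefE kj; lia.
- have l0 : ((ord0 : 'I_n.+1) < l)%N by have := kl => /=; lia.
  have k0 : ((ord0 : 'I_n.+1) < k)%N.
    move: al00; rewrite coefE !ord_eqE /=; have := kl => /=; lia.
  case/orP => /eqP kj; [exists (eps_sub l0) | exists (eps_sub k0)] => i;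
    rewrite !coefE kj; lia.
- rewrite orbb => /eqP ->; exists (eps_sub h) => i; rewrite !coefE; lia.
Qed.

End FirstColumn.

(** * The patterns attached to the first root *)

Section FirstRoot.

Variable n : nat.
Variable b1 : pos_root n.+1.
Implicit Types (al be : pos_root n.+1) (a b c : idx n.+1).

Let iota := root_row b1.

Variant first_root_spec : pos_root n.+1 -> Type :=
| FirstAway be of root_col be != ord0 : first_root_spec be
| FirstLong : first_root_spec (eps_dbl ord0)
| FirstSub (j : 'I_n.+1) (h : ((ord0 : 'I_n.+1) < j)%N) : first_root_spec (eps_sub h)
| FirstAdd (j : 'I_n.+1) (h : ((ord0 : 'I_n.+1) < j)%N) : first_root_spec (eps_add h).

Lemma first_rootP be : first_root_spec be.
Proof.
have [col0|] := eqVneq (root_col be) ord0; last exact: FirstAway.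
case: be col0 => [i j h|i j h|i]; rewrite /root_col => /eqP;
  rewrite -pidx0 (inj_eq (@pidx_inj _)) => /eqP i0.
- by subst i; apply: FirstSub.
- by subst i; apply: FirstAdd.
- by subst i; apply: FirstLong.
Qed.

(** The columns left of the diagonal where the row iota vanishes on Lie(H). *)
Definition blocked b : bool :=
  if root_col b1 != ord0 then false
  else if b1 == eps_dbl ord0 then (n.+1 <= b < (ord_max : idx n.+1))%N
  else (0 < b < iota)%N.

(** Together with skewness, this pattern already cuts out Lie(H); the mirror
    symmetric H_pattern allows exactly the entries that occur in Lie(H). *)
Definition row_pattern : rel (idx n.+1) :=
  fun a b => (b < a)%N && ~~ ((a == iota) && blocked b).

Definition H_pattern : rel (idx n.+1) :=
  fun a b => row_pattern a b && ~~ ((b == rev_ord iota) && blocked (rev_ord a)).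

Definition V_pattern : rel (idx n.+1) :=
  fun a b => [&& H_pattern a b, b != ord0 & a != ord_max].

Definition Psi : {set pos_root n.+1} :=
  [set al | H_pattern (root_row al) (root_col al)].

Lemma iota_long : b1 = eps_dbl ord0 -> iota = ord_max.
Proof. by rewrite /iota => ->; rewrite /root_row nidx0. Qed.

Lemma root_row_max al : (root_row al == ord_max) = (al == eps_dbl ord0).
Proof.
apply/eqP/eqP => [|->]; last by rewrite /root_row nidx0.
rewrite -nidx0; case: al => [i j h|i j h|i]; rewrite /root_row => /eqP.
- by rewrite eq_sym nidx_pidx.
- by rewrite (inj_eq (@nidx_inj _)) => /eqP j0; move: (h); rewrite j0.
- by rewrite (inj_eq (@nidx_inj _)) => /eqP ->.
Qed.

Lemma blocked_long b : b1 = eps_dbl ord0 ->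
  blocked b = (n.+1 <= b < (ord_max : idx n.+1))%N.
Proof. by rewrite /blocked => ->; rewrite eqxx /root_col pidx0 eqxx. Qed.

Lemma blocked_short b : root_col b1 = ord0 -> b1 != eps_dbl ord0 ->
  blocked b = (0 < b < iota)%N.
Proof. by rewrite /blocked => -> /negPf ->; rewrite eqxx. Qed.

Lemma blocked_lt b : blocked b -> (0 < b < iota)%N.
Proof.
rewrite /blocked; case: ifP => // _; case: eqP => // /iota_long -> /andP[nb ->].
by rewrite (leq_ltn_trans _ nb).
Qed.

Lemma strict_row_pattern : strict_pattern row_pattern.
Proof.
split=> [b a c /andP[ba nab] /andP[cb nbc]|a b /andP[]//].
rewrite /row_pattern (ltn_trans cb ba) /=; apply: contra nab => /andP[/eqP ea].
rewrite ea eqxx /= /blocked; case: ifP => // _; have := ltn_ord a.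
case: eqP => [|_]; move: ba cb; rewrite ea => /= ba cb _; first by lia.
by move=> /andP[c0 _]; rewrite ba andbT; lia.
Qed.

Lemma H_pattern_sym a b : H_pattern (rev_ord b) (rev_ord a) = H_pattern a b.
Proof.
rewrite /H_pattern /row_pattern rev_ordK -!(inj_eq rev_ord_inj _ iota) !rev_ordK.
rewrite (inj_eq rev_ord_inj) rev_ord_ltn.
by rewrite -andbA [X in _ && X]andbC andbA.
Qed.

Lemma strict_H_pattern : strict_pattern H_pattern.
Proof.
have [tr _] := strict_row_pattern.
have E a b : H_pattern a b = row_pattern a b && row_pattern (rev_ord b) (rev_ord a).
  rewrite /H_pattern {3}/row_pattern -[in RHS](inj_eq rev_ord_inj) rev_ordK.
  rewrite rev_ord_ltn.
  by rewrite /row_pattern; case: (b < a)%N.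
split=> [b a c|a b]; rewrite !E.
  by move=> /andP[r1 r2] /andP[r3 r4]; rewrite (tr _ _ _ r1 r3) (tr _ _ _ r4 r2).
by case/andP => /andP[].
Qed.

Lemma strict_V_pattern : strict_pattern V_pattern.
Proof.
have [tr st] := strict_H_pattern; split=> [b a c|a b]; last by case/and3P => /st.
by move=> /and3P[h1 _ h2] /and3P[h3 h4 _]; rewrite /V_pattern (tr _ _ _ h1 h3) h4 h2.
Qed.

Lemma pattern_of_Psi : pattern_of Psi H_pattern.
Proof.
by split; [exact: strict_H_pattern | exact: H_pattern_sym | move=> al; rewrite inE].
Qed.

Lemma rev_ord_max a : (rev_ord a == ord0) = (a == ord_max).
Proof.
rewrite -(inj_eq rev_ord_inj) rev_ordK; congr (_ == _).
by apply: ord_inj; rewrite /= subn1.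
Qed.

Lemma row_not_max al : root_col al != ord0 -> root_row al != ord_max.
Proof. by apply: contra; rewrite root_row_max => /eqP ->; rewrite /root_col pidx0. Qed.

Lemma Psi_away al : root_col b1 != ord0 -> al \in Psi.
Proof.
move=> c0; rewrite inE /H_pattern /row_pattern /blocked c0 !andbF !andbT.
by case: (root_col_row al).
Qed.

Lemma Psi_long al : b1 = eps_dbl ord0 ->
  (al \in Psi) = (root_col al != ord0) || (root_row al >= n.+1)%N.
Proof.
move=> b1E; rewrite inE /H_pattern /row_pattern !(blocked_long _ b1E) (iota_long b1E).
have [-> _] := root_col_row al; have rmax := row_not_max (al := al).
have lc : (root_col al < n.+1)%N.
  by case: al {rmax} => *; rewrite /root_col val_pidx ltn_ord.
rewrite (ltn_geF lc) andbF /=.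
have -> : (root_col al == rev_ord ord_max) = (root_col al == ord0).
  by rewrite !idx_eqE /= subnn.
case: eqP => //= c0; have := root_col_row al; rewrite c0 /=.
by have := ltn_ord (root_row al); rewrite /=; lia.
Qed.

Lemma Psi_short al : root_col b1 = ord0 -> b1 != eps_dbl ord0 ->
  (al \in Psi) =
    (root_col al == ord0) || ~~ ((root_row al == iota) || (root_col al == rev_ord iota)).
Proof.
move=> c1 nl; rewrite inE /H_pattern /row_pattern !blocked_short //.
have [ltcr le] := root_col_row al; rewrite ltcr andTb.
have imax : iota != ord_max by rewrite root_row_max.
have [c0|c0] := eqVneq (root_col al) ord0.
  by rewrite c0 [ord0 == rev_ord _]eq_sym rev_ord_max (negPf imax) !andbF.
have c0' : (0 < root_col al)%N by move: c0; rewrite idx_eqE /=; lia.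
have rmax := row_not_max c0.
rewrite c0' negb_or; congr (~~ _ && ~~ _).
  by case: eqP => // <-; rewrite ltcr.
case: eqP => //= cE; move: rmax ltcr; rewrite cE idx_eqE /=.
by have := ltn_ord (root_row al); have := ltn_ord iota; rewrite /=; lia.
Qed.

Lemma sminus_outside be al : be != eps_dbl ord0 -> root_col be = ord0 ->
  root_col al != ord0 -> (al \in sminus be) = (al \in singular be).
Proof.
move=> nl c0 al0; rewrite /sminus in_setD andb_idl // => _.
by case: be nl c0 => [i j h|i j h|i] nl c0; rewrite /splus ?in_setI ?inE ?c0 ?(negPf al0) ?andbF //;
  move: nl c0; rewrite /root_col -pidx0 => /eqP nl /pidx_inj e; case: nl; rewrite e.
Qed.

Lemma singular_long al : root_col al != ord0 ->
  al \notin singular (eps_dbl (ord0 : 'I_n.+1)).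
Proof.
move=> al0; apply/negP => /singularP[c E].
have := E ord0; rewrite (coef_col0_le al0) coef_dbl eqxx.
case: c E => [k l kl|k l kl|k] E; rewrite ?coefE.
- by case: (ord0 == k); case: (ord0 == l).
- case: (ord0 =P k) => [k0|_]; last by case: (ord0 == l).
  case: (ord0 =P l) => // l0; have := kl; rewrite -l0 /=; lia.
- case: (ord0 =P k) => // k0 _; by apply: (singular_irrefl E); rewrite k0.
Qed.

Lemma root_col_sub0 (j : 'I_n.+1) (h : ((ord0 : 'I_n.+1) < j)%N) :
  root_col (eps_sub h) = ord0.
Proof. by rewrite /root_col pidx0. Qed.

Lemma root_col_add0 (j : 'I_n.+1) (h : ((ord0 : 'I_n.+1) < j)%N) :
  root_col (eps_add h) = ord0.
Proof. by rewrite /root_col pidx0. Qed.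

Lemma Psi_sub (j : 'I_n.+1) (h : ((ord0 : 'I_n.+1) < j)%N) al :
  b1 = eps_sub h -> root_col al != ord0 -> (al \in Psi) = ~~ (coef al j < 0).
Proof.
move=> E al0; rewrite Psi_short ?E ?root_col_sub0 //.
rewrite (negPf al0) /iota E coef_lt0 [root_row (eps_sub h)]/root_row rev_pidx.
have -> : (root_col al == nidx j) = false.
  by case: (al) => *; rewrite /root_col eq_sym nidx_pidx.
by rewrite orbF.
Qed.

Lemma Psi_add (j : 'I_n.+1) (h : ((ord0 : 'I_n.+1) < j)%N) al :
  b1 = eps_add h -> root_col al != ord0 -> (al \in Psi) = ~~ (0 < coef al j).
Proof.
move=> E al0; rewrite Psi_short ?E ?root_col_add0 //.
by rewrite (negPf al0) /iota E coef_gt0 [root_row (eps_add h)]/root_row rev_nidx orFb orbC.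
Qed.

Lemma Phi1E al : (al \in Phi1 b1) = (al \in Psi) && (root_col al != ord0).
Proof.
rewrite /Phi1; have [c0|c0] := eqVneq (root_col b1) ord0; last first.
  by rewrite in_setC inE Psi_away.
rewrite in_setC in_setU [al \in Cset _]inE negb_or andbC.
have [_|al0] := eqVneq (root_col al) ord0; first by rewrite !andbF.
rewrite !andbT; case E: {-}b1 / (first_rootP b1) => [be cb||j h|j h].
- by rewrite -E c0 eqxx in cb.
- rewrite Psi_long // al0 /sminus in_setD negb_and.
  by have := singular_long al0; rewrite -E => ->; rewrite orbT.
- by rewrite (Psi_sub E al0) sminus_outside ?E // ?singular_sub // -E.
- by rewrite (Psi_add E al0) sminus_outside ?E // ?singular_add // -E.
Qed.

Section WithPlacement.

Variable D : {set pos_root n.+1}.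
Hypothesis D_col1 : D :&: Cset ord0 = if root_col b1 == ord0 then [set b1] else set0.

Lemma col1_is_longE : col1_is_long D = (b1 == eps_dbl ord0).
Proof.
rewrite /col1_is_long D_col1; have [c0|c0] := eqVneq (root_col b1) ord0.
  by rewrite (inj_eq set1_inj).
have -> : (b1 == eps_dbl ord0) = false.
  by apply: contra_neqF c0 => /eqP ->; rewrite /root_col pidx0.
by apply/negP => /eqP/setP/(_ (eps_dbl ord0)); rewrite !inE eqxx.
Qed.

Lemma CprimeE al : (al \in Cprime D) = (al \in Psi) && (root_col al == ord0).
Proof.
rewrite /Cprime col1_is_longE; have [b1E|nl] := eqVneq b1 (eps_dbl ord0).
  rewrite Psi_long // in_setD [al \in Cset _]inE.
  have [c0|] := eqVneq (root_col al) ord0; last by rewrite andbF.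
  rewrite !andbT inE; case: al c0 => [i j h|i j h|i]; rewrite /root_col /root_row => c0.
  - have -> : i = ord0 by apply: pidx_inj; rewrite pidx0.
    by rewrite eqxx val_pidx leqNgt ltn_ord.
  - by have jn := ltn_ord j; have -> : (n.+1 <= nidx j)%N by rewrite val_nidx; lia.
  - by have jn := ltn_ord i; have -> : (n.+1 <= nidx i)%N by rewrite val_nidx; lia.
rewrite inE; have [c0|] := eqVneq (root_col b1) ord0; last by move=> c0; rewrite Psi_away.
by rewrite Psi_short //; case: (root_col al == ord0); rewrite ?andbF.
Qed.

End WithPlacement.

Lemma pattern_of_Phi1 : pattern_of (Phi1 b1) V_pattern.
Proof.
split=> [|a b|al]; first exact: strict_V_pattern.
  rewrite /V_pattern H_pattern_sym rev_ord_max -(rev_ord_max (rev_ord b)) rev_ordK.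
  by rewrite (andbC (a != ord_max)).
rewrite Phi1E inE /V_pattern; case: H_pattern => //=.
by have [//|c0] := eqVneq; rewrite row_not_max.
Qed.

End FirstRoot.

(** * Quotients of groups of exponentials *)

Section Quotient.

Variables (F : finFieldType) (r p : nat).
Hypotheses (charFp : p \in [pchar F]) (le_rp : (r.*2 <= p)%N).
Variables (r' : nat) (phi : {linear mat F r -> mat F r'}).
Variables (A : {set pos_root r}) (T : rel (idx r)).
Hypothesis AT : pattern_of A T.
Hypothesis phiM : {in supported T &, forall x y, phi (x * y) = phi x * phi y}.
Hypothesis phi_strict : forall x, x \in supported gtI -> phi x \in supported gtI.
Implicit Types (x : mat F r) (g h : {'GL_(r.*2)[F]}).

Definition group_quotient g : mat F r' := 1 + phi (GLval g - 1).

Lemma exp_span_supported g : g \in exp_span F A -> GLval g - 1 \in supported T.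
Proof. by case/(exp_span_patternP charFp le_rp _ AT). Qed.

Lemma quotient_exp x : x \in lie_span F A ->
  group_quotient (exp_gl x) = exp_mx (phi x).
Proof.
move=> hx; have [sx xT] := lie_span_patternP x AT hx.
have xs := skew_lower_strict sx; have [sT _ _] := AT.
by rewrite (exp_mx_morph sT phiM xT (phi_strict xs)) /group_quotient (exp_glE charFp le_rp xs).
Qed.

Lemma quotient_ln g : g \in exp_span F A ->
  group_quotient g = exp_mx (phi (ln_gl g)).
Proof.
move=> gA; have gU := exp_span_sub_U gA.
rewrite -quotient_exp ?(ln_exp_span charFp le_rp) //.
by have [_ ->] := ln_glP charFp le_rp gU.
Qed.

Lemma quotientM g h : g \in exp_span F A -> h \in exp_span F A ->
  group_quotient (g * h)%g = group_quotient g * group_quotient h.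
Proof.
move=> /exp_span_supported gT /exp_span_supported hT.
by rewrite /group_quotient GL_ME (unital_morphM phiM).
Qed.

Lemma quotient1 : group_quotient 1%g = 1.
Proof. by rewrite /group_quotient GL_1E subrr linear0 addr0. Qed.

Lemma quotient_inj g h : g \in exp_span F A -> h \in exp_span F A ->
  group_quotient g = group_quotient h -> phi (ln_gl g) = phi (ln_gl h).
Proof.
move=> gA hA; rewrite (quotient_ln gA) (quotient_ln hA) => /exp_mx_inj; apply; apply: phi_strict.
  by apply: skew_lower_strict; have [] := ln_glP charFp le_rp (exp_span_sub_U gA).
by apply: skew_lower_strict; have [] := ln_glP charFp le_rp (exp_span_sub_U hA).
Qed.

Variable A2 : {set pos_root r}.
Hypothesis sA2 : A2 \subset A.
Hypothesis phi_ker : forall x, x \in lie_span F A ->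
  reflect (forall al, al \in A2 -> root_coord al x = 0) (phi x == 0).

Lemma quotient_ker g : g \in exp_span F (A :\: A2) -> group_quotient g = 1.
Proof.
case/exp_spanP => x hx ->.
have hxA : x \in lie_span F A.
  case/lie_spanP: hx => sx h0; apply/lie_spanP; split=> // al nA.
  by apply: h0; rewrite in_setD (negPf nA) andbF.
rewrite quotient_exp // (eqP (introT (phi_ker hxA) _)) ?exp_mx0 // => al alA2.
by case/lie_spanP: hx => _; apply; rewrite in_setD alA2.
Qed.

(** The element c is the exponential of the component of ln g along A2. It has the
    same image as g in the quotient group, so g c^-1 is in the kernel, and the
    kernel is the exponential of the span of the remaining roots. *)
Lemma quotient_split g : g \in exp_span F A ->
  exists2 c, c \in exp_span F A2 & (g * c^-1)%g \in exp_span F (A :\: A2).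
Proof.
move=> gA; pose x := ln_gl g; pose z := \sum_(al in A2) root_coord al x *: root_mx F al.
have hx : x \in lie_span F A by apply: (ln_exp_span charFp le_rp).
have hz : z \in lie_span F A2.
  by apply/imsetP; exists [ffun al => root_coord al x] => //; apply: eq_bigr => al _; rewrite ffunE.
have cA2 : exp_gl z \in exp_span F A2 by apply: exp_span_mem.
exists (exp_gl z) => //; set c := exp_gl z.
have cA : c \in exp_span F A by apply: (subsetP (exp_span_subset _ sA2)).
have cVA : (c^-1)%g \in exp_span F A by apply: (exp_spanV charFp le_rp).
have gcA : (g * c^-1)%g \in exp_span F A.
  exact: (exp_spanM charFp le_rp AT).
have hzA : z \in lie_span F A.
  by rewrite -(exp_glK charFp le_rp (lie_span_skew hz)); apply: (ln_exp_span charFp le_rp).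
have phixz : phi x = phi z.
  apply/eqP; rewrite -subr_eq0 -linearB; apply/phi_ker.
    case/lie_spanP: hx => sx x0; case/lie_spanP: hzA => sz z0; apply/lie_spanP.
    split=> [|al nA]; first exact/skew_lowerD/skew_lowerN.
    by rewrite root_coordD x0 // add0r /root_coord mxE -/(root_coord _ _) z0 // oppr0.
  move=> al alA2; rewrite root_coordD [root_coord _ (- z)]mxE -/(root_coord al z).
  by rewrite root_coord_span alA2 mulr1n subrr.
have q1 : group_quotient (g * c^-1)%g = group_quotient 1%g.
  rewrite quotientM // (quotient_ln gA) -/x phixz -(quotient_exp hzA) -/c.
  by rewrite -quotientM // mulgV.
have oneA := exp_span1 charFp le_rp A.
have := quotient_inj gcA oneA q1.
have -> : ln_gl (1%g : {'GL_(r.*2)[F]}) = 0.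
  by rewrite -(exp_gl0 charFp le_rp) (exp_glK charFp le_rp) ?skew_lower0.
rewrite linear0 => /eqP/phi_ker ker.
have hy := ln_exp_span charFp le_rp gcA.
have [sy ey] := ln_glP charFp le_rp (exp_span_sub_U gcA).
rewrite -ey; apply/exp_span_mem/lie_spanP; split=> // al.
rewrite in_setD negb_and negbK => /orP[|nA]; first exact: ker.
by case/lie_spanP: hy => _; apply.
Qed.

End Quotient.

Section QuotientGroup.

Variables (F : finFieldType) (r r' p : nat).
Hypotheses (charFp : p \in [pchar F]) (le_rp : (r.*2 <= p)%N) (le_rp' : (r'.*2 <= p)%N).
Variables (phi : {linear mat F r -> mat F r'}) (A : {set pos_root r}) (T : rel (idx r)).
Hypothesis AT : pattern_of A T.
Hypothesis phiM : {in supported T &, forall x y, phi (x * y) = phi x * phi y}.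
Hypothesis phi_strict : forall x, x \in supported gtI -> phi x \in supported gtI.
Hypothesis phi_skew : forall x, skew_lower x -> skew_lower (phi x).
Implicit Types (x : mat F r) (g : {'GL_(r.*2)[F]}).

Definition quotient_gl g : {'GL_(r'.*2)[F]} := exp_gl (phi (ln_gl g)).

Lemma quotient_gl_U g : g \in exp_span F A -> quotient_gl g \in group_U F r'.
Proof.
move=> gA; apply: exp_gl_in_U; apply: phi_skew.
exact: (lie_span_skew (ln_exp_span charFp le_rp gA)).
Qed.

Lemma quotient_gl_val g : g \in exp_span F A ->
  GLval (quotient_gl g) = group_quotient phi g.
Proof.
move=> gA; have sx := lie_span_skew (ln_exp_span charFp le_rp gA).
rewrite /quotient_gl (exp_glE charFp le_rp'); last exact/phi_strict/skew_lower_strict.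
by rewrite (quotient_ln charFp le_rp AT phiM phi_strict gA).
Qed.

Lemma quotient_glV g : g \in exp_span F A -> (quotient_gl g)^-1%g = quotient_gl g^-1%g.
Proof.
move=> gA; have gVA := exp_spanV charFp le_rp gA.
apply: (mulgI (quotient_gl g)); rewrite mulgV; apply: GLval_inj; rewrite GL_ME.
move: (quotient_gl_val gA) (quotient_gl_val gVA).
move: (quotient_gl g) (quotient_gl _) => h h' -> ->.
by rewrite -(quotientM charFp le_rp AT phiM gA gVA) mulgV quotient1.
Qed.

Lemma lie_span_conj g x : g \in exp_span F A -> x \in lie_span F A ->
  GLval g^-1 * x * GLval g \in lie_span F A.
Proof.
move=> gA /(lie_span_patternP _ AT)[sx xT].
have gVA := exp_spanV charFp le_rp gA; have [[trT _] _ _] := AT.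
apply/(lie_span_patternP _ AT); split.
  exact: (skew_lower_conj charFp le_rp sx (exp_span_sub_U gA)).
exact: (supported_conj trT (exp_span_supported charFp le_rp AT gVA)
  (exp_span_supported charFp le_rp AT gA) xT).
Qed.

Lemma quotient_conj g x : g \in exp_span F A -> x \in lie_span F A ->
  phi (GLval g^-1 * x * GLval g) =
    GLval (quotient_gl g)^-1 * phi x * GLval (quotient_gl g).
Proof.
move=> gA /(lie_span_patternP _ AT)[sx xT].
have gVA := exp_spanV charFp le_rp gA; have [sT _ _] := AT.
rewrite (quotient_glV gA).
move: (quotient_gl_val gA) (quotient_gl_val gVA); move: (quotient_gl g) (quotient_gl g^-1%g).
move=> h h' -> ->; exact: (morph_conj sT phiM (exp_span_supported charFp le_rp AT gVA)
  (exp_span_supported charFp le_rp AT gA) xT).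
Qed.

End QuotientGroup.

(** * Relabelling of roots as deletion of indices *)

Section Relabel.

Variables (n : nat) (b1 : pos_root n.+1).
Let k := rank_tilde b1.

Lemma idx_cases r (c : idx r) : (0 < r)%N ->
  (exists j, c = pidx j) \/ (exists j, c = nidx j).
Proof.
move=> r0; have := ltn_ord c; case: (ltnP c r) => cr ltc.
  by left; exists (Ordinal cr); apply: ord_inj; rewrite val_pidx.
have h : (r.*2 - c.+1 < r)%N by move: cr ltc r0; clear; lia.
right; exists (Ordinal h); apply: ord_inj; rewrite val_nidx /=.
by move: cr ltc r0; clear; lia.
Qed.

Definition old_index (i : 'I_k) : 'I_n.+1 := enum_val i.

Lemma old_index_mem i : old_index i \in rest_idx b1.
Proof. exact: enum_valP. Qed.

(** In rank zero the only index carries no root, and any value will do. *)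
Definition embed (c : idx k) : idx n.+1 :=
  if insub (c : nat) is Some i then pidx (old_index i)
  else if insub (rev_ord c : nat) is Some i then nidx (old_index i) else ord0.

Lemma embed_pidx i : embed (pidx i) = pidx (old_index i).
Proof. by rewrite /embed val_pidx valK. Qed.

Lemma embed_nidx i : embed (nidx i) = nidx (old_index i).
Proof.
rewrite /embed rev_nidx val_pidx valK insubN // val_nidx.
by have := ltn_ord i; lia.
Qed.

Lemma embed_rank0 c : k = 0%N -> embed c = ord0.
Proof.
move=> k0; have h m : ~~ (m < k)%N by rewrite k0.
by rewrite /embed !insubN.
Qed.

Lemma embed_rev c : (0 < k)%N -> embed (rev_ord c) = rev_ord (embed c).
Proof.
by move=> /(idx_cases c)[[i ->]|[i ->]];
  rewrite ?rev_pidx ?rev_nidx ?embed_pidx ?embed_nidx ?rev_pidx ?rev_nidx.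
Qed.

Lemma embed_sign (F : finFieldType) c : (0 < k)%N ->
  half_sign F (embed c) = half_sign F c.
Proof.
by move=> /(idx_cases c)[[i ->]|[i ->]];
  rewrite ?embed_pidx ?embed_nidx ?half_sign_pidx ?half_sign_nidx.
Qed.

Lemma embed_ltn (c d : idx k) : (c < d)%N -> (embed c < embed d)%N.
Proof.
case: (posnP k) => [k0 cd|k0].
  have d0 : (d <= 0)%N.
    by apply: (@leq_trans (k.*2).-1); rewrite ?k0 // -ltnS ltn_ord.
  by have := leq_trans cd d0; rewrite ltn0.
have [[i ->]|[i ->]] := idx_cases c k0; have [[j ->]|[j ->]] := idx_cases d k0;
  rewrite ?embed_pidx ?embed_nidx ?val_pidx ?val_nidx => lt.
- exact: enum_val_ltn.
- by have := ltn_ord (old_index i); have := ltn_ord (old_index j); lia.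
- by have := ltn_ord i; have := ltn_ord j; lia.
have ji : (j < i)%N by have := ltn_ord i; have := ltn_ord j; lia.
have := enum_val_ltn ji; rewrite -/(old_index j) -/(old_index i).
by have := ltn_ord (old_index i); lia.
Qed.

Variable F : finFieldType.

Definition delete (x : mat F n.+1) : mat F k := mxsub embed embed x.

Lemma delete_is_linear : linear delete.
Proof. by move=> c x y; apply/matrixP => a b; rewrite !mxE. Qed.

HB.instance Definition _ :=
  GRing.isLinear.Build F (mat F n.+1) (mat F k) _ delete delete_is_linear.

Lemma delete_strict x : x \in supported gtI -> delete x \in supported gtI.
Proof.
move=> /supportedP hx; apply/supportedP => a b; rewrite /gtI -leqNgt => ab.
rewrite mxE hx // /gtI -leqNgt.
move: ab; rewrite leq_eqVlt => /orP[/eqP/ord_inj->//|/embed_ltn]; exact: ltnW.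
Qed.

Lemma delete_skew x : skew_lower x -> skew_lower (delete x).
Proof.
move=> hx; have sx := skew_lower_strict hx.
case: (posnP k) => [k0|k0].
  suff -> : delete x = 0 by exact: skew_lower0.
  by apply/matrixP => a b; rewrite !mxE !embed_rank0 // (supportedP _ _ sx).
rewrite /skew_lower delete_strict //; apply/eqP/matrixP => a b.
by rewrite !mxE (skew_entry (embed a) (embed b) hx) opprK !embed_rev ?embed_sign.
Qed.

Lemma coord_delete (al : pos_root k) x :
  root_coord al (delete x) = root_coord (unrelabel al) x.
Proof.
by rewrite /root_coord mxE; case: al => *; rewrite /root_row /root_col !(embed_pidx, embed_nidx).
Qed.

Lemma lie_relabelE x : skew_lower x -> lie_relabel b1 x = delete x.
Proof.
move=> hx; rewrite [RHS](skew_lower_expand (delete_skew hx)).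
by apply: eq_bigr => al _; rewrite coord_delete.
Qed.

Lemma unrelabel_inj : injective (@unrelabel n b1).
Proof.
case=> [i j h|i j h|i]; case=> [i' j' h'|i' j' h'|i'] //= [].
- by move=> /enum_val_inj ei /enum_val_inj ej; apply: eps_sub_eq.
- by move=> /enum_val_inj ei /enum_val_inj ej; apply: eps_add_eq.
- by move=> /enum_val_inj ->.
Qed.

Lemma unrelabelP (al : pos_root n.+1) :
  (exists al', @unrelabel n b1 al' = al) <->
  (forall i, i \notin rest_idx b1 -> coef al i = 0).
Proof.
split=> [[al' <-] i ni|h].
  have neq j : (i == old_index j) = false.
    by apply: contraNF ni => /eqP ->; apply: old_index_mem.
  by case: al' => *; rewrite coefE !neq.
have mem i : coef al i != 0 -> exists i', i = old_index i'.
  move=> ci; have ir : i \in rest_idx b1 by apply: contraNT ci => /h ->.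
  by exists (enum_rank_in ir i); rewrite /old_index enum_rankK_in.
have lt (i j : 'I_k) : (old_index i < old_index j)%N -> (i < j)%N.
  by apply: contraLR; rewrite -!leqNgt leq_eqVlt => /orP[/eqP/ord_inj->//|/enum_val_ltn/ltnW].
case: al h mem => [i j ij|i j ij|i] h mem.
- have [|i' ei] := mem i; first by rewrite coefE eqxx !ord_eqE; move: (ij); clear; lia.
  have [|j' ej] := mem j; first by rewrite coefE eqxx !ord_eqE; move: (ij); clear; lia.
  have ij' : (i' < j')%N by apply: lt; rewrite -ei -ej.
  by exists (eps_sub ij'); apply: eps_sub_eq.
- have [|i' ei] := mem i; first by rewrite coefE eqxx !ord_eqE; move: (ij); clear; lia.
  have [|j' ej] := mem j; first by rewrite coefE eqxx !ord_eqE; move: (ij); clear; lia.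
  have ij' : (i' < j')%N by apply: lt; rewrite -ei -ej.
  by exists (eps_add ij'); apply: eps_add_eq.
- have [|i' ei] := mem i; first by rewrite coefE eqxx.
  by exists (eps_dbl i'); rewrite ei.
Qed.

End Relabel.

(** * Deletion on the groups attached to the first root *)

Section Deletion.

Variables (n : nat) (b1 : pos_root n.+1) (F : finFieldType).
Implicit Types (x y : mat F n.+1) (al : pos_root n.+1).

Local Notation k := (rank_tilde b1).
Let iota := root_row b1.

Lemma rest_idx0 : ord0 \notin rest_idx b1.
Proof. by rewrite /rest_idx; case: ifP => _; case: (b1) => *; rewrite !inE. Qed.

Lemma rest_idx_out i : i \notin rest_idx b1 -> i != ord0 ->
  [/\ root_col b1 = ord0, b1 != eps_dbl ord0 & iota = pidx i \/ iota = nidx i].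
Proof.
rewrite /rest_idx /iota; have [c0|c0] := eqVneq (root_col b1) ord0; last first.
  by rewrite !inE negbK => ->.
case: (b1) c0 => [i' j h|i' j h|i'] c0; rewrite !inE negbK.
- by move=> /orP[->//|/eqP ->] _; split=> //; left.
- by move=> /orP[->//|/eqP ->] _; split=> //; right.
- by move=> ->.
Qed.

Lemma Phi2_sub (j : 'I_n.+1) (h : ((ord0 : 'I_n.+1) < j)%N) : b1 = eps_sub h ->
  Phi2 b1 = Phi1 b1 :\: sminus (eps_add h) /\ rest_idx b1 = ~: [set ord0; j].
Proof. by move=> ->; rewrite /Phi2 /rest_idx root_col_sub0 eqxx. Qed.

Lemma Phi2_add (j : 'I_n.+1) (h : ((ord0 : 'I_n.+1) < j)%N) : b1 = eps_add h ->
  Phi2 b1 = Phi1 b1 :\: sminus (eps_sub h) /\ rest_idx b1 = ~: [set ord0; j].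
Proof. by move=> ->; rewrite /Phi2 /rest_idx root_col_add0 eqxx. Qed.

Lemma Phi2_other : root_col b1 != ord0 \/ b1 = eps_dbl ord0 ->
  Phi2 b1 = Phi1 b1 /\ rest_idx b1 = ~: [set ord0].
Proof.
rewrite /Phi2 /rest_idx => -[/negPf ->//|->].
by rewrite /root_col pidx0 eqxx.
Qed.

Lemma coef_out2 al (j : 'I_n.+1) :
  [forall i, (i \notin ~: [set ord0; j]) ==> (coef al i == 0)] =
    (root_col al != ord0) && (coef al j == 0).
Proof.
rewrite coef_col0 negbK; apply/forallP/andP => [h|[h0 hj] i].
  by have := (h ord0, h j); rewrite !inE !eqxx orbT => -[].
by rewrite !inE negbK; apply/implyP => /orP[/eqP->|/eqP->].
Qed.

Lemma coef_out1 al :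
  [forall i, (i \notin ~: [set (ord0 : 'I_n.+1)]) ==> (coef al i == 0)] =
    (root_col al != ord0).
Proof.
rewrite coef_col0 negbK; apply/forallP/idP => [/(_ ord0)|h i].
  by rewrite !inE eqxx.
by rewrite !inE negbK; apply/implyP => /eqP->.
Qed.

(** If b1 is a short root of the first column and j its second index, the nonzero
    coefficients at j of the roots of Phi1 all have the same sign, and the roots
    where they occur are the ones that Phi2 excludes. *)
Lemma Phi2E al : (al \in Phi2 b1) = [forall i, (i \notin rest_idx b1) ==> (coef al i == 0)].
Proof.
have dis (z : int) : ~~ (0 < z) && ~~ (z < 0) = (z == 0).
  by apply/idP/idP; lia.
case E: {-}b1 / (first_rootP b1) => [be cb||j h|j h].
- have [-> ->] := Phi2_other (or_introl (etrans (congr1 (fun b => root_col b != ord0) E) cb)).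
  by rewrite coef_out1 Phi1E Psi_away // E.
- have [-> ->] := Phi2_other (or_intror E).
  by rewrite coef_out1 Phi1E Psi_long // andb_idl // => ->.
- have [-> ->] := Phi2_sub E; rewrite coef_out2 in_setD Phi1E.
  have [_|al0] := eqVneq (root_col al) ord0; first by rewrite !andbF.
  by rewrite andbT (Psi_sub E al0) sminus_outside ?root_col_add0 // singular_add // dis.
- have [-> ->] := Phi2_add E; rewrite coef_out2 in_setD Phi1E.
  have [_|al0] := eqVneq (root_col al) ord0; first by rewrite !andbF.
  by rewrite andbT (Psi_add E al0) sminus_outside ?root_col_sub0 // singular_sub // andbC dis.
Qed.

Lemma Phi2P al : reflect (exists a : pos_root (rank_tilde b1), unrelabel a = al) (al \in Phi2 b1).
Proof.
rewrite Phi2E; apply: (iffP forallP) => [h|/unrelabelP h i].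
  by apply/unrelabelP => i ni; apply/eqP; move/implyP: (h i); apply.
by apply/implyP => /h ->.
Qed.

Lemma sub_Phi2_Phi1 : Phi2 b1 \subset Phi1 b1.
Proof.
rewrite /Phi2; case: ifP => _ //; case: (b1) => *; rewrite ?subsetDl //.
Qed.

Lemma sub_Phi1_Psi : Phi1 b1 \subset Psi b1.
Proof. by apply/subsetP => al; rewrite Phi1E => /andP[]. Qed.

Lemma embed_inj : injective (@embed n b1).
Proof.
move=> c d e; apply: ord_inj; have := @embed_ltn n b1 c d; have := @embed_ltn n b1 d c.
by rewrite e ltnn; by case: ltngtP => // _ h1 h2; [have := h1 isT | have := h2 isT].
Qed.

Lemma embed_interior (c : idx k) : (0 < k)%N ->
  (embed c != ord0) && (embed c != ord_max).
Proof.
have h (i : 'I_k) : old_index i != ord0.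
  by apply: contraNneq rest_idx0 => <-; apply: old_index_mem.
move=> /(idx_cases c)[[i ->]|[i ->]]; rewrite ?embed_pidx ?embed_nidx -pidx0 -nidx0.
  by rewrite (inj_eq (@pidx_inj _)) h eq_sym nidx_pidx.
by rewrite (inj_eq (@nidx_inj _)) h nidx_pidx.
Qed.

(** The removed indices are 1 and -1, together with the row of b1 and its opposite
    if b1 is a short root of the first column. For each of them, the row or the
    column is zero outside the removed indices on all matrices supported by
    H_pattern. *)
Lemma H_pattern_through (a b : idx k) (c : idx n.+1) :
  H_pattern b1 (embed a) c -> H_pattern b1 c (embed b) -> exists d : idx (rank_tilde b1), c = embed d.
Proof.
move=> hac hcb; have [_ st] := strict_H_pattern b1.
case: (posnP k) => [k0|k0]; first by have := st _ _ hac; rewrite embed_rank0.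
have [/andP[ea0 eaM] /andP[eb0 ebM]] := (embed_interior a k0, embed_interior b k0).
have out i : c = pidx i \/ c = nidx i -> i \notin rest_idx b1 -> False.
  move=> ci ni; have [i0|i0] := eqVneq i ord0.
    case: ci => cE; move: hac hcb; rewrite cE i0 ?pidx0 ?nidx0 => /st h1 /st h2 //.
    by have := leq_trans h1 (leq_ord (embed a)); rewrite ltnn.
  have [c1 nl io] := rest_idx_out ni i0.
  have iomax : iota != ord_max by rewrite root_row_max.
  have : c = iota \/ c = rev_ord iota.
    by case: ci => ->; case: io => ->; rewrite ?rev_nidx ?rev_pidx; auto.
  case=> cE.
    move: hcb (st _ _ hcb); rewrite cE => /andP[/andP[_ nb] _] lt.
    by move: nb; rewrite eqxx blocked_short // lt andbT /= lt0n; move: eb0; rewrite -val_eqE /= => ->.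
  move: hac (st _ _ hac); rewrite cE => /andP[_ nb] lt.
  have lt2 : (rev_ord (embed a) < iota)%N by rewrite -[iota]rev_ordK rev_ord_ltn.
  have gt0 : (0 < rev_ord (embed a))%N.
    by rewrite lt0n -[_ == _]/(rev_ord (embed a) == ord0) rev_ord_max.
  by move: nb; rewrite eqxx blocked_short // lt2 gt0.
have [[i ci]|[i ci]] := idx_cases c (ltn0Sn n); have ir : i \in rest_idx b1.
- by apply/negPn/negP; apply: out; left.
- by exists (pidx (enum_rank_in ir i)); rewrite embed_pidx /old_index enum_rankK_in.
- by apply/negPn/negP; apply: out; right.
- by exists (nidx (enum_rank_in ir i)); rewrite embed_nidx /old_index enum_rankK_in.
Qed.

Lemma deleteM : {in supported (H_pattern b1) &, forall x y,
  delete b1 (x * y) = delete b1 x * delete b1 y}.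
Proof.
move=> x y /supportedP hx /supportedP hy; apply/matrixP => a b; rewrite !mxE.
rewrite (bigID (mem ((@embed n b1) @: [set: idx k]))) /= [X in _ + X]big1 ?addr0.
  rewrite big_imset /=; last by move=> ? ? _ _; apply: embed_inj.
  by apply: eq_big => [c|c _]; rewrite ?inE // !mxE.
move=> c /negP nc; case hac: (H_pattern b1 (embed a) c); last by rewrite hx ?hac ?mul0r.
case hcb: (H_pattern b1 c (embed b)); last by rewrite hy ?hcb ?mulr0.
by have [d cE] := H_pattern_through hac hcb; case: nc; rewrite cE imset_f ?inE.
Qed.

Lemma delete_eq0 x : x \in lie_span F (Psi b1) ->
  reflect (forall al, al \in Phi2 b1 -> root_coord al x = 0) (delete b1 x == 0).
Proof.
move=> /lie_span_skew sx; apply: (iffP eqP) => [d0 al /Phi2P[al' <-]|h].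
  by rewrite -coord_delete d0 /root_coord mxE.
apply: skew_lower_ext => [||al']; [exact: delete_skew | exact: skew_lower0 |].
by rewrite coord_delete h ?/root_coord ?mxE //; apply/Phi2P; exists al'.
Qed.

Definition border (a : idx n.+1) := (a == ord0) || (a == ord_max).

(** The projection from Lie(H) to Lie(V'), which forgets the first column. *)
Definition middle x : mat F n.+1 :=
  \matrix_(a, b) (if border a || border b then 0 else x a b).

Lemma middle_is_linear : linear middle.
Proof.
by move=> c x y; apply/matrixP => a b; rewrite !mxE; case: ifP; rewrite // mulr0 addr0.
Qed.

HB.instance Definition _ :=
  GRing.isLinear.Build F (mat F n.+1) (mat F n.+1) _ middle middle_is_linear.

Lemma middle_strict x : x \in supported gtI -> middle x \in supported gtI.
Proof.
by move=> /supportedP hx; apply/supportedP => a b ab; rewrite mxE hx // if_same.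
Qed.

Lemma border_rev a : border (rev_ord a) = border a.
Proof. by rewrite /border rev_ord_max -(rev_ord_max (rev_ord a)) rev_ordK orbC. Qed.

Lemma middle_skew x : skew_lower x -> skew_lower (middle x).
Proof.
move=> hx; rewrite /skew_lower middle_strict ?skew_lower_strict //.
apply/eqP/matrixP => a b; rewrite !mxE !border_rev orbC.
case: ifP => _; first by rewrite mulr0 oppr0.
by rewrite (skew_entry a b hx) opprK.
Qed.

Lemma middleM : {in supported gtI &, forall x y, middle (x * y) = middle x * middle y}.
Proof.
move=> x y /supportedP hx /supportedP hy; apply/matrixP => a b; rewrite !mxE.
case: ifPn => [bab|]; last rewrite negb_or => /andP[na nb].
  by rewrite big1 // => c _; rewrite !mxE; case/orP: bab => ->; rewrite ?orbT ?mul0r ?mulr0.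
apply: eq_bigr => c _; rewrite !mxE (negPf na) (negPf nb) orbF /=.
case: ifP => // /orP[/eqP->|/eqP->].
  by rewrite (hy ord0) ?mulr0.
by rewrite (hx _ ord_max) ?mul0r // /gtI -leqNgt leq_ord.
Qed.

Lemma middle_eq0 x : x \in lie_span F (Psi b1) ->
  reflect (forall al, al \in Phi1 b1 -> root_coord al x = 0) (middle x == 0).
Proof.
case/lie_spanP => sx x0; apply: (iffP eqP) => [m0 al|h].
  rewrite Phi1E => /andP[_ c0]; have := congr1 (root_coord al) m0.
  rewrite /root_coord !mxE /border (negPf c0) (negPf (row_not_max c0)) !orbF.
  have [lt _] := root_col_row al.
  have -> : (root_row al == ord0) = false by apply: contraTF lt => /eqP ->.
  have -> // : (root_col al == ord_max) = false.
  by apply: contraTF lt => /eqP ->; rewrite -leqNgt leq_ord.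
apply: skew_lower_ext => [||al]; [exact: middle_skew | exact: skew_lower0 |].
rewrite /root_coord !mxE; case: ifPn => // nb; have [c0|c0] := eqVneq (root_col al) ord0.
  by move: nb; rewrite /border c0 eqxx !orbT.
have [alP|alP] := boolP (al \in Psi b1); last exact: (x0 al).
by apply: (h al); rewrite Phi1E alP.
Qed.

End Deletion.

(** * The coadjoint action *)

Section Coadjoint.

Variables (F : finFieldType) (r p : nat).
Hypotheses (charFp : p \in [pchar F]) (le_rp : (r.*2 <= p)%N).
Implicit Types (x y : mat F r) (g h : {'GL_(r.*2)[F]}) (f : udual F r).

Lemma dual_evalD f x y : dual_eval f (x + y) = dual_eval f x + dual_eval f y.
Proof.
by rewrite /dual_eval -big_split; apply: eq_bigr => al _; rewrite root_coordD mulrDr.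
Qed.

Lemma dual_evalZ f c x : dual_eval f (c *: x) = c * dual_eval f x.
Proof.
by rewrite /dual_eval mulr_sumr; apply: eq_bigr => al _; rewrite /root_coord mxE mulrCA.
Qed.

Lemma dual_eval_is_linear f : linear_for *%R (dual_eval f).
Proof. by move=> c x y; rewrite dual_evalD dual_evalZ. Qed.

HB.instance Definition _ f :=
  GRing.isLinear.Build F (mat F r) F _ (dual_eval f) (dual_eval_is_linear f).

Lemma dual_eval_addl f f' x : dual_eval (f + f') x = dual_eval f x + dual_eval f' x.
Proof.
by rewrite /dual_eval -big_split; apply: eq_bigr => al _; rewrite ffunE mulrDl.
Qed.

Lemma dual_eval_subl f f' x : dual_eval (f - f') x = dual_eval f x - dual_eval f' x.
Proof.
rewrite dual_eval_addl /dual_eval -sumrN; congr (_ + _).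
by apply: eq_bigr => al _; rewrite ffunE mulNr.
Qed.

Lemma udual_ext f f' :
  (forall x, skew_lower x -> dual_eval f x = dual_eval f' x) -> f = f'.
Proof.
move=> h; apply/ffunP => al.
by have := h _ (root_mx_skew F al); rewrite !dual_eval_mx.
Qed.

Lemma coadj_eval g f x : skew_lower x ->
  dual_eval (coadj g f) x = dual_eval f (GLval g^-1 * x * GLval g).
Proof. by move=> hx; rewrite coadjE //; apply/lie_uP. Qed.

Lemma coadj1 f : coadj 1%g f = f.
Proof.
apply: udual_ext => x hx; rewrite coadj_eval //.
by have -> : GLval (1^-1)%g * x * GLval (1%g : {'GL_(r.*2)[F]}) = x;
  rewrite ?invg1 ?GL_1E ?mul1r ?mulr1.
Qed.

Lemma coadjM : {in group_U F r &, forall g h f, coadj (g * h)%g f = coadj g (coadj h f)}.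
Proof.
move=> g h gU hU f; apply: udual_ext => x hx; rewrite !coadj_eval //; last first.
  exact: (skew_lower_conj charFp le_rp).
by rewrite invMg !GL_ME !mulrA.
Qed.

Lemma rook_formE (D : {set pos_root r}) (xi : pos_root r -> F) al :
  rook_form D xi al = if al \in D then xi al else 0.
Proof.
rewrite /rook_form sum_ffunE; case: ifPn => alD.
  rewrite (bigD1 al) //= !ffunE eqxx mulr1 big1 ?addr0 // => b /andP[_ nb].
  by rewrite !ffunE eq_sym (negPf nb) mulr0.
rewrite big1 // => b bD; rewrite !ffunE; case: eqP => [E|]; last by rewrite mulr0.
by rewrite E bD in alD.
Qed.

End Coadjoint.

(** * The block attached to a rook placement *)

Section Block.

Variables (n p : nat) (F : finFieldType).
Hypotheses (charFp : p \in [pchar F]) (le_rp : (n.+1.*2 <= p)%N).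
Variables (D : {set pos_root n.+1}) (b1 : pos_root n.+1) (xi : pos_root n.+1 -> F).
Hypothesis D_col1 : D :&: Cset ord0 = if root_col b1 == ord0 then [set b1] else set0.
Hypothesis D_rest : forall be, be \in D -> root_col be != ord0 -> be \in Phi2 b1.

Local Notation k := (rank_tilde b1).
Local Notation Psi := (Psi b1).
Local Notation iota := (root_row b1).
Implicit Types (x y : mat F n.+1) (g h : {'GL_(n.+1.*2)[F]}) (f : udual F n.+1).
Implicit Types (al be : pos_root n.+1).

Let f0 : udual F n.+1 := rook_form D xi.
Let f0' : udual F k := rook_form (Dtilde D b1) (xitilde xi).

Lemma le_kp : (k.*2 <= p)%N.
Proof.
apply: leq_trans le_rp; rewrite leq_double.
by apply: leq_trans (max_card _) _; rewrite card_ord.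
Qed.

(** The functional defining psi, as an entry of the matrix, so that it can be
    evaluated on products. *)
Definition first_coord x : F := (if root_col b1 == ord0 then xi b1 else 0) * x iota ord0.

Lemma first_coordD x y : first_coord (x + y) = first_coord x + first_coord y.
Proof. by rewrite /first_coord mxE mulrDr. Qed.

Lemma first_coordZ c x : first_coord (c *: x) = c * first_coord x.
Proof. by rewrite /first_coord mxE mulrCA. Qed.

Definition restrict f : udual F k := [ffun al => f (unrelabel al)].

Lemma dual_eval_Phi2 f x :
  \sum_(al in Phi2 b1) f al * root_coord al x = dual_eval (restrict f) (delete b1 x).
Proof.
have -> : Phi2 b1 = [set unrelabel al | al : pos_root k].
  apply/setP => al; apply/Phi2P/imsetP => [[a <-]|[a _ ->]]; by exists a.
rewrite big_imset /=; last by move=> ? ? _ _; apply: unrelabel_inj.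
by apply: eq_bigr => al _; rewrite ffunE coord_delete.
Qed.

Lemma Phi2_col al : al \in Phi2 b1 -> root_col al != ord0.
Proof. by move/(subsetP (sub_Phi2_Phi1 _)); rewrite Phi1E => /andP[]. Qed.

Lemma sub_Phi2_Psi : Phi2 b1 \subset Psi.
Proof. exact: subset_trans (sub_Phi2_Phi1 _) (sub_Phi1_Psi _). Qed.

(** The roots of D outside Phi2 lie in the first column, by D_rest, and b1 is the
    only root of D that can be there. *)
Lemma rook_form_first x :
  \sum_(al | al \notin Phi2 b1) f0 al * root_coord al x = first_coord x.
Proof.
have DC al : (al \in D) && (root_col al == ord0) = (root_col b1 == ord0) && (al == b1).
  move/setP/(_ al): D_col1; rewrite !inE => ->; case: (root_col b1 == ord0); by rewrite inE.
have zero al : al \notin Phi2 b1 -> al \in D -> root_col al == ord0.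
  by move=> nP alD; apply: contraNT nP; apply: D_rest.
rewrite /first_coord; have [c0|c0] := eqVneq (root_col b1) ord0; last first.
  rewrite mul0r big1 // => al nP; rewrite rook_formE; case: ifP; rewrite ?mul0r //.
  move=> alD; have := DC al; rewrite alD zero //; by rewrite (negPf c0).
have /andP[b1D _] : (b1 \in D) && (root_col b1 == ord0) by rewrite DC c0 !eqxx.
rewrite (bigD1 b1) /=; last by apply: contraL (eqxx (root_col b1)) => /Phi2_col; rewrite c0 => /negP.
rewrite rook_formE b1D /root_coord c0 big1 ?addr0 // => al /andP[nP nb].
rewrite rook_formE; case: ifP; rewrite ?mul0r // => alD.
by have := DC al; rewrite alD zero // c0 eqxx (negPf nb).
Qed.

Lemma restrict_rook_form : restrict f0 = f0'.
Proof.
apply/ffunP => al; rewrite ffunE !rook_formE /Dtilde /xitilde !inE.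
by rewrite (Phi2_col (introT (Phi2P _ _) (ex_intro _ al erefl))).
Qed.

Lemma dual_eval_split f x :
  dual_eval f x = dual_eval (restrict f) (delete b1 x)
                  + \sum_(al | al \notin Phi2 b1) f al * root_coord al x.
Proof. by rewrite -dual_eval_Phi2 /dual_eval (bigID (mem (Phi2 b1))). Qed.

Lemma rook_form_split x :
  dual_eval f0 x = first_coord x + dual_eval f0' (delete b1 x).
Proof. by rewrite dual_eval_split rook_form_first restrict_rook_form addrC. Qed.

Let Omega' := rook_orbit (Dtilde D b1) (xitilde (b1 := b1) xi).

(** Stated on coordinates, so that the points above a given one of the smaller
    orbit can be counted; blockP characterizes them by restriction to Lie(H). *)
Definition block : {set udual F n.+1} :=
  [set f : udual F n.+1 | (restrict f \in Omega') &&
     [forall al, (al \in Psi :\: Phi2 b1) ==> (f al == f0 al)]].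

Definition extends f (f' : udual F k) : Prop :=
  forall x, x \in lie_span F Psi ->
    dual_eval f x = first_coord x + dual_eval f' (delete b1 x).

Lemma block_eval f : f \in block -> extends f (restrict f).
Proof.
rewrite inE => /andP[_ /forallP fE] x /lie_spanP[sx x0].
rewrite dual_eval_split addrC -rook_form_first; congr (_ + _).
apply: eq_bigr => al nP; have [aP|aP] := boolP (al \in Psi); last by rewrite x0 ?mulr0.
by move/implyP: (fE al); rewrite in_setD nP aP => /(_ isT)/eqP ->.
Qed.

Lemma blockP f : reflect (exists2 f', f' \in Omega' & extends f f') (f \in block).
Proof.
apply: (iffP idP) => [fB|[f' f'O ext]].
  by exists (restrict f); [move: fB; rewrite inE => /andP[] | exact: block_eval].
have evalf al : al \in Psi -> f al = (if al \in Phi2 b1 then 0 else f0 al)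
    + dual_eval f' (delete b1 (root_mx F al)).
  move=> aP; have := ext (root_mx F al); rewrite dual_eval_mx => ->.
    congr (_ + _); rewrite -rook_form_first; case: ifPn => a2.
      rewrite big1 // => be nb; rewrite root_coord_mx.
      by case: eqP nb => [->|]; rewrite ?a2 // mulr0.
    rewrite (bigD1 al) //= root_coord_mx eqxx mulr1 big1 ?addr0 // => be /andP[_ nb].
    by rewrite root_coord_mx (negPf nb) mulr0.
  apply/lie_spanP; split=> [|be nb]; first exact: root_mx_skew.
  by rewrite root_coord_mx; case: eqP nb => // ->; rewrite aP.
rewrite inE; apply/andP; split.
  suff -> : restrict f = f' by [].
  apply/ffunP => al; rewrite ffunE.
  have a2 : unrelabel al \in Phi2 b1 by apply/Phi2P; exists al.
  rewrite evalf ?(subsetP sub_Phi2_Psi) // a2 add0r /dual_eval (bigD1 al) //=.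
  rewrite coord_delete root_coord_mx eqxx mulr1 big1 ?addr0 // => be nb.
  by rewrite coord_delete root_coord_mx (inj_eq (@unrelabel_inj _ _)) (negPf nb) mulr0.
apply/forallP => al; apply/implyP; rewrite in_setD => /andP[n2 aP]; apply/eqP.
rewrite evalf // (negPf n2) [X in _ + X](_ : _ = 0) ?addr0 //.
rewrite /dual_eval big1 // => be _; rewrite coord_delete root_coord_mx.
case: eqP => [E|]; rewrite ?mulr0 //; case/negP: n2; rewrite -E.
by apply/Phi2P; exists be.
Qed.

End Block.

(** * The action of H on the block *)

Section BlockGroup.

Variables (n p : nat) (F : finFieldType).
Hypotheses (charFp : p \in [pchar F]) (le_rp : (n.+1.*2 <= p)%N).
Variables (D : {set pos_root n.+1}) (b1 : pos_root n.+1) (xi : pos_root n.+1 -> F).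
Hypothesis D_col1 : D :&: Cset ord0 = if root_col b1 == ord0 then [set b1] else set0.
Hypothesis D_rest : forall be, be \in D -> root_col be != ord0 -> be \in Phi2 b1.

Local Notation k := (rank_tilde b1).
Local Notation Psi := (Psi b1).
Local Notation iota := (root_row b1).
Local Notation T := (H_pattern b1).
Implicit Types (x y : mat F n.+1) (g h : {'GL_(n.+1.*2)[F]}) (f : udual F n.+1).
Implicit Types (al be : pos_root n.+1).

Let le_kp := le_kp le_rp b1.
Let f0 : udual F n.+1 := rook_form D xi.
Let f0' : udual F k := rook_form (Dtilde D b1) (xitilde xi).

(** A step from iota within Lie(H) leads to the column 1, or, if b1 is long, to a
    positive column; from the latter no step leads to the column 1. This makes the
    entry of b1 additive on H. *)
Lemma H_pattern_indecomposable c : root_col b1 = ord0 ->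
  T iota c -> T c ord0 -> False.
Proof.
move=> c0 h1 h2; have [_ st] := strict_H_pattern b1.
have lt1 := st _ _ h1; have lt2 := st _ _ h2.
move: h1 => /andP[/andP[_ n1] _]; rewrite eqxx /= in n1.
have [b1E|nl] := eqVneq b1 (eps_dbl ord0); last first.
  by move: n1; rewrite blocked_short // lt1 lt2.
move: h2 => /andP[_ n2]; rewrite (iota_long b1E) in n2 lt1.
have r0 : ord0 = rev_ord ord_max :> idx n.+1.
  by apply: ord_inj; rewrite /= subnn.
rewrite {1}r0 eqxx /= in n2.
move: n1 n2 lt1 lt2; rewrite !(blocked_long _ b1E) /=; clear; lia.
Qed.

Lemma first_coord_mul0 x y : x \in supported T -> y \in supported T ->
  first_coord b1 xi (x * y) = 0.
Proof.
move=> /supportedP hx /supportedP hy; rewrite /first_coord.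
have [c0|c0] := eqVneq (root_col b1) ord0; last by rewrite mul0r.
rewrite mxE big1 ?mulr0 // => c _.
case h1: (T iota c); last by rewrite hx ?h1 ?mul0r.
case h2: (T c ord0); last by rewrite hy ?h2 ?mulr0.
by case: (H_pattern_indecomposable c0 h1 h2).
Qed.

Lemma first_coord_conj (u v x : mat F n.+1) :
    u - 1 \in supported T -> v - 1 \in supported T -> x \in supported T ->
  first_coord b1 xi (u * x * v) = first_coord b1 xi x.
Proof.
have [[trT _] _ _] := pattern_of_Psi b1.
rewrite -{2}(subrK 1 u) -{2}(subrK 1 v); move: (u - 1) (v - 1) => a b ha hb hx.
rewrite !(mulrDl, mulrDr, mul1r, mulr1) !first_coordD !first_coord_mul0 ?supportedM //.
by rewrite !add0r.
Qed.

Lemma first_coord_groupM (u v : mat F n.+1) :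
    u - 1 \in supported T -> v - 1 \in supported T ->
  first_coord b1 xi (u * v - 1) = first_coord b1 xi (u - 1) + first_coord b1 xi (v - 1).
Proof.
rewrite -{2}(subrK 1 u) -{2}(subrK 1 v); move: (u - 1) (v - 1) => a b ha hb.
have -> : (a + 1) * (b + 1) - 1 = a * b + a + b.
  by rewrite mulrDl mul1r mulrDr mulr1 !addrA addrK.
by rewrite !first_coordD first_coord_mul0 // add0r.
Qed.

Lemma first_coord_exp x : x \in lie_span F Psi ->
  first_coord b1 xi (GLval (exp_gl x) - 1) = first_coord b1 xi x.
Proof.
case/(lie_span_patternP _ (pattern_of_Psi b1)) => sx xT.
have xs := skew_lower_strict sx; have [[trT _] _ _] := pattern_of_Psi b1.
rewrite (exp_glE charFp le_rp xs) (exp_mx_split2 xs) -(addrA 1) (addrAC 1) subrr add0r.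
rewrite first_coordD.
rewrite [X in _ + X](_ : _ = 0) ?addr0 //.
elim/big_rec: _ => [|i s _ IH]; first by rewrite /first_coord mxE mulr0.
rewrite first_coordD IH addr0 first_coordZ exprS first_coord_mul0 ?mulr0 //.
exact: supportedX.
Qed.

Lemma H_supported g : g \in exp_span F Psi -> GLval g - 1 \in supported T.
Proof. by case/(exp_span_patternP charFp le_rp _ (pattern_of_Psi b1)). Qed.

Definition reduce g : {'GL_(k.*2)[F]} := quotient_gl (@delete n b1 F) g.

Lemma reduce_U g : g \in exp_span F Psi -> reduce g \in group_U F k.
Proof. exact: (quotient_gl_U charFp le_rp (@delete_skew _ _ _)). Qed.

Lemma reduceV g : g \in exp_span F Psi -> (reduce g)^-1%g = reduce g^-1%g.
Proof.
exact: (quotient_glV charFp le_rp le_kp (pattern_of_Psi b1) (@deleteM _ _ _)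
  (@delete_strict _ _ _)).
Qed.

Lemma H_conj_span g x : g \in exp_span F Psi -> x \in lie_span F Psi ->
  GLval g^-1 * x * GLval g \in lie_span F Psi.
Proof. exact: (lie_span_conj charFp le_rp (pattern_of_Psi b1)). Qed.

Lemma delete_conj g x : g \in exp_span F Psi -> x \in lie_span F Psi ->
  delete b1 (GLval g^-1 * x * GLval g) =
    GLval (reduce g)^-1 * delete b1 x * GLval (reduce g).
Proof.
exact: (quotient_conj charFp le_rp le_kp (pattern_of_Psi b1) (@deleteM _ _ _)
  (@delete_strict _ _ _)).
Qed.

(** Restriction to Lie(H) intertwines the action of H with the action of its
    quotient on the smaller dual space. *)
Lemma extends_coadj g f (f' : udual F k) : g \in exp_span F Psi ->
  extends xi f f' -> extends xi (coadj g f) (coadj (reduce g) f').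
Proof.
move=> gH ext x hx; have gVH := exp_spanV charFp le_rp gH.
have sx := lie_span_skew hx.
rewrite !coadj_eval // ?ext ?H_conj_span //; last exact: delete_skew.
rewrite delete_conj //; congr (_ + _).
have [_ xT] := lie_span_patternP _ (pattern_of_Psi b1) hx.
exact: (first_coord_conj (H_supported gVH) (H_supported gH) xT).
Qed.

Lemma reduce_onto (g' : {'GL_(k.*2)[F]}) : g' \in group_U F k ->
  exists2 g, g \in exp_span F Psi & reduce g = g'.
Proof.
move=> g'U; have [sx' ex'] := ln_glP charFp le_kp g'U.
pose x := \sum_al root_coord al (ln_gl g') *: root_mx F (@unrelabel n b1 al).
have coordx be : root_coord be x = \sum_al root_coord al (ln_gl g') *+ (be == @unrelabel n b1 al).
  rewrite /root_coord summxE; apply: eq_bigr => al _.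
  by rewrite mxE -/(root_coord be _) root_coord_mx mulr_natr.
have hx : x \in lie_span F Psi.
  apply/lie_spanP; split=> [|be nb].
    by apply: skew_lower_sum => al _; apply/skew_lowerZ/root_mx_skew.
  rewrite coordx big1 // => al _; case: eqP => // E; case/negP: nb.
  by apply: (subsetP (sub_Phi2_Psi b1)); apply/Phi2P; exists al.
exists (exp_gl x); first exact: exp_span_mem.
rewrite /reduce /quotient_gl (exp_glK charFp le_rp (lie_span_skew hx)) -[RHS]ex'; congr exp_gl.
apply: skew_lower_ext => // [|al]; first exact/delete_skew/(lie_span_skew hx).
rewrite coord_delete coordx (bigD1 al) //= eqxx mulr1n big1 ?addr0 // => be nb.
by rewrite (inj_eq (@unrelabel_inj _ _)) eq_sym (negPf nb).
Qed.

Lemma block_stable : {in exp_span F Psi & block D b1 xi, forall g f,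
  coadj g f \in block D b1 xi}.
Proof.
move=> g f gH /(blockP xi D_col1 D_rest)[f' /imsetP[h hU ->] ext].
apply/(blockP xi D_col1 D_rest); exists (coadj (reduce g) (coadj h f0')); last exact: extends_coadj.
rewrite -(coadjM charFp le_kp) ?reduce_U //; apply: imset_f.
exact: (group_UM charFp le_kp (reduce_U gH) hU).
Qed.

Lemma f0_extends : extends xi f0 f0'.
Proof. by move=> x _; rewrite (rook_form_split xi D_col1 D_rest). Qed.

Lemma f0_block : f0 \in block D b1 xi.
Proof.
apply/(blockP xi D_col1 D_rest); exists f0'; last exact: f0_extends.
by rewrite /rook_orbit -[X in X \in _]coadj1; apply: imset_f; apply: exp_span1 charFp le_kp _.
Qed.

(** The point of the smaller orbit below f is moved to the base point by an element
    of the smaller group, which lifts to H. *)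
Lemma block_normalize f : f \in block D b1 xi ->
  exists2 h, h \in exp_span F Psi &
    forall x, x \in lie_span F Psi -> dual_eval (coadj h f) x = dual_eval f0 x.
Proof.
case/(blockP xi D_col1 D_rest) => f' /imsetP[g' g'U ->] ext.
have [g gH gE] := reduce_onto g'U; have gVH := exp_spanV charFp le_rp gH.
exists g^-1%g => // x hx; rewrite (extends_coadj gVH ext hx).
rewrite -reduceV // gE -(coadjM charFp le_kp) ?mulVg ?coadj1 -?f0_extends //.
exact: (exp_spanV charFp le_kp).
Qed.

End BlockGroup.

(** * Matrices supported on the border *)

Section Transvections.

Variables (n : nat) (F : finFieldType).
Implicit Types (x y v w : mat F n.+1) (a b c : idx n.+1).

Lemma half_sign_rev c : half_sign F (rev_ord c) = - half_sign F c.
Proof.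
by have [[j ->]|[j ->]] := idx_cases c (ltn0Sn n);
  rewrite ?rev_pidx ?rev_nidx half_sign_pidx half_sign_nidx ?opprK.
Qed.

(** The skew matrix generated by an elementary matrix; on the antidiagonal the two
    terms of the skew completion coincide and only one of them is kept. *)
Definition mirror a b : mat F n.+1 :=
  delta_mx a b - (if rev_ord b == a then 0
                  else (half_sign F a * half_sign F b) *: delta_mx (rev_ord b) (rev_ord a)).

Lemma mirror_skew a b : (b < a)%N -> skew_lower (mirror a b).
Proof.
move=> ba; rewrite /skew_lower /mirror; case: eqP => [E|_].
  rewrite subr0 delta_strict //= adj_delta E.
  have -> : rev_ord a = b by rewrite -E rev_ordK.
  by rewrite -E half_sign_rev mulNr half_sign_sq scaleN1r.
rewrite supportedB ?supportedZ ?delta_strict ?rev_ord_ltn //=.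
rewrite linearB linearZ /= !adj_delta !rev_ordK !half_sign_rev mulrNN scalerA.
rewrite [half_sign F b * _]mulrC; set e := half_sign F a * half_sign F b.
have -> : e * e = 1.
  rewrite /e; have := half_sign_sq F a; have := half_sign_sq F b.
  by move: (half_sign F a) (half_sign F b) => s t h1 h2; rewrite mulrACA h1 h2 mulr1.
by rewrite scale1r opprB.
Qed.

Lemma mirror_row a b c : mirror a b a c = (c == b)%:R.
Proof.
rewrite /mirror mxE [X in X + _]mxE [X in _ + X]mxE eqxx /=; case: (rev_ord b =P a) => [_|/eqP ne]; first by rewrite mxE subr0.
by rewrite !mxE [a == _]eq_sym (negPf ne) mulr0 subr0.
Qed.

(** The support of the span of the roots of the first column. *)
Definition border_pattern : rel (idx n.+1) :=
  fun a b => (b < a)%N && ((b == ord0) || (a == ord_max)).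

Lemma strict_border_pattern : strict_pattern border_pattern.
Proof.
split=> [b a c /andP[ba h1] /andP[cb h2]|a b /andP[]//].
rewrite /border_pattern (ltn_trans cb ba) /=; case/orP: h2 => [->//|/eqP bM].
by move: ba; rewrite bM ltnNge leq_ord.
Qed.

Lemma border_zero w a b : w \in supported border_pattern ->
  b != ord0 -> a != ord_max -> w a b = 0.
Proof.
by move=> /supportedP hw nb na; rewrite hw // /border_pattern (negPf nb) (negPf na) andbF.
Qed.

Lemma border_mul0 w w' a b : w \in supported border_pattern ->
    w' \in supported border_pattern -> (a != ord_max) || (b != ord0) ->
  (w * w') a b = 0.
Proof.
move=> hw hw' nab; rewrite mxE big1 // => c _.
have [/andP[ca h1]|h1] := boolP (border_pattern a c); last by rewrite (supportedP _ _ hw) ?mul0r.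
have [/andP[bc h2]|h2] := boolP (border_pattern c b); last by rewrite (supportedP _ _ hw') ?mulr0.
have c0 : c != ord0 by apply: contraTneq bc => ->.
have cM : c != ord_max by apply: contraTneq ca => ->; rewrite -leqNgt leq_ord.
by move: h1 h2 nab; rewrite (negPf c0) (negPf cM) /= orbF => -> ->.
Qed.

(** A product of two matrices supported on the border is zero except in the bottom
    left corner. *)
Lemma exp_border_entry v a b : v \in supported border_pattern ->
    (a != ord_max) || (b != ord0) ->
  (exp_mx v - 1) a b = v a b.
Proof.
move=> hv nab; have vs := supported_gtI strict_border_pattern hv.
have [trB _] := strict_border_pattern.
rewrite (exp_mx_split2 vs) -(addrA 1) (addrAC 1) subrr add0r mxE.
rewrite [X in _ + X](_ : _ = 0) ?addr0 // summxE big1 // => i _.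
by rewrite mxE exprS border_mul0 ?mulr0 // supportedX.
Qed.

Definition off_border x : Prop := forall a b, a != ord_max -> b != ord0 -> x a b = 0.

Lemma off_border_delete (b1 : pos_root n.+1) x : x \in supported gtI -> off_border x -> delete b1 x = 0.
Proof.
move=> xs hx; apply/matrixP => a b; rewrite !mxE.
case: (posnP (rank_tilde b1)) => [k0|k0].
  by rewrite !embed_rank0 // (supportedP _ _ xs).
by have [/andP[_ ?] /andP[? _]] := (embed_interior a k0, embed_interior b k0); apply: hx.
Qed.

Lemma off_border_mull w x : w \in supported border_pattern -> x \in supported gtI ->
  forall a b, a != ord_max -> (w * x) a b = 0.
Proof.
move=> hw /supportedP hx a b na; rewrite mxE big1 // => c _.
have [->|c0] := eqVneq c ord0; first by rewrite (hx ord0) ?mulr0.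
by rewrite (border_zero hw c0 na) mul0r.
Qed.

Lemma off_border_mulr w x : w \in supported border_pattern -> x \in supported gtI ->
  forall a b, b != ord0 -> (x * w) a b = 0.
Proof.
move=> hw /supportedP hx a b nb; rewrite mxE big1 // => c _.
have [->|cM] := eqVneq c ord_max; last by rewrite (border_zero hw nb cM) mulr0.
by rewrite (hx _ ord_max) ?mul0r // /gtI -leqNgt leq_ord.
Qed.

Lemma conj_expand (w w' x : mat F n.+1) :
  (1 + w') * x * (1 + w) = x + w' * x + x * w + w' * x * w.
Proof. by rewrite mulrDl mul1r mulrDr mulr1 mulrDl addrA. Qed.

Lemma delete_border_conj (b1 : pos_root n.+1) w w' x :
    w \in supported border_pattern -> w' \in supported border_pattern ->
    x \in supported gtI ->
  delete b1 ((1 + w') * x * (1 + w)) = delete b1 x.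
Proof.
move=> hw hw' hx; have ws := supported_gtI strict_border_pattern hw.
have ws' := supported_gtI strict_border_pattern hw'.
have tr := @trans_gtI n.+1.*2.-1.
have w'x : w' * x \in supported gtI by apply: supportedM.
have d1 : delete b1 (w' * x) = 0.
  by apply: off_border_delete => // a b na _; apply: off_border_mull.
have d2 : delete b1 (x * w) = 0.
  apply: off_border_delete; first exact: supportedM.
  by move=> a b _ nb; apply: off_border_mulr.
have d3 : delete b1 (w' * x * w) = 0.
  apply: off_border_delete; first exact: supportedM.
  by move=> a b _ nb; apply: off_border_mulr.
by rewrite conj_expand !linearD /= d1 d2 d3 !addr0.
Qed.

End Transvections.

Arguments border_pattern {n}.

(** * The block as a block of the orbit *)

Section BlockOrbit.

Variables (n p : nat) (F : finFieldType).
Hypotheses (charFp : p \in [pchar F]) (le_rp : (n.+1.*2 <= p)%N).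
Variables (D : {set pos_root n.+1}) (b1 : pos_root n.+1) (xi : pos_root n.+1 -> F).
Hypothesis D_col1 : D :&: Cset ord0 = if root_col b1 == ord0 then [set b1] else set0.
Hypothesis D_rest : forall be, be \in D -> root_col be != ord0 -> be \in Phi2 b1.
Hypothesis xi_b1 : xi b1 != 0.

Local Notation k := (rank_tilde b1).
Local Notation Psi := (Psi b1).
Local Notation iota := (root_row b1).
Local Notation blocked := (blocked b1).
Local Notation sgn := (@half_sign F n.+1).
Implicit Types (x y v : mat F n.+1) (g h u : {'GL_(n.+1.*2)[F]}) (f : udual F n.+1).
Implicit Types (al be : pos_root n.+1) (a b c d : idx n.+1).

Let f0 : udual F n.+1 := rook_form D xi.

(** For a long root b1 the column of v and its mirror image, the row of v, both
    contribute to the pairing with the row iota, and by the same amount. *)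
Definition pairing_factor : F := if b1 == eps_dbl ord0 then 2 else 1.

(** Blocked entries for a long b1 only exist in rank at least 2, where the
    characteristic is at least 4. *)
Lemma pairing_factor_neq0 b : blocked b -> pairing_factor != 0.
Proof.
rewrite /pairing_factor; have [b1E|_ _] := eqVneq b1 (eps_dbl ord0); last exact: oner_neq0.
rewrite blocked_long // -(dvdn_pcharf charFp) => bb.
apply: contraL le_rp => dv; have := dvdn_leq (isT : (0 < 2)%N) dv.
by rewrite -ltnNge; move: bb => /=; lia.
Qed.

Lemma blocked_span x : skew_lower x -> (forall b, blocked b -> x iota b = 0) ->
  x \in lie_span F Psi.
Proof.
move=> sx x0; apply/(lie_span_patternP _ (pattern_of_Psi b1)); split=> //.
apply/supportedP => a b; rewrite /H_pattern /row_pattern negb_and negb_and !negbK.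
case/orP => [/orP[nba|/andP[/eqP-> /x0//]]|/andP[/eqP-> bl]].
  by rewrite (supportedP _ _ (skew_lower_strict sx)).
by rewrite (skew_entry _ _ sx) rev_ordK x0 ?mulr0 ?oppr0.
Qed.

(** Subtracting from x the combination of mirror elements with the same blocked
    entries leaves an element of Lie(H). *)
Lemma functional_expand (l : udual F n.+1) x :
    (forall y, y \in lie_span F Psi -> dual_eval l y = 0) -> skew_lower x ->
  dual_eval l x = \sum_(b | blocked b) x iota b * dual_eval l (mirror F iota b).
Proof.
move=> l0 sx; pose z := \sum_(b | blocked b) x iota b *: mirror F iota b.
have sz : skew_lower z.
  apply: skew_lower_sum => b /blocked_lt/andP[_ bi].
  by apply/skew_lowerZ/mirror_skew.
have /l0 : x - z \in lie_span F Psi.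
  apply: blocked_span => [|b bl]; first exact/skew_lowerD/skew_lowerN.
  rewrite 2!mxE summxE (bigD1 b) //= mxE mirror_row eqxx mulr1 big1 ?addr0 ?subrr // => c /andP[_ nc].
  by rewrite mxE mirror_row eq_sym (negPf nc) mulr0.
rewrite linearB /= => /eqP; rewrite subr_eq0 => /eqP ->; rewrite linear_sum /=.
by apply: eq_bigr => b _; rewrite dual_evalZ.
Qed.

Lemma mirror0E b a c : b != ord_max ->
  mirror F b ord0 a c = ((a == b) && (c == ord0))%:R
   - sgn b * sgn ord0 * ((a == ord_max) && (c == rev_ord b))%:R.
Proof.
move=> bM; have r0 : rev_ord ord0 = ord_max :> idx n.+1.
  by apply: ord_inj; rewrite /= subn1.
by rewrite /mirror r0 eq_sym (negPf bM) !mxE.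
Qed.

Lemma blocked_max b : blocked b -> b != ord_max.
Proof.
move=> /blocked_lt/andP[_ bi]; apply: contraTneq bi => ->.
by rewrite -leqNgt leq_ord.
Qed.

Lemma blocked_0 b : blocked b -> b != ord0.
Proof. by move=> /blocked_lt/andP[b0 _]; apply: contraTneq b0 => ->. Qed.

Lemma mirror0_col b a : b != ord_max -> a != ord_max -> mirror F b ord0 a ord0 = (a == b)%:R.
Proof.
by move=> bM aM; rewrite mirror0E // (negPf aM) andbT mulr0 subr0.
Qed.

Lemma mirror0_border b : blocked b -> mirror F b ord0 \in supported border_pattern.
Proof.
move=> bl; have bM := blocked_max bl; have b0 := blocked_0 bl.
have sm := mirror_skew F (_ : (ord0 < b)%N).
apply/supportedP => a c; rewrite /border_pattern negb_and => /orP[nac|].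
  apply: (supportedP _ _ (skew_lower_strict (mirror_skew F _))) nac.
  by rewrite lt0n.
by rewrite negb_or mirror0E // => /andP[/negPf-> /negPf->]; rewrite andbF mulr0 subr0.
Qed.

(** Except in the bottom left corner, exp v - 1 has the entries of v. If iota is not
    the last row, only the product of y on the right with exp v contributes to the
    entry iota 1. If iota is the last row, so does the product on the left; the two
    agree by skewness. The term with v on both sides vanishes: the column of v lies
    at negative indices, its row at positive ones, and y is lower triangular. *)
Lemma first_coord_border (co : idx n.+1 -> F) y (v := \sum_(b | blocked b) co b *: mirror F b ord0) :
  root_col b1 = ord0 -> skew_lower y ->
  first_coord b1 xi (exp_mx (- v) * y * exp_mx v) =
    first_coord b1 xi y + xi b1 * (pairing_factor * \sum_(b | blocked b) y iota b * co b).
Proof.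
move=> c0 sy; have ys := skew_lower_strict sy.
have hv : v \in supported border_pattern.
  by apply: supported_sum => b bl; apply/supportedZ/mirror0_border.
have sv : skew_lower v.
  apply: skew_lower_sum => b bl; apply/skew_lowerZ/mirror_skew.
  by rewrite lt0n; exact: blocked_0 bl.
have strB := @strict_border_pattern n.
pose w := exp_mx v - 1; pose w' := exp_mx (- v) - 1.
have hw : w \in supported border_pattern := exp_mx_supported strB hv.
have hw' : w' \in supported border_pattern := exp_mx_supported strB (supportedN hv).
have -> : exp_mx v = 1 + w by rewrite addrC subrK.
have -> : exp_mx (- v) = 1 + w' by rewrite addrC subrK.
rewrite conj_expand !first_coordD -!addrA; congr (_ + _).
rewrite /first_coord c0 eqxx -!mulrDr; congr (_ * _).
have vcol a : a != ord_max -> v a ord0 = if blocked a then co a else 0.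
  move=> aM; rewrite summxE; case: ifPn => bl.
    rewrite (bigD1 a bl) /= mxE mirror0_col ?(blocked_max bl) // eqxx mulr1 big1 ?addr0 // => b /andP[blb nb].
    by rewrite mxE mirror0_col ?(blocked_max blb) // eq_sym (negPf nb) mulr0.
  rewrite big1 // => b blb; rewrite mxE mirror0_col ?(blocked_max blb) //.
  by case: eqP => [ab|_]; [rewrite ab blb in bl | rewrite mulr0].
have ymax a : y a ord_max = 0 by rewrite (supportedP _ _ ys) // /gtI -leqNgt leq_ord.
have yw : (y * w) iota ord0 = \sum_(b | blocked b) y iota b * co b.
  rewrite mxE [RHS]big_mkcond; apply: eq_bigr => c _.
  have [->|cM] := eqVneq c ord_max.
    by rewrite ymax mul0r; case: ifP => // /blocked_max; rewrite eqxx.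
  by rewrite exp_border_entry ?cM // vcol //; case: ifP; rewrite ?mulr0.
rewrite yw /pairing_factor; have [b1E|nl] := eqVneq b1 (eps_dbl ord0); last first.
  have iM : iota != ord_max by rewrite root_row_max.
  have e1 c : (w' * y) iota c = 0 by rewrite (off_border_mull hw' ys).
  have -> : (w' * y * w) iota ord0 = 0 by rewrite mxE big1 // => c _; rewrite e1 mul0r.
  by rewrite e1 add0r addr0 mul1r.
have iE := iota_long b1E; rewrite iE in yw *.
have sM : sgn (ord_max : idx n.+1) * sgn ord0 = -1.
  by rewrite -nidx0 -pidx0 half_sign_nidx half_sign_pidx mulr1.
have r0 : rev_ord ord0 = ord_max :> idx n.+1 by apply: ord_inj; rewrite /= subn1.
have rM : rev_ord ord_max = ord0 :> idx n.+1 by rewrite -r0 rev_ordK.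
have w'row c : c != ord0 -> w' ord_max c =
    sgn ord_max * sgn c * v (rev_ord c) ord0.
  by move=> cn; rewrite exp_border_entry ?supportedN ?cn ?orbT // mxE (skew_entry _ _ sv) rM opprK.
have w'y : (w' * y) ord_max ord0 = \sum_(b | blocked b) y ord_max b * co b.
  rewrite mxE (reindex_inj rev_ord_inj) /= [RHS]big_mkcond; apply: eq_bigr => c _.
  have [->|cM] := eqVneq c ord_max.
    rewrite rM (supportedP _ _ ys ord0) ?mulr0 //.
    by case: ifP => // /blocked_max; rewrite eqxx.
  have rc0 : rev_ord c != ord0 by rewrite rev_ord_max.
  rewrite w'row // rev_ordK vcol // (skew_entry _ _ sy) rev_ordK r0.
  case: ifP => _; last by rewrite mulr0 mul0r.
  transitivity (- (sgn ord_max * sgn ord0)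
     * (sgn (rev_ord c) * sgn (rev_ord c)) * (y ord_max c * co c)).
    by move: (sgn _) (sgn _) (sgn _) => s1 s2 s3; ring.
  by rewrite sM half_sign_sq opprK !mul1r.
have w'yw : (w' * y * w) ord_max ord0 = 0.
  rewrite mxE big1 // => d _; rewrite mxE mulr_suml big1 // => c _.
  have [dc|ndc] := boolP (gtI c d); last by rewrite (supportedP _ _ ys c d ndc) mulr0 mul0r.
  have cn : c != ord0 by apply: contraTneq dc => ->.
  have dM : d != ord_max by apply: contraTneq dc => ->; rewrite /gtI -leqNgt leq_ord.
  have rcM : rev_ord c != ord_max by rewrite -rev_ord_max rev_ordK.
  rewrite w'row // exp_border_entry ?dM // !vcol //.
  case: ifP => [b1c|]; last by rewrite mulr0 !mul0r.
  case: ifP => [b1d|]; last by rewrite mulr0.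
  move: b1c b1d; rewrite !blocked_long // => h1 h2.
  by move: dc h1 h2; rewrite /gtI /=; clear; lia.
by rewrite w'y w'yw addr0 mulrDl mul1r.
Qed.

(** The difference of f and the rook form is a combination of blocked entries; the
    coefficients of that combination, divided by those of the pairing, are the
    entries of an element v whose exponential moves the rook form to f. *)
Lemma agree_in_orbit f : (forall x, x \in lie_span F Psi -> dual_eval f x = dual_eval f0 x) ->
  f \in rook_orbit D xi.
Proof.
move=> ff0; have [c0|c0] := eqVneq (root_col b1) ord0; last first.
  have -> : f = f0.
    apply: udual_ext => x sx; apply: ff0; apply/lie_spanP; split=> // al.
    by rewrite Psi_away.
  by rewrite /rook_orbit -[X in X \in _]coadj1; apply: imset_f; apply: exp_span1 charFp le_rp _.
pose l := f - f0.
have l0 y : y \in lie_span F Psi -> dual_eval l y = 0.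
  by move=> hy; rewrite dual_eval_subl ff0 // subrr.
pose co b := dual_eval l (mirror F iota b) / (xi b1 * pairing_factor).
pose v := \sum_(b | blocked b) co b *: mirror F b ord0.
have sv : skew_lower v.
  apply: skew_lower_sum => b bl; apply/skew_lowerZ/mirror_skew.
  by rewrite lt0n; exact: blocked_0 bl.
have vs := skew_lower_strict sv.
apply/imsetP; exists (exp_gl v); first exact: exp_gl_in_U.
apply: udual_ext => x sx; rewrite coadj_eval // -(exp_glN charFp le_rp vs).
rewrite (exp_glE charFp le_rp vs) (exp_glE charFp le_rp (supportedN vs)).
rewrite !(rook_form_split xi D_col1 D_rest) first_coord_border //.
have hv : v \in supported border_pattern.
  by apply: supported_sum => b bl; apply/supportedZ/mirror0_border.
have strB := @strict_border_pattern n.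
have -> : delete b1 (exp_mx (- v) * x * exp_mx v) = delete b1 x.
  rewrite -[exp_mx v](subrK 1) -[exp_mx (- v)](subrK 1) ![_ - 1 + 1]addrC.
  apply: delete_border_conj (exp_mx_supported strB hv) _ (skew_lower_strict sx).
  exact: exp_mx_supported strB (supportedN hv).
rewrite addrAC -(rook_form_split xi D_col1 D_rest).
apply/eqP; rewrite addrC -subr_eq -dual_eval_subl -/l (functional_expand l0 sx).
rewrite mulrA mulr_sumr; apply/eqP; apply: eq_bigr => b bl; rewrite /co.
have m0 := pairing_factor_neq0 bl; have xm0 : xi b1 * pairing_factor != 0 by rewrite mulf_neq0.
by field; rewrite m0.
Qed.

Lemma block_sub_orbit : block D b1 xi \subset rook_orbit D xi.
Proof.
apply/subsetP => f fB.
have [h hH hf] := block_normalize charFp le_rp D_col1 D_rest fB.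
have hU := exp_span_sub_U hH; have /imsetP[g gU gE] := agree_in_orbit hf.
have hVU := exp_spanV charFp le_rp hU.
apply/imsetP; exists (h^-1 * g)%g.
  exact: (group_UM charFp le_rp hVU gU).
by rewrite (coadjM charFp le_rp hVU gU) -gE -(coadjM charFp le_rp hVU hU) mulVg coadj1.
Qed.

Lemma delta_conj_entry (A B : mat F n.+1) i j a b :
  (A * delta_mx i j * B) a b = A a i * B j b.
Proof.
have Ad c : (A * delta_mx i j) a c = A a i * (c == j)%:R.
  rewrite mxE (bigD1 i) //= mxE eqxx big1 ?addr0 // => e ne.
  by rewrite mxE (negPf ne) mulr0.
rewrite mxE (bigD1 j) //= Ad eqxx mulr1 big1 ?addr0 // => c nc.
by rewrite Ad (negPf nc) mulr0 mul0r.
Qed.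

(** Take x to be the mirror element of the entry b 1, for b blocked. It lies in
    Lie(H) and the block vanishes on it. Its conjugate by u again lies in Lie(H),
    is only seen by the entry of b1, and takes there a nonzero multiple of the
    entry iota b of u^-1. *)
Lemma block_return u f : u \in group_U F n.+1 -> f \in block D b1 xi ->
  coadj u f \in block D b1 xi -> u \in exp_span F Psi.
Proof.
move=> uU fB ufB; have uVU := exp_spanV charFp le_rp uU.
have [c0|c0] := eqVneq (root_col b1) ord0; last first.
  have [su eu] := ln_glP charFp le_rp uU; rewrite -eu; apply/exp_span_mem/lie_spanP.
  by split=> // al; rewrite Psi_away.
suff uV0 b : blocked b -> GLval u^-1 iota b = 0.
  have hrow : GLval u^-1 - 1 \in supported (row_pattern b1).
    apply/supportedP => a b; rewrite /row_pattern negb_and negbK => /orP[nba|/andP[/eqP-> bl]].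
      exact: (supportedP _ _ (group_U_strict charFp le_rp uVU)).
    have nib : (iota == b) = false.
      by move: (blocked_lt bl) => /andP[_]; case: eqP => // ->; rewrite ltnn.
    by rewrite 3!mxE uV0 // nib subr0.
  have /(group_UP charFp le_rp) uVs := uVU.
  have [x [sx xr xE]] := symp_unitri_exp charFp le_rp (strict_row_pattern b1) uVs hrow.
  rewrite -[u]invgK; apply: (exp_spanV charFp le_rp); rewrite -xE; apply: exp_span_mem.
  apply: blocked_span => // b bl; apply: (supportedP _ _ xr).
  by rewrite /row_pattern eqxx bl andbF.
move=> bl; have bM := blocked_max bl; have b0 := blocked_0 bl.
pose x := mirror F b ord0; pose z := GLval u^-1 * x * GLval u.
have sx : skew_lower x by apply: mirror_skew; rewrite lt0n.
have sz : skew_lower z by apply: (skew_lower_conj charFp le_rp).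
have u0 d : GLval u ord0 d = (d == ord0)%:R.
  have := supportedP _ _ (group_U_strict charFp le_rp uU) ord0 d isT.
  by rewrite 3!mxE eq_sym => /eqP; rewrite subr_eq0 => /eqP.
have uM a : GLval u^-1 a ord_max = (a == ord_max)%:R.
  have := supportedP _ _ (group_U_strict charFp le_rp uVU) a ord_max.
  by rewrite /gtI -leqNgt leq_ord => /(_ isT); rewrite 3!mxE => /eqP; rewrite subr_eq0 => /eqP.
have r0 : rev_ord ord0 = ord_max :> idx n.+1 by apply: ord_inj; rewrite /= subn1.
have zE a d : z a d = GLval u^-1 a b * (d == ord0)%:R
    - sgn b * sgn ord0 * ((a == ord_max)%:R * GLval u (rev_ord b) d).
  rewrite /z /x /mirror r0 eq_sym (negPf bM) mulrBr mulrBl -scalerAr -scalerAl.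
  by rewrite mxE [X in _ + X]mxE [X in - X]mxE !delta_conj_entry u0 uM.
have lowlong b' : b1 = eps_dbl ord0 -> blocked b' -> (rev_ord b < b')%N.
  move=> b1E; move: bl; rewrite !blocked_long //= => h1 h2.
  by move: h1 h2; clear; lia.
have hx : x \in lie_span F Psi.
  apply: blocked_span => // b' bl'; rewrite /x mirror0E // (negPf (blocked_0 bl')) andbF.
  case: eqP => [iM|_]; last by rewrite mulr0 subr0.
  have b1E : b1 = eps_dbl ord0 by apply/eqP; rewrite -root_row_max; apply/eqP.
  have := lowlong _ b1E bl'; case: eqP => [->|_ _]; rewrite ?ltnn //=.
  by rewrite mulr0 subr0.
have hz : z \in lie_span F Psi.
  apply: blocked_span => // b' bl'; rewrite zE (negPf (blocked_0 bl')) mulr0.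
  case: eqP => [iM|_]; last by rewrite mul0r mulr0 subr0.
  have b1E : b1 = eps_dbl ord0 by apply/eqP; rewrite -root_row_max; apply/eqP.
  have lt := lowlong _ b1E bl'.
  have -> : GLval u (rev_ord b) b' = 0.
    have := supportedP _ _ (group_U_strict charFp le_rp uU) (rev_ord b) b'.
    rewrite /gtI -leqNgt (ltnW lt) => /(_ isT); rewrite 3!mxE.
    by case: eqP => [E|_]; [rewrite E ltnn in lt | rewrite subr0].
  by rewrite !mulr0 subr0.
have offx : off_border x by move=> a c na nc; apply: border_zero (mirror0_border bl) nc na.
have offz : off_border z.
  by move=> a c na nc; rewrite zE (negPf nc) (negPf na) mul0r !mulr0 subr0.
have [f1 _ ext1] := blockP xi D_col1 D_rest _ fB.
have [f2 _ ext2] := blockP xi D_col1 D_rest _ ufB.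
have := ext2 x hx; rewrite coadj_eval // -/z ext1 //.
rewrite !(off_border_delete b1 (skew_lower_strict _)) // !linear0 !addr0.
rewrite /first_coord c0 eqxx => /(mulfI xi_b1); rewrite zE eqxx mulr1 mirror0E // eqxx andbT.
have -> : (iota == b) = false.
  by move: (blocked_lt bl) => /andP[_]; case: eqP => // ->; rewrite ltnn.
have -> : (ord0 == rev_ord b) = false by rewrite eq_sym rev_ord_max (negPf bM).
rewrite andbF mulr0 subr0; have [iM|iM] := eqVneq iota ord_max; last first.
  by rewrite mul0r mulr0 subr0.
have b1E : b1 = eps_dbl ord0 by apply/eqP; rewrite -root_row_max iM.
have [j bE] : exists j, b = nidx j.
  have [[j bE]|//] := idx_cases b (ltn0Sn n).
  by move: bl; rewrite blocked_long // bE val_pidx leqNgt ltn_ord.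
have uE : GLval u (rev_ord b) ord0 = GLval u^-1 ord_max b.
  have := group_UV charFp le_rp uVU; rewrite invgK => ->; rewrite mxE rev_ordK r0.
  by rewrite bE rev_nidx -pidx0 !half_sign_pidx !mul1r.
have -> : sgn b * sgn ord0 = -1 by rewrite bE -pidx0 half_sign_nidx half_sign_pidx mulr1.
rewrite uE iM mul1r mulN1r opprK.
have := pairing_factor_neq0 bl; rewrite /pairing_factor b1E eqxx => two0; rewrite -mulr2n -[_ *+ 2]mulr_natl => /eqP.
by rewrite mulf_eq0 (negPf two0) => /eqP.
Qed.

End BlockOrbit.

(** * Character sums over the block *)

Section BlockSums.

Variables (n p : nat) (F : finFieldType).
Hypotheses (charFp : p \in [pchar F]) (le_rp : (n.+1.*2 <= p)%N).
Variables (D : {set pos_root n.+1}) (b1 : pos_root n.+1) (xi : pos_root n.+1 -> F).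
Hypothesis D_col1 : D :&: Cset ord0 = if root_col b1 == ord0 then [set b1] else set0.
Hypothesis D_rest : forall be, be \in D -> root_col be != ord0 -> be \in Phi2 b1.
Variable theta : F -> algC.
Hypothesis theta_char : nontrivial_add_char theta.

Local Notation k := (rank_tilde b1).
Local Notation Psi := (Psi b1).
Implicit Types (y : mat F n.+1) (f : udual F n.+1) (al : pos_root n.+1).

Let f0 : udual F n.+1 := rook_form D xi.
Let Omega' := rook_orbit (Dtilde D b1) (xitilde (b1 := b1) xi).

(** Translating the block by a functional that vanishes on Lie(H) but takes on y a
    value where theta is not 1 multiplies the sum by a scalar different from 1. *)
Lemma block_sum_vanish y : skew_lower y -> y \notin lie_span F Psi ->
  \sum_(f in block D b1 xi) theta (dual_eval f y) = 0.
Proof.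
move=> sy ny; have [al aP y0] : exists2 al, al \notin Psi & root_coord al y != 0.
  apply/exists_inP; apply: contraNT ny => /exists_inPn h; apply/lie_spanP; split=> // al aP.
  by apply/eqP/negPn; apply: h.
have [_ thetaM [t0 t0n1]] := theta_char.
pose s : udual F n.+1 := [ffun be => (be == al)%:R * (t0 / root_coord al y)].
have sE : dual_eval s y = t0.
  rewrite /dual_eval (bigD1 al) //= ffunE eqxx mul1r divfK // big1 ?addr0 // => be nb.
  by rewrite ffunE (negPf nb) !mul0r.
have inv f : (f + s \in block D b1 xi) = (f \in block D b1 xi).
  have s0 be : be \in Psi -> s be = 0.
    by rewrite ffunE; case: eqP => [->|]; rewrite ?(negPf aP) // mul0r.
  rewrite !inE; have -> : restrict b1 (f + s) = restrict b1 f.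
    apply/ffunP => be; rewrite !ffunE -[RHS]addr0; congr (_ + _).
    have := s0 (unrelabel be); rewrite ffunE; apply.
    by apply: (subsetP (sub_Phi2_Psi b1)); apply/Phi2P; exists be.
  congr (_ && _).
  apply: eq_forallb => be; case: (boolP (be \in _)) => //= /setDP[bP _].
  by rewrite ffunE s0 // addr0.
have : \sum_(f in block D b1 xi) theta (dual_eval f y)
     = \sum_(f in block D b1 xi) theta (dual_eval f y) * theta t0.
  rewrite [LHS](reindex_inj (addIr s)); apply: eq_big => [f|f _]; first exact: inv.
  by rewrite dual_eval_addl sE thetaM.
rewrite -mulr_suml; set S := \sum_(f in _) _ => ES.
have : S * (1 - theta t0) == 0 by rewrite mulrBr mulr1 -ES subrr.
by rewrite mulf_eq0 subr_eq0 [1 == _]eq_sym (negPf t0n1) orbF => /eqP.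
Qed.

(** A point of the smaller orbit determines an element of the block on Psi, and the
    values on the other roots are free. *)
Lemma block_sum_restrict (E : udual F k -> algC) :
  \sum_(f in block D b1 xi) E (restrict b1 f)
    = (#|F| ^ #|~: Psi|)%:R * \sum_(f' in Omega') E f'.
Proof.
rewrite [LHS](partition_big (fun f : udual F n.+1 => restrict b1 f) (fun g : udual F k => g \in Omega')) /=; last first.
  by move=> f; rewrite inE => /andP[].
rewrite mulr_sumr; apply: eq_bigr => f' f'O.
rewrite (eq_bigr (fun=> E f')) => [|f /andP[_ /eqP->]//].
rewrite sumr_const mulr_natl; congr (_ *+ _).
(* Off Psi the value 0 is an arbitrary choice; f0 is reached on Psi off Phi2. *)
pose base : udual F n.+1 := [ffun al => if al \notin Psi then 0 else
  if [pick al' : pos_root k | unrelabel al' == al] is Some al' then f' al' else f0 al].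
have base_Psi al : al \notin Psi -> base al = 0 by rewrite ffunE => ->.
have base_un (al' : pos_root k) : base (unrelabel al') = f' al'.
  have uP : unrelabel al' \in Psi.
    by apply: (subsetP (sub_Phi2_Psi b1)); apply/Phi2P; exists al'.
  rewrite ffunE uP /=; case: pickP => [be /eqP/unrelabel_inj->//|/(_ al')].
  by rewrite eqxx.
have base_f0 al : al \in Psi :\: Phi2 b1 -> base al = f0 al.
  rewrite in_setD => /andP[n2 aP]; rewrite ffunE aP /=; case: pickP => // be /eqP bE.
  by case/negP: n2; apply/Phi2P; exists be.
rewrite -(card_pffun_on (0 : F) (~: Psi) predT).
rewrite -[RHS](card_imset _ (addrI base)) -[LHS]cardsE; apply: eq_card => f.
rewrite in_set; apply/andP/imsetP.
  case; rewrite inE => /andP[_ /forallP fE] /eqP fr.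
  exists (f - base); last by rewrite addrC subrK.
  apply/pffun_onP; split=> //; apply/subsetP => al; rewrite in_setC -[X in X -> _]/(is_true ((f - base) al != 0)) 2!ffunE.
  apply: contraNN => aP; have [a2|n2] := boolP (al \in Phi2 b1).
    have /Phi2P[al' <-] := a2; by rewrite base_un -fr ffunE subrr eqxx.
  have aD : al \in Psi :\: Phi2 b1 by rewrite in_setD n2 aP.
  by rewrite base_f0 // (eqP (implyP (fE al) aD)) subrr eqxx.
case=> l /pffun_onP[/subsetP ls _] ->.
have l0 al : al \in Psi -> l al = 0.
  by move=> aP; apply/eqP; apply: contraTT aP => h; have := ls al h; rewrite inE.
have res : restrict b1 (base + l) = f'.
  apply/ffunP => al'; rewrite !ffunE -[RHS]base_un ffunE l0 ?addr0 //.
  by apply: (subsetP (sub_Phi2_Psi b1)); apply/Phi2P; exists al'.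
split; last by rewrite res.
rewrite inE res f'O; apply/forallP => al; apply/implyP => aD.
by rewrite ffunE base_f0 // l0 ?addr0 //; case/setDP: aD.
Qed.

Lemma card_block_restrict : #|block D b1 xi| = (#|F| ^ #|~: Psi| * #|Omega'|)%N.
Proof.
apply/eqP; rewrite -(eqr_nat algC) natrM -[#|block _ _ _|%:R]mulr1 -[#|Omega'|%:R]mulr1.
have := block_sum_restrict (fun=> 1); rewrite !sumr_const => ->.
by rewrite !mulr1.
Qed.

End BlockSums.

(** * The inducing function *)

Section Remainder.

Variables (m : nat) (R : finComUnitRingType).
Implicit Types (A B : {set {'GL_m[R]}}) (g : {'GL_m[R]}).

(** The remainder is defined by choice as a representative in B of the coset of g
    modulo A; all that is used about it is that it is one. *)
Lemma remgr_spec A B g : (forall a, a \in A -> (a^-1)%g \in A) ->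
    (exists2 c, c \in B & (g * c^-1)%g \in A) ->
  remgr A B g \in B /\ (g * (remgr A B g)^-1)%g \in A.
Proof.
move=> AV [c cB gcA].
have cAB : c \in (A :* g :&: B)%g.
  rewrite inE cB andbT; apply/rcosetP; exists (c * g^-1)%g; last by rewrite mulgKV.
  by rewrite -[(c * g^-1)%g]invgK invMg invgK AV.
have := mem_repr c cAB; rewrite -/(remgr A B g) inE => /andP[/rcosetP[a aA E] rB].
by split=> //; rewrite E invMg mulKVg AV.
Qed.

End Remainder.

Section InducingFunction.

Variables (n p : nat) (F : finFieldType).
Hypotheses (charFp : p \in [pchar F]) (le_rp : (n.+1.*2 <= p)%N).
Variables (D : {set pos_root n.+1}) (b1 : pos_root n.+1) (xi : pos_root n.+1 -> F).
Hypothesis D_col1 : D :&: Cset ord0 = if root_col b1 == ord0 then [set b1] else set0.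
Hypothesis D_rest : forall be, be \in D -> root_col be != ord0 -> be \in Phi2 b1.
Variable theta : F -> algC.
Hypothesis theta_char : nontrivial_add_char theta.

Local Notation k := (rank_tilde b1).
Local Notation Psi := (Psi b1).
Local Notation del := (@delete n b1 F).
Implicit Types (y : mat F n.+1) (f : udual F n.+1) (al : pos_root n.+1).
Implicit Types (g : {'GL_(n.+1.*2)[F]}).

Let le_kp := le_kp le_rp b1.
Let PP := pattern_of_Psi b1.

Lemma Psi_setD_Phi1 : Psi :\: Phi1 b1 = Cprime D.
Proof.
apply/setP => al; rewrite in_setD (CprimeE D_col1) Phi1E negb_and negbK.
by case: (al \in Psi); rewrite ?andbF ?andbT.
Qed.

Lemma sub_Cprime_Psi2 : Cprime D \subset Psi :\: Phi2 b1.
Proof. by rewrite -Psi_setD_Phi1 setDS // sub_Phi2_Phi1. Qed.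

Lemma U1_split g : g \in exp_span F Psi ->
  exists2 c, c \in group_Vprime F b1 & (g * c^-1)%g \in group_U1 F D.
Proof.
move=> gH; rewrite /group_U1 -Psi_setD_Phi1.
have mM : {in supported (H_pattern b1) &, forall x y, middle (F := F) (x * y) = middle x * middle y}.
  by move=> x y hx hy; apply: middleM; apply: (supported_gtI (strict_H_pattern b1)).
exact: (quotient_split charFp le_rp PP mM (@middle_strict _ _) (sub_Phi1_Psi b1)
  (@middle_eq0 _ b1 F) gH).
Qed.

Lemma V1_split g : g \in group_Vprime F b1 ->
  exists2 c, c \in group_Utilde F b1 & (g * c^-1)%g \in group_V1 F b1.
Proof.
move=> gV.
have dM : {in supported (V_pattern b1) &, forall x y, del (x * y) = del x * del y}.
  by move=> x y hx hy; apply: deleteM; [move: hx | move: hy];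
    apply: supported_subset => a b /andP[].
apply: (quotient_split charFp le_rp (pattern_of_Phi1 b1) dM (@delete_strict _ _ _)
  (sub_Phi2_Phi1 b1) _ gV).
move=> x /lie_spanP[sx x0]; apply: delete_eq0; apply/lie_spanP; split=> // al nP.
by apply: x0; apply: contra nP; apply: (subsetP (sub_Phi1_Psi b1)).
Qed.

Lemma H_group_eq : (group_U1 F D * group_Vprime F b1)%g = exp_span F Psi.
Proof.
apply/setP => g; apply/mulsgP/idP => [[a b aU bV ->]|gH].
  apply: (exp_spanM charFp le_rp PP).
    apply: (subsetP (exp_span_subset F _)) aU.
    exact: subset_trans sub_Cprime_Psi2 (subsetDl _ _).
  exact: (subsetP (exp_span_subset F (sub_Phi1_Psi b1))) bV.
have [c cV gcU] := U1_split gH.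
by exists (g * c^-1)%g c => //; rewrite mulgKV.
Qed.

Lemma first_coord_ln g : g \in exp_span F Psi ->
  first_coord b1 xi (ln_gl g) = first_coord b1 xi (GLval g - 1).
Proof.
move=> gH; have [_ eg] := ln_glP charFp le_rp (exp_span_sub_U gH).
by rewrite -{2}eg (first_coord_exp charFp le_rp) // (ln_exp_span charFp le_rp).
Qed.

(** Write g = a d c with a in U1, d in V1 and c in U-tilde. Additivity of the entry
    of b1 gives psi a in terms of ln g, and c has the same image as g in the
    quotient because a and d are in the kernel. *)
Lemma inducing_funE g : g \in exp_span F Psi ->
  inducing_fun theta D b1 xi g =
    (sqrtC #|rook_orbit (Dtilde D b1) (xitilde (b1 := b1) xi)|%:R)^-1 *
    \sum_(f' in rook_orbit (Dtilde D b1) (xitilde (b1 := b1) xi))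
      theta (first_coord b1 xi (ln_gl g) + dual_eval f' (delete b1 (ln_gl g))).
Proof.
move=> gH; have [_ thetaM _] := theta_char; rewrite /inducing_fun.
have invA (A : {set pos_root n.+1}) a : a \in exp_span F A -> (a^-1)%g \in exp_span F A.
  exact: (exp_spanV charFp le_rp).
have [] := remgr_spec (invA _) (U1_split gH).
rewrite /divgr; move: (remgr _ _ g) => b bV aU.
have [] := remgr_spec (invA _) (V1_split bV).
move: (remgr _ _ b) => c cU dV.
have gE := esym (mulgKV b g); have bE := esym (mulgKV c b).
move: gE bE aU dV; set a := (g * b^-1)%g; set d := (b * c^-1)%g.
move: a d => a d gE bE aU dV.
have sub (A : {set pos_root n.+1}) x : A \subset Psi -> x \in exp_span F A -> x \in exp_span F Psi.
  by move=> sA; apply: (subsetP (exp_span_subset F sA)).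
have aH : a \in exp_span F Psi.
  by apply: sub aU; apply: subset_trans sub_Cprime_Psi2 (subsetDl _ _).
have bH : b \in exp_span F Psi by apply: sub bV; apply: sub_Phi1_Psi.
have cH : c \in exp_span F Psi by apply: sub cU; apply: sub_Phi2_Psi.
have dH : d \in exp_span F Psi.
  by apply: sub dV; apply: subset_trans (subsetDl _ _) (sub_Phi1_Psi b1).
have qker x : x \in exp_span F (Psi :\: Phi2 b1) -> group_quotient del x = 1.
  exact: (quotient_ker charFp le_rp PP (@deleteM _ _ _) (@delete_strict _ _ _) (@delete_eq0 _ _ _)).
have qM := quotientM charFp le_rp PP (@deleteM n b1 F).
have dln : delete b1 (ln_gl c) = delete b1 (ln_gl g).
  apply: (quotient_inj charFp le_rp PP (@deleteM n b1 F) (@delete_strict n b1 F)) => //.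
  have qa : group_quotient del a = 1.
    by apply: qker; apply: (subsetP (exp_span_subset F sub_Cprime_Psi2)) aU.
  have qd : group_quotient del d = 1.
    by apply: qker; apply: (subsetP (exp_span_subset F (setSD _ (sub_Phi1_Psi b1)))) dV.
  by rewrite gE (qM _ _ aH bH) qa mul1r bE (qM _ _ dH cH) qd mul1r.
have -> : psi theta D xi a = theta (first_coord b1 xi (ln_gl g)).
  have la := ln_exp_span charFp le_rp aU; have laH := ln_exp_span charFp le_rp aH.
  rewrite /psi (rook_form_split xi D_col1 D_rest).
  rewrite [delete b1 (ln_gl a)](_ : _ = 0) ?linear0 ?addr0; last first.
    apply/eqP/delete_eq0 => // al a2; case/lie_spanP: la => _; apply.
    by apply: contraL a2 => /(subsetP sub_Cprime_Psi2); rewrite in_setD => /andP[].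
  congr theta; rewrite (first_coord_ln gH) gE GL_ME.
  rewrite first_coord_groupM ?(H_supported charFp le_rp) // -!first_coord_ln //.
  rewrite [X in _ + X](_ : _ = 0) ?addr0 // /first_coord.
  case: eqP => [c0|_]; last by rewrite mul0r.
  have /lie_spanP[_ lb] := ln_exp_span charFp le_rp bV.
  by have := lb b1; rewrite Phi1E c0 eqxx andbF /root_coord c0 => ->; rewrite ?mulr0.
rewrite /chi_tilde /orbit_char.
have sc := lie_span_skew (ln_exp_span charFp le_rp cH).
rewrite (lie_relabelE b1 sc) (exp_glK charFp le_kp (delete_skew b1 sc)) dln.
rewrite mulrCA; congr (_ * _); rewrite mulr_sumr; apply: eq_bigr => f' _.
by rewrite thetaM.
Qed.

End InducingFunction.

(** * The theorem *)

Section Placement.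

Variables (n : nat) (D : {set pos_root n.+1}) (b1 : pos_root n.+1) (bs : seq (pos_root n.+1)).
Hypothesis D_sorted : sorted (@root_gt n.+1) (b1 :: bs).
Hypothesis D_eq : D = [set b in b1 :: bs].
Hypothesis D_rook : orthogonal_rook_placement D.

Lemma first_root_in : b1 \in D.
Proof. by rewrite D_eq inE mem_head. Qed.

Lemma first_root_col be : be \in D -> (root_col b1 <= root_col be)%N.
Proof.
have tr : transitive (@root_gt n.+1).
  move=> y x z; rewrite /root_gt /root_lt.
  move=> /orP[h1|/andP[/eqP e1 h1]] /orP[h2|/andP[/eqP e2 h2]].
  - by rewrite (ltn_trans h1 h2).
  - by rewrite -e2 h1.
  - by rewrite e1 h2.
  - by rewrite e1 e2 eqxx (ltn_trans h1 h2) orbT.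
rewrite D_eq inE in_cons => /orP[/eqP->//|].
have /allP h := order_path_min tr D_sorted.
by move/h; rewrite /root_gt /root_lt => /orP[/ltnW//|/andP[/eqP-> _]].
Qed.

Lemma placement_col1 : D :&: Cset ord0 = if root_col b1 == ord0 then [set b1] else set0.
Proof.
have [_ _ /(_ ord0) Dc] := D_rook; have [c0|c0] := eqVneq (root_col b1) ord0.
  apply/esym/eqP; rewrite eqEcard cards1 Dc andbT sub1set inE first_root_in inE c0.
  by rewrite eqxx.
apply/setP => be; rewrite !inE; apply/negP => /andP[/first_root_col h /eqP c].
by move: h; rewrite c leqn0; apply/negP.
Qed.

(** If b1 is a short root of the first column, its inner product with a root outside
    the first column is, up to sign, the coefficient of that root at the second
    index of b1; orthogonality thus removes this index from the rest of D. *)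
Lemma placement_rest be : be \in D -> root_col be != ord0 -> be \in Phi2 b1.
Proof.
move=> beD be0; rewrite Phi2E; apply/forallP => i; apply/implyP => ni.
have [i0|i0] := eqVneq i ord0; first by rewrite i0 (coef_col0_le be0).
have [c0 nl io] := rest_idx_out ni i0.
have [orth _ _] := D_rook.
have ne : b1 != be by apply: contraNneq be0 => <-; rewrite c0.
have := orth _ _ first_root_in beD ne; rewrite /root_orth.
have be00 := coef_col0_le be0; rewrite /coef in be00 *.
case E: {-}b1 / (first_rootP b1) => [b cb||j h|j h].
- by rewrite -E c0 eqxx in cb.
- by rewrite E eqxx in nl.
- have ij : i = j.
    move: io; rewrite E /root_row => -[/pidx_inj//|/eqP].
    by rewrite eq_sym nidx_pidx.
  by rewrite E ij dotvDl dotvNl !dotv_delta be00 add0r oppr_eq0.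
have ij : i = j.
  by move: io; rewrite E /root_row => -[/eqP|/nidx_inj//]; rewrite nidx_pidx.
by rewrite E ij dotvDl !dotv_delta be00 add0r.
Qed.

End Placement.

Theorem theorem3p8 (n p : nat) (F : finFieldType)
    (Fp : p \in [pchar F]) (p_large : (2 * n.+1 <= p)%N)
    (theta : F -> algC) (theta_char : nontrivial_add_char theta)
    (D : {set pos_root n.+1})
    (b1 : pos_root n.+1) (bs : seq (pos_root n.+1))
    (D_sorted : sorted (@root_gt n.+1) (b1 :: bs))
    (D_eq : D = [set b in b1 :: bs])
    (D_rook : orthogonal_rook_placement D)
    (xi : pos_root n.+1 -> F) (xi_neq0 : {in D, forall b, xi b != 0}) :
  exists (U H : {group {'GL_(n.+1.*2)[F]}}) (chi : 'CF(U)) (phi : 'CF(H)),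
    [/\ U = group_U F n.+1 :> {set _},
        H = (group_U1 F D * group_Vprime F b1)%g :> {set _},
        {in U, chi =1 orbit_char theta (rook_orbit D xi)},
        {in H, phi =1 inducing_fun theta D b1 xi}
      & chi = 'Ind[U, H] phi].
Proof.
have le_rp : (n.+1.*2 <= p)%N by rewrite -mul2n.
have D_col1 := placement_col1 D_sorted D_eq D_rook.
have D_rest := placement_rest D_eq D_rook.
have xi_b1 : xi b1 != 0 by apply/xi_neq0/(first_root_in D_eq).
pose U := Group (group_U_group_set Fp le_rp).
pose H := Group (exp_span_group_set Fp le_rp (pattern_of_Psi b1)).
have sHU : H \subset U by apply/subsetP => g; apply: exp_span_sub_U.
pose e g (f : udual F n.+1) := theta (dual_eval f (ln_gl g)).
have actM : {in U &, forall g h f, coadj (g * h)%g f = coadj g (coadj h f)}.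
  by move=> g h gU hU f; apply: (coadjM Fp le_rp).
have e_conj : {in U &, forall g u f, e (g ^ u)%g f = e g (coadj u f)}.
  move=> g u gU uU f; have [sg _] := ln_glP Fp le_rp gU.
  by rewrite /e (ln_gl_conj Fp le_rp) // coadj_eval.
have f0B := f0_block Fp le_rp xi D_col1 D_rest.
have sub := block_sub_orbit Fp le_rp D_col1 D_rest xi_b1.
have ret u f (uU : u \in U) (fB : f \in block D b1 xi) (ufB : coadj u f \in block D b1 xi) :
  u \in H := block_return Fp le_rp D_col1 D_rest xi_b1 uU fB ufB.
have stab := block_stable Fp le_rp D_col1 D_rest (xi := xi).
have vanish g : g \in U -> g \notin H -> \sum_(f in block D b1 xi) e g f = 0.
  move=> gU gH; have [sg eg] := ln_glP Fp le_rp gU.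
  apply: (block_sum_vanish D xi theta_char sg).
  by apply: contra gH => hy; rewrite -eg; apply: exp_span_mem.
pose q := (#|F| ^ #|~: Psi b1|)%N.
have q0 : (q%:R : algC) != 0.
  by rewrite pnatr_eq0 -lt0n expn_gt0; apply/orP; left; apply/card_gt0P; exists 0.
(* The translates of the block tile the orbit, and |U| / |H| = q. *)
have cardO : #|rook_orbit D xi| = (q ^ 2 * #|rook_orbit (Dtilde D b1) (xitilde (b1 := b1) xi)|)%N.
  have := card_block sHU (@coadj1 F n.+1) actM f0B sub ret stab.
  rewrite (card_block_restrict D b1 xi) (card_exp_span Fp le_rp) (card_exp_span Fp le_rp).
  rewrite cardsT -(cardsC (Psi b1)) expnD -/q.
  have qP : (0 < #|F| ^ #|Psi b1|)%N.
    by rewrite expn_gt0; apply/orP; left; apply/card_gt0P; exists 0.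
  rewrite -mulnA => /eqP; rewrite eqn_pmul2l // mulnA => /eqP <-.
  by rewrite mulnn.
have [chi [phi [chiE phiE ind]]] := Ind_block sHU (@coadj1 F n.+1) actM e_conj f0B sub ret stab
  vanish (sqrtC #|rook_orbit D xi|%:R)^-1.
exists U, H, chi, phi; split=> //; first by rewrite (H_group_eq Fp le_rp D_col1).
move=> g gH; rewrite phiE // (inducing_funE Fp le_rp xi D_col1 D_rest theta_char gH).
have eE f : f \in block D b1 xi -> e g f =
    theta (first_coord b1 xi (ln_gl g) + dual_eval (restrict b1 f) (delete b1 (ln_gl g))).
  move=> fB; rewrite /e (block_eval D_col1 D_rest fB) //.
  exact: (ln_exp_span Fp le_rp).
rewrite (eq_bigr _ eE) (block_sum_restrict D xi (fun f' => theta (first_coord b1 xi (ln_gl g)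
  + dual_eval f' (delete b1 (ln_gl g))))) -/q.
rewrite mulrA cardO natrM (natrX _ q 2).
have q_ge0 : 0 <= (q%:R : algC) by exact: ler0n.
have q2_nneg : (q%:R : algC) ^+ 2 \is Num.nneg by rewrite nnegrE exprn_ge0.
rewrite (sqrtCM q2_nneg) ?nnegrE ?ler0n // (sqrCK q_ge0).
by rewrite invfM [q%:R^-1 * _]mulrC mulfVK.
Qed.
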